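(* For $\mathbf G=SL_2(\bar{\mathbb F}_q)$, the category $\mathscr C(\mathbf G)$ is a highest weight category.
   Context: Let $\mathbb{F}_q$ be a finite field with $q$ elements, $\bar{\mathbb{F}}_q$ its algebraic closure, and $\Bbbk$ an algebraically closed field of characteristic $0$. Let $\mathbf G=SL_2(\bar{\mathbb F}_q)$, regarded as an abstract group, with $\Bbbk\mathbf G$ its group algebra. Let $\mathbf T$, $\mathbf B$, $\mathbf U$ be the subgroups of diagonal, upper triangular, and upper unitriangular matrices respectively. Let $\widehat{\mathbf T}$ be the set of all (abstract) group homomorphisms $\mathbf T\to\Bbbk^*$. For a $\Bbbk\mathbf G$-module $M$ and $\lambda\in\widehat{\mathbf T}$ let $M_\lambda=\{\xi\in M\mid t\xi=\lambda(t)\xi\ \forall t\in\mathbf T\}$, $M^{\mathbf T}=\bigoplus_{\lambda\in\widehat{\mathbf T}}M_\lambda$ and $\mathfrak d(M)=\dim M^{\mathbf T}$. A $\mathbf T$-eigenvector is an element of some $M_\lambda$. The category $\mathscr C(\mathbf G)$ is the full subcategory of the category of $\Bbbk\mathbf G$-modules whose objects are those $M$ such that $n=\mathfrak d(M)<+\infty$ and there exist $\mathbf T$-eigenvectors $\xi_1,\dots,\xi_n\in M$ with $M\cong\bigoplus_{i=1}^n\Bbbk\mathbf U\xi_i$ as $\Bbbk\mathbf B$-modules. Definition (highest weight category, Cline–Parshall–Scott). Let $\mathscr C$ be a locally artinian (every object is the union of its subobjects of finite length), abelian, $\Bbbk$-linear category with enough injective objects that satisfies Grothendieck's condition ($B\cap(\bigcup_\alpha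 A_\alpha)=\bigcup_\alpha(B\cap A_\alpha)$ for a subobject $B$ and a directed family of subobjects $\{A_\alpha\}$ of an object). Then $\mathscr C$ is a highest weight category if there exists a locally finite poset $\Lambda$ (all intervals are finite) such that: (a) There is a complete collection $\{S(\lambda)\}_{\lambda\in\Lambda}$ of non-isomorphic simple objects of $\mathscr C$ indexed by $\Lambda$. (b) There is a collection $\{A(\lambda)\}_{\lambda\in\Lambda}$ of objects of $\mathscr C$ and, for each $\lambda$, an embedding $S(\lambda)\subset A(\lambda)$ such that all composition factors $S(\mu)$ of $A(\lambda)/S(\lambda)$ satisfy $\mu<\lambda$. For $\lambda,\mu\in\Lambda$, $\dim_\Bbbk\operatorname{Hom}_{\mathscr C}(A(\lambda),A(\mu))$ and the multiplicity $[A(\lambda):S(\mu)]$ are finite. (c) Each simple object $S(\lambda)$ has an injective envelope $\mathcal I(\lambda)$ in $\mathscr C$, and $\mathcal I(\lambda)$ has a filtration $0=F_0(\lambda)\subset F_1(\lambda)\subset\cdots$ such that: (i) $F_1(\lambda)\cong A(\lambda)$; (ii) for $n>1$, $F_n(\lambda)/F_{n-1}(\lambda)\cong A(\mu)$ for some $\mu=\mu(n)>\lambda$; (iii) for a given $\mu\in\Lambda$, $\mu=\mu(n)$ for only finitely many $n$; (iv) $\bigcup_iF_i(\lambda)=\mathcal I(\lambda)$. (The filtration may be finite.) *)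

(* Defs.v *)
From HB Require Import structures.
From mathcomp Require Import all_boot all_order all_algebra.
From mathcomp Require Import all_classical.

Set Implicit Arguments.
Unset Strict Implicit.
Unset Printing Implicit Defensive.

Import Order.TTheory GRing.Theory.
Local Open Scope classical_set_scope.
Local Open Scope ring_scope.

Section LinearAlgebra.
Context {k : fieldType} {V : lmodType k}.

Definition lin_span (A : set V) : set V :=
  [set v | exists n (c : 'I_n -> k) (x : 'I_n -> V),
     (forall i, A (x i)) /\ v = \sum_(i < n) c i *: x i].

Definition lin_indep n (e : 'I_n -> V) :=
  forall c : 'I_n -> k, \sum_(i < n) c i *: e i = 0 -> forall i, c i = 0.

Definition has_dim (W : set V) (n : nat) :=
  exists e : 'I_n -> V, lin_indep e /\ lin_span (range e) = W.

End LinearAlgebra.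

Record lincat (k : fieldType) := LinCat {
  obj :> Type;
  mor : obj -> obj -> lmodType k;
  idc : forall X, mor X X;
  compc : forall X Y Z, mor Y Z -> mor X Y -> mor X Z;
  compA : forall X Y Z W (h : mor Z W) (g : mor Y Z) (f : mor X Y),
    compc h (compc g f) = compc (compc h g) f;
  comp1c : forall X Y (f : mor X Y), compc (idc Y) f = f;
  compc1 : forall X Y (f : mor X Y), compc f (idc X) = f;
  comp_linearl : forall X Y Z (f : mor X Y),
    linear (fun g : mor Y Z => compc g f);
  comp_linearr : forall X Y Z (g : mor Y Z),
    linear (fun f : mor X Y => compc g f)
}.

Arguments mor {k l} X Y.
Arguments idc {k l} X.
Arguments compc {k l X Y Z} g f.

Notation "g \c f" := (compc g f) (at level 50, left associativity).

Definition full_subcat (k : fieldType) (C : lincat k) (P : C -> Prop) :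
    lincat k :=
  @LinCat k {X : C | P X}
    (fun X Y => mor (sval X) (sval Y))
    (fun X => idc (sval X))
    (fun X Y Z g f => g \c f)
    (fun X Y Z W => @compA k C (sval X) (sval Y) (sval Z) (sval W))
    (fun X Y => @comp1c k C (sval X) (sval Y))
    (fun X Y => @compc1 k C (sval X) (sval Y))
    (fun X Y Z => @comp_linearl k C (sval X) (sval Y) (sval Z))
    (fun X Y Z => @comp_linearr k C (sval X) (sval Y) (sval Z)).

Section Categories.
Context {k : fieldType} {C : lincat k}.
Implicit Types X Y Z W Q : C.

Definition mono X Y (f : mor X Y) :=
  forall W (g h : mor W X), f \c g = f \c h -> g = h.

Definition epi X Y (f : mor X Y) :=
  forall W (g h : mor Y W), g \c f = h \c f -> g = h.

Definition isomorphic X Y :=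
  exists (f : mor X Y) (g : mor Y X), g \c f = idc X /\ f \c g = idc Y.

Definition is_zero X :=
  forall Y, (forall f : mor X Y, f = 0) /\ (forall f : mor Y X, f = 0).

Definition is_product X Y P (p : mor P X) (q : mor P Y) :=
  forall W (f : mor W X) (g : mor W Y),
    exists! h : mor W P, p \c h = f /\ q \c h = g.

Definition is_kernel X Y K (f : mor X Y) (i : mor K X) :=
  f \c i = 0 /\
  forall W (g : mor W X), f \c g = 0 -> exists! h : mor W K, i \c h = g.

Definition is_cokernel X Y Q (f : mor X Y) (p : mor Y Q) :=
  p \c f = 0 /\
  forall W (g : mor Y W), g \c f = 0 -> exists! h : mor Q W, h \c p = g.

Definition injective_obj (I : C) :=
  forall X Y (i : mor X Y) (f : mor X I), mono i ->
    exists g : mor Y I, g \c i = f.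

Record subobj X := Subobj {
  sdom : C;
  sinc : mor sdom X;
  sinc_mono : mono sinc
}.

Lemma mono_idc X : mono (idc X).
Proof. by move=> W g h; rewrite !comp1c. Qed.

Definition subT X : subobj X := Subobj (@mono_idc X).

Definition sub_le X (A B : subobj X) :=
  exists f : mor (sdom A) (sdom B), sinc B \c f = sinc A.

Definition is_meet X (A B M : subobj X) :=
  [/\ sub_le M A, sub_le M B
    & forall N, sub_le N A -> sub_le N B -> sub_le N M].

Definition is_union X (I : Type) (A : I -> subobj X) (U : subobj X) :=
  (forall i, sub_le (A i) U) /\
  (forall V, (forall i, sub_le (A i) V) -> sub_le U V).

Definition directed X (I : Type) (A : I -> subobj X) :=
  inhabited I /\
  forall i j, exists l, sub_le (A i) (A l) /\ sub_le (A j) (A l).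

(* [A] is contained in [B] and [B / A] is isomorphic to [Q]. *)
Definition is_subquo X (A B : subobj X) Q :=
  exists (i : mor (sdom A) (sdom B)) (p : mor (sdom B) Q),
    sinc B \c i = sinc A /\ is_cokernel i p.

Definition simple_obj X :=
  ~ is_zero X /\
  forall A : subobj X, is_zero (sdom A) \/ sub_le (subT X) A.

Definition comp_series X (m : nat) (F : nat -> subobj X) :=
  [/\ is_zero (sdom (F 0%N)), sub_le (subT X) (F m)
    & forall i, (i < m)%N ->
        exists Q, simple_obj Q /\ is_subquo (F i) (F i.+1) Q].

Definition finite_length X := exists m F, @comp_series X m F.

Definition series_mult X (m : nat) (F : nat -> subobj X) (S : C) : nat :=
  #|[pred i : 'I_m | `[< is_subquo (F i) (F i.+1) S >]]|.

(* As usual in a locally artinian category, composition factors and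
   multiplicities of an object are those of its subobjects of finite length:
   [X : S] is the supremum of [B : S] over these subobjects [B]. *)
Definition is_comp_factor (S X : C) :=
  simple_obj S /\
  exists (B : subobj X) m (F : nat -> subobj (sdom B)),
    comp_series m F /\ (0 < series_mult m F S)%N.

Definition finite_mult (X S : C) :=
  exists N : nat, forall (B : subobj X) m (F : nat -> subobj (sdom B)),
    comp_series m F -> (series_mult m F S <= N)%N.

Definition injective_envelope (S I : C) (e : mor S I) :=
  injective_obj I /\
  exists he : mono e, forall A M : subobj I,
    ~ is_zero (sdom A) -> is_meet (Subobj he) A M -> ~ is_zero (sdom M).

End Categories.

Section HighestWeight.
Context {k : fieldType} (C : lincat k).

Definition abelian_cat :=
  (exists Z : C, is_zero Z) /\
  (forall X Y : C, exists (P : C) (p : mor P X) (q : mor P Y),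
     is_product p q) /\
  (forall (X Y : C) (f : mor X Y), exists (K : C) (i : mor K X),
     is_kernel f i) /\
  (forall (X Y : C) (f : mor X Y), exists (Q : C) (p : mor Y Q),
     is_cokernel f p) /\
  (forall (X Y : C) (f : mor X Y), mono f ->
     exists (Z : C) (g : mor Y Z), is_kernel g f) /\
  (forall (X Y : C) (f : mor X Y), epi f ->
     exists (Z : C) (g : mor Z X), is_cokernel g f).

Definition locally_artinian :=
  forall X : C,
    is_union (fun B : {B : subobj X | finite_length (sdom B)} => sval B)
      (subT X).

Definition enough_injectives :=
  forall X : C, exists (I : C) (i : mor X I), injective_obj I /\ mono i.

(* The condition includes the existence of the unions involved. *)
Definition grothendieck_condition :=
  forall (X : C) (B : subobj X) (I : Type) (A BA : I -> subobj X),
    directed A -> (forall i, is_meet B (A i) (BA i)) ->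
    exists U BU, [/\ is_union A U, is_meet B U BU & is_union BA BU].

Definition locally_finite d (L : porderType d) :=
  forall x y : L, finite_set [set z : L | (x <= z <= y)%O].

Definition complete_simples (I : Type) (S : I -> C) :=
  [/\ forall l, simple_obj (S l),
      forall l m, isomorphic (S l) (S m) -> l = m
    & forall X : C, simple_obj X -> exists l, isomorphic X (S l)].

(* The terms [F n] of a filtration are those with [in_range len n]; the
   filtration is infinite when [len] is [None]. *)
Definition in_range (len : option nat) (n : nat) : bool :=
  if len is Some m then (n <= m)%N else true.

Definition good_filtration d (L : porderType d) (A : L -> C) (l : L) (I : C)
    (len : option nat) (F : nat -> subobj I) (mu : nat -> L) :=
  [/\ is_zero (sdom (F 0%N)),
      forall n, in_range len n.+1 -> sub_le (F n) (F n.+1),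
      in_range len 1 /\ isomorphic (sdom (F 1%N)) (A l)
    & [/\ forall n, (1 < n)%N -> in_range len n ->
            is_subquo (F n.-1) (F n) (A (mu n)) /\ (l < mu n)%O,
          forall m : L,
            finite_set [set n | [/\ (1 < n)%N, in_range len n & mu n = m]]
        & is_union (fun n : {n | in_range len n} => F (sval n)) (subT I)]].

Definition highest_weight_category :=
  [/\ locally_artinian, abelian_cat, enough_injectives,
      grothendieck_condition
    & exists (d : Order.disp_t) (L : porderType d) (S A : L -> C)
        (e : forall l, mor (S l) (A l)),
      [/\ locally_finite L,
          complete_simples S,
          (forall l, mono (e l) /\
             forall (Q : C) (p : mor (A l) Q), is_cokernel (e l) p ->
             forall m, is_comp_factor (S m) Q -> (m < l)%O),
          (forall l m,
             (exists n, has_dim [set: mor (A l) (A m)] n) /\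
             finite_mult (A l) (S m))
        & forall l, exists (I : C) (i : mor (S l) I),
            injective_envelope i /\
            exists len F mu, good_filtration A l (I := I) len F mu]].

End HighestWeight.

(* A [kH]-module is encoded as a [k]-linear action of [H] on a [k]-vector space. *)
Record gmod (k : fieldType) (H : groupType) := GMod {
  gcar :> lmodType k;
  gact : H -> gcar -> gcar;
  gact_linear : forall h, linear (gact h);
  gact1 : forall v, gact 1%g v = v;
  gactM : forall g h v, gact (g * h)%g v = gact g (gact h v)
}.

Section GModHom.
Context (k : fieldType) (H : groupType) (M N : gmod k H).

Definition gmod_hom_pred : {pred M -> N} := fun f =>
  `[< linear f /\ forall h v, f (gact h v) = gact h (f v) >].

Record gmod_hom := GModHom {
  gmod_fun :> M -> N;
  gmod_homP : gmod_fun \in gmod_hom_pred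
}.

HB.instance Definition _ := [isSub for gmod_fun].
HB.instance Definition _ := [Choice of gmod_hom by <:].

Fact gmod_hom_submod_closed : submod_closed gmod_hom_pred.
Proof.
have gact0 h : gact h 0 = 0 :> N.
  have := @gact_linear k H N h (-1) 0 0.
  by rewrite scaleN1r addNr scaleN1r addNr.
split; first by apply/asboolP; split=> [a u v|h v] /=;
  [rewrite /= scaler0 addr0 | rewrite gact0].
move=> a f g /asboolP[fl fh] /asboolP[gl gh]; apply/asboolP; split.
  move=> b u v; rewrite !fctE fl gl !scalerDr !scalerA mulrC.
  by rewrite addrACA.
by move=> h v; rewrite !fctE fh gh -gact_linear.
Qed.

HB.instance Definition _ := GRing.isSubmodClosed.Build k (M -> N)
  gmod_hom_pred gmod_hom_submod_closed.
HB.instance Definition _ := [SubChoice_isSubLmodule of gmod_hom by <:].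

Lemma gmod_hom_linear (f : gmod_hom) : linear f.
Proof. by case: f => f /= /asboolP[]. Qed.

Lemma gmod_hom_act (f : gmod_hom) h v : f (gact h v) = gact h (f v).
Proof. by case: f => f /= /asboolP[_ ->]. Qed.

End GModHom.

Section GModCat.
Context (k : fieldType) (H : groupType).
Implicit Types M N P : gmod k H.

Fact gmod_id_subproof M : id \in @gmod_hom_pred k H M M.
Proof. exact/asboolP. Qed.

Definition gmod_id M : gmod_hom M M := GModHom (gmod_id_subproof M).

Fact gmod_comp_subproof M N P (g : gmod_hom N P) (f : gmod_hom M N) :
  g \o f \in @gmod_hom_pred k H M P.
Proof.
apply/asboolP; split=> [a u v|h v] /=.
  by rewrite !gmod_hom_linear.
by rewrite !gmod_hom_act.
Qed.

Definition gmod_comp M N P (g : gmod_hom N P) (f : gmod_hom M N) :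
  gmod_hom M P := GModHom (gmod_comp_subproof g f).

Definition gmod_cat : lincat k.
Proof.
refine (@LinCat k (gmod k H) (fun M N => gmod_hom M N) gmod_id gmod_comp
  _ _ _ _ _).
- by move=> *; apply/val_inj.
- by move=> *; apply/val_inj.
- by move=> *; apply/val_inj.
- by move=> M N P f a u v; apply/val_inj; apply/funext.
- by move=> M N P g a u v; apply/val_inj; apply/funext => x;
    exact: (gmod_hom_linear g a (u x) (v x)).
Defined.

End GModCat.

Section SL2.
Context (F : fieldType).

Record SL2 := MkSL2 {
  SL2val :> 'M[F]_2;
  SL2P : \det SL2val == 1
}.

HB.instance Definition _ := [isSub for SL2val].
HB.instance Definition _ := [Choice of SL2 by <:].

Fact SL2_mul_subproof (A B : SL2) : \det (val A *m val B) == 1.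
Proof. by rewrite det_mulmx (eqP (SL2P A)) (eqP (SL2P B)) mulr1. Qed.

Fact SL2_one_subproof : \det (1%:M : 'M[F]_2) == 1.
Proof. by rewrite det1. Qed.

Fact SL2_inv_subproof (A : SL2) : \det (invmx (val A)) == 1.
Proof. by rewrite det_inv (eqP (SL2P A)) invr1. Qed.

Definition SL2_mul (A B : SL2) := MkSL2 (SL2_mul_subproof A B).
Definition SL2_one := MkSL2 SL2_one_subproof.
Definition SL2_inv (A : SL2) := MkSL2 (SL2_inv_subproof A).

Lemma SL2_unit (A : SL2) : val A \in unitmx.
Proof. by rewrite unitmxE (eqP (SL2P A)) unitr1. Qed.

Fact SL2_mulA : associative SL2_mul.
Proof. by move=> A B D; apply/val_inj; rewrite /= mulmxA. Qed.
Fact SL2_mul1 : left_id SL2_one SL2_mul.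
Proof. by move=> A; apply/val_inj; rewrite /= mul1mx. Qed.
Fact SL2_mulr1 : right_id SL2_one SL2_mul.
Proof. by move=> A; apply/val_inj; rewrite /= mulmx1. Qed.
Fact SL2_mulV : left_inverse SL2_one SL2_inv SL2_mul.
Proof. by move=> A; apply/val_inj; rewrite /= mulVmx ?SL2_unit. Qed.
Fact SL2_mulrV : right_inverse SL2_one SL2_inv SL2_mul.
Proof. by move=> A; apply/val_inj; rewrite /= mulmxV ?SL2_unit. Qed.

HB.instance Definition _ := isGroup.Build SL2
  SL2_mulA SL2_mul1 SL2_mulr1 SL2_mulV SL2_mulrV.

Definition torus_pred : {pred SL2} := fun A => is_diag_mx (val A).

Definition borel : {pred SL2} := fun A => val A 1 0 == 0.

Definition unipotent : {pred SL2} :=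
  fun A => [&& val A 1 0 == 0, val A 0 0 == 1 & val A 1 1 == 1].

Record torus := Torus {
  torus_val :> SL2;
  torusP : torus_val \in torus_pred
}.

HB.instance Definition _ := [isSub for torus_val].
HB.instance Definition _ := [Choice of torus by <:].

Fact torus_group_closed : group_closed torus_pred.
Proof.
have diagM (A B : 'M[F]_2) i j :
    is_diag_mx A -> (A *m B) i j = A i i * B i j.
  move=> /is_diag_mxP dA; rewrite mxE (bigD1 i) //= big1 ?addr0 // => l ne_li.
  by rewrite dA ?mul0r // eq_sym.
have diagV (A : SL2) : is_diag_mx (val A) -> is_diag_mx (invmx (val A)).
  move=> dA; apply/is_diag_mxP => i j ne_ij.
  have Aii : val A i i != 0.
    have := diagM _ (invmx (val A)) i i dA.
    rewrite mulmxV ?SL2_unit // mxE eqxx => /eqP.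
    by apply: contraTneq => ->; rewrite mul0r oner_eq0.
  have := diagM _ (invmx (val A)) i j dA.
  rewrite mulmxV ?SL2_unit // mxE -val_eqE (negPf ne_ij) => /esym/eqP.
  by rewrite mulf_eq0 (negPf Aii) => /eqP.
split=> [|A B dA dB].
  by apply/is_diag_mxP => i j; rewrite mxE -val_eqE => /negPf->.
apply/is_diag_mxP => i j ne_ij.
rewrite /= (diagM _ _ _ _ dA).
by move/is_diag_mxP: (diagV _ dB) => ->; rewrite ?mulr0.
Qed.

HB.instance Definition _ :=
  SubChoice_isSubGroup.Build SL2 torus_pred torus torus_group_closed.

End SL2.

Section CategoryCG.
Context (F k : fieldType).
Implicit Types (M : gmod k (SL2 F)).

Record torus_char := TorusChar {
  tchar :> torus F -> k;
  tchar_neq0 : forall t, tchar t != 0;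
  tcharM : forall s t, tchar (s * t)%g = tchar s * tchar t
}.

Definition weight_space M (l : torus_char) : set M :=
  [set v | forall t : torus F, gact (val t) v = l t *: v].

Definition T_eigenvectors M : set M :=
  [set v | exists l, weight_space l v].

(* The sum of the subspaces [weight_space l], which is automatically direct. *)
Definition T_part M : set M := lin_span (@T_eigenvectors M).

Definition kU_span M (x : M) : set M :=
  lin_span [set gact u x | u in [set u | u \in @unipotent F]].

(* The isomorphism of [kB]-modules from [M] to the external direct sum of the
   [kU xi_i] is given as a map to [M ^ n] with image this direct sum. *)
Definition in_CG M :=
  exists n, has_dim (@T_part M) n /\
  exists xi : 'I_n -> M, (forall i, @T_eigenvectors M (xi i)) /\
  exists phi : M -> ('I_n -> M),
    [/\ linear phi,
        forall b, b \in @borel F ->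
          forall v i, phi (gact b v) i = gact b (phi v i),
        injective phi
      & range phi = [set w | forall i, kU_span (xi i) (w i)]].

Definition CG : lincat k := full_subcat (C := gmod_cat k (SL2 F)) in_CG.

End CategoryCG.

(* Main.v *)
Require Import Defs.
From HB Require Import structures.
From mathcomp Require Import all_boot all_order all_algebra all_field.
From mathcomp Require Import all_classical.
From mathcomp Require Import ring.


(** Call a vector of a [kG]-module standard if it is the image of the canonical
    generator of one of the following modules: the module [M(l)] induced from a
    character [l] of [B], whose generator is a [U]-fixed vector of weight [l]; or
    the Steinberg module [St], generated by [s 1 - 1] inside [M(1)]. The proof
    rests on the fact that a module is an object of the category if and only if it
    is generated over [G] by finitely many standard vectors
    ([in_CG_std_generated], [std_generated_in_CG]).

    In one direction, an object [M] is a direct sum of cyclic [kU]-modules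
    generated by weight vectors [xi_i]. Each of these modules is either
    one-dimensional or free ([Ufixed_or_Ufree]): here, as in most of the proof, one
    averages over finite subfields of [F] and uses that their orders are invertible
    in [k]. It remains to understand the action of [s], or equivalently of the
    lower unipotent elements [y(e)]. Comparing two expansions of [y(1 + e) xi_j]
    for generic [e] shows that [y(1) xi_j] is a combination of translates of the
    [xi_i] by [1] and [x(1)] only, up to [U]-fixed vectors ([co_lact1_support]).
    The coefficients at [1] define a finite-dimensional representation of the
    additive group of [F], homogeneous under the torus, and such a representation
    is trivial ([additive_rep_trivial]). The relations between [s] and [x(1)] then
    express [xi_i] through standard vectors ([xi_std]).

    In the other direction, the submodule generated by a standard vector is
    simple ([cell_simple]), except that [M(1)] is an extension of the trivial module
    by [St]. So a module generated by standard vectors is built by adding such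
    cells one at a time ([std_ind]), and every new cell contributes one or two
    cyclic [kU]-summands.

    The generation property passes to quotients, to products and, by a complement
    argument, to submodules ([submod_std_generated]). Therefore the category is
    abelian, its objects have finite length, and a directed family of subobjects has
    a largest element. The simple objects are [St], the trivial module and the
    modules [M(l)] for [l] nontrivial ([complete_Sobj]).

    A homomorphism given on a submodule is extended one cell at a time. The only
    obstruction appears for a [B]-fixed generator [g]: its image [z] must satisfy
    [s z - z = e] for the prescribed image [e] of [s g - g], which is a Steinberg
    vector. So an object is injective as soon as each of its Steinberg vectors has
    the form [s z - z] with [z] fixed by [B] ([hom_extend]). This holds for [M(1)],
    and for the simple objects other than [St] because they have no nonzero
    Steinberg vector. Gluing copies of [M(1)] to an arbitrary object along its
    Steinberg generators embeds it into an injective object ([embed_injective]).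

    Hence one may take [A(l) = S(l)] and the order whose only strict relation puts
    [St] below the trivial module: the injective envelope of [St] is [M(1)], filtered
    by [St] with the trivial module as quotient, and the other simple objects are
    their own envelopes. *)

Set Implicit Arguments.
Unset Strict Implicit.
Unset Printing Implicit Defensive.

Import Order.TTheory GRing.Theory.
Local Open Scope classical_set_scope.
Local Open Scope ring_scope.

(** * Elements of SL2 *)

Section Matrices.
Context (F : fieldType).
Implicit Types a b c d e : F.

Definition mx2 a b c d : 'M[F]_2 :=
  \matrix_(i < 2, j < 2)
    if i == 0 then if j == 0 then a else b else if j == 0 then c else d.

Lemma ord2P (i : 'I_2) : i = 0 \/ i = 1.
Proof.
by case: i => [[|[|//]] hi]; [left | right]; apply/val_inj.
Qed.

Lemma mx2P (A B : 'M[F]_2) :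
  A 0 0 = B 0 0 -> A 0 1 = B 0 1 -> A 1 0 = B 1 0 -> A 1 1 = B 1 1 -> A = B.
Proof.
by move=> h1 h2 h3 h4; apply/matrixP => i j;
  case: (ord2P i) => ->; case: (ord2P j) => ->.
Qed.

Lemma mx2E (A : 'M[F]_2) : A = mx2 (A 0 0) (A 0 1) (A 1 0) (A 1 1).
Proof. by apply: mx2P; rewrite mxE. Qed.

Lemma mulmx2 a b c d a' b' c' d' : mx2 a b c d *m mx2 a' b' c' d' =
  mx2 (a * a' + b * c') (a * b' + b * d') (c * a' + d * c') (c * b' + d * d').
Proof.
by apply: mx2P; rewrite !mxE !big_ord_recl big_ord0 addr0 /= !mxE.
Qed.

Lemma det_mx2 a b c d : \det (mx2 a b c d) = a * d - b * c.
Proof.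
rewrite (expand_det_row _ 0) !big_ord_recl big_ord0 addr0 /cofactor.
rewrite !det_mx11 !mxE /= expr0 expr1 mul1r.
by rewrite mulN1r mulrN.
Qed.

Lemma mx2_1 : 1%:M = mx2 1 0 0 1.
Proof. by apply: mx2P; rewrite !mxE. Qed.

(** Makes the diagonal elements below a total function of [c]. *)
Definition nz c := if c == 0 then 1 else c.

Lemma nz_neq0 c : nz c != 0.
Proof. by rewrite /nz; have [_|] := eqVneq c 0; rewrite ?oner_eq0. Qed.

Lemma nzE c : c != 0 -> nz c = c.
Proof. by rewrite /nz => /negPf->. Qed.

Fact det_upper a : \det (mx2 1 a 0 1) == 1.
Proof. by rewrite det_mx2 mulr1 mulr0 subr0. Qed.
Fact det_lower a : \det (mx2 1 0 a 1) == 1.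
Proof. by rewrite det_mx2 mulr1 mul0r subr0. Qed.
Fact det_diag c : \det (mx2 (nz c) 0 0 (nz c)^-1) == 1.
Proof. by rewrite det_mx2 mulfV ?nz_neq0 // mulr0 subr0. Qed.
Fact det_weyl : \det (mx2 0 1 (-1) 0) == 1.
Proof. by rewrite det_mx2 mulr0 mul1r sub0r opprK. Qed.

(** The upper and lower unipotent, the diagonal and the Weyl elements, written
    [x(a)], [y(a)], [h(c)] and [s] in the comments below. *)
Definition ux a : SL2 F := MkSL2 (det_upper a).
Definition lx a : SL2 F := MkSL2 (det_lower a).
Definition hx c : SL2 F := MkSL2 (det_diag c).
Definition wx : SL2 F := MkSL2 det_weyl.

Lemma SL2_eqP (g h : SL2 F) : val g = val h -> g = h.
Proof. exact: val_inj. Qed.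

Lemma hx1 : hx 1 = 1%g.
Proof.
by apply/SL2_eqP; rewrite /= nzE ?oner_neq0 // invr1 mx2_1.
Qed.

Lemma ux0 : ux 0 = 1%g.
Proof. by apply/SL2_eqP; rewrite /= mx2_1. Qed.

Lemma ux_unipotent a : ux a \in @unipotent F.
Proof. by rewrite unfold_in /= !mxE !eqxx. Qed.

Lemma unipotentP g : g \in @unipotent F -> exists a, g = ux a.
Proof.
rewrite unfold_in => /and3P[/eqP h1 /eqP h2 /eqP h3]; exists (val g 0 1).
by apply/SL2_eqP; rewrite /= [val g in LHS]mx2E h1 h2 h3.
Qed.

Lemma hx_torus c : hx c \in @torus_pred F.
Proof.
apply/is_diag_mxP => i j; rewrite /= mxE.
by case: (ord2P i) => ->; case: (ord2P j) => ->.
Qed.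

Definition hT c : torus F := Torus (hx_torus c).

Lemma torusE (t : torus F) : exists2 c, c != 0 & t = hT c.
Proof.
have /is_diag_mxP dt := torusP t.
have t01 : val (val t) 0 1 = 0 by apply: dt.
have t10 : val (val t) 1 0 = 0 by apply: dt.
have := eqP (SL2P (val t)).
rewrite [SL2val _]mx2E det_mx2 [SL2val _ 0 1]t01 mul0r subr0 => dt1.
have t00 : val (val t) 0 0 != 0.
  by apply: contra_eq_neq dt1 => /= ->; rewrite mul0r eq_sym oner_neq0.
exists (val (val t) 0 0) => //; apply/val_inj/SL2_eqP.
rewrite /= nzE // [LHS]mx2E [X in mx2 _ X]t01 [X in mx2 _ _ X]t10.
by congr mx2; apply: (mulfI t00); rewrite mulfV.
Qed.

Lemma SL2_mulE (g h : SL2 F) : val (g * h)%g = val g *m val h.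
Proof. by []. Qed.

Lemma uxD a b : ux (a + b) = (ux a * ux b)%g.
Proof. by apply/SL2_eqP; rewrite SL2_mulE /= mulmx2; congr mx2; ring. Qed.

Lemma lxD a b : lx (a + b) = (lx a * lx b)%g.
Proof. by apply/SL2_eqP; rewrite SL2_mulE /= mulmx2; congr mx2; ring. Qed.

Lemma hxM c d : c != 0 -> d != 0 -> hx (c * d) = (hx c * hx d)%g.
Proof.
move=> c0 d0; apply/SL2_eqP; rewrite SL2_mulE /= mulmx2 !nzE ?mulf_neq0 //.
by rewrite ?(invrK, invrN, invr1); congr mx2; field; rewrite ?c0 ?d0.
Qed.

Lemma hx_ux c a : c != 0 -> (hx c * ux a = ux (c ^+ 2 * a) * hx c)%g.
Proof.
move=> c0; apply/SL2_eqP; rewrite !SL2_mulE /= !mulmx2 !nzE //.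
by rewrite ?(invrK, invrN, invr1); congr mx2; field; rewrite ?c0.
Qed.

Lemma hx_lx c a : c != 0 -> (hx c * lx (c ^+ 2 * a) = lx a * hx c)%g.
Proof.
move=> c0; apply/SL2_eqP; rewrite !SL2_mulE /= !mulmx2 !nzE //.
by rewrite ?(invrK, invrN, invr1); congr mx2; field; rewrite ?c0.
Qed.

Lemma wx_hx c : c != 0 -> (wx * hx c = hx c^-1 * wx)%g.
Proof.
move=> c0; apply/SL2_eqP; rewrite !SL2_mulE /= !mulmx2 !nzE ?invr_eq0 //.
by rewrite ?(invrK, invrN, invr1); congr mx2; field; rewrite ?c0.
Qed.

Lemma wx_wx : (wx * wx = hx (-1))%g.
Proof.
apply/SL2_eqP; rewrite !SL2_mulE /= !mulmx2 !nzE ?oppr_eq0 ?oner_eq0 //.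
by rewrite ?(invrK, invrN, invr1); congr mx2; field; rewrite ?oppr_eq0 ?oner_eq0.
Qed.

Lemma wx_ux_wx a : a != 0 ->
  (wx * ux a * wx = ux (- a^-1) * (hx (- a^-1) * (wx * ux (- a^-1))))%g.
Proof.
move=> a0; apply/SL2_eqP.
rewrite !SL2_mulE /= !mulmx2 !nzE ?oppr_eq0 ?invr_eq0 //.
by rewrite ?(invrK, invrN, invr1); congr mx2; field; rewrite ?a0.
Qed.

Lemma lxE : lx 1 = (ux 1 * hx (-1) * wx * ux 1)%g.
Proof.
apply/SL2_eqP; rewrite !SL2_mulE /= !mulmx2 !nzE ?oppr_eq0 ?oner_eq0 //.
by rewrite ?(invrK, invrN, invr1); congr mx2; field; rewrite ?oppr_eq0 ?oner_eq0.
Qed.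

(** A lower unipotent element acts on the positions of upper ones as the Moebius
    map [z |-> z / (1 + e z)]. *)
Lemma lx_ux e z : 1 + e * z != 0 ->
  (lx e * ux z = ux (z / (1 + e * z)) *
     (hx (1 + e * z)^-1 * lx (e / (1 + e * z))))%g.
Proof.
move=> ez0; apply/SL2_eqP.
rewrite !SL2_mulE /= !mulmx2 !nzE ?invr_eq0 // invrK.
by rewrite ?(invrK, invrN, invr1); congr mx2; field; rewrite ?ez0.
Qed.

Lemma lx_uxN e : e != 0 ->
  (lx e * ux (- e^-1) = ux e^-1 * (hx (- e^-1) * wx))%g.
Proof.
move=> e0; apply/SL2_eqP.
rewrite !SL2_mulE /= !mulmx2 !nzE ?oppr_eq0 ?invr_eq0 //.
by rewrite ?(invrK, invrN, invr1); congr mx2; field; rewrite ?e0.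
Qed.

Lemma lx_wx e : lx e = (wx * ux (- e) * hx (-1) * wx)%g.
Proof.
apply/SL2_eqP; rewrite !SL2_mulE /= !mulmx2 !nzE ?oppr_eq0 ?oner_eq0 //.
by rewrite ?(invrK, invrN, invr1); congr mx2; field; rewrite ?oppr_eq0 ?oner_eq0.
Qed.

Lemma bruhat (g : SL2 F) :
  (exists c a, c != 0 /\ g = (ux a * hx c)%g) \/
  (exists a c b, c != 0 /\ g = (ux a * (wx * (hx c * ux b)))%g).
Proof.
have := eqP (SL2P g); rewrite [SL2val g]mx2E det_mx2.
set a := SL2val g 0 0; set b := SL2val g 0 1.
set c := SL2val g 1 0; set d := SL2val g 1 1 => dg.
have gE : val g = mx2 a b c d by rewrite [LHS]mx2E.
have [c0|c0] := eqVneq c 0; [left|right].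
  rewrite c0 mulr0 subr0 in dg.
  have a0 : a != 0 by apply: contra_eq_neq dg => ->; rewrite mul0r eq_sym oner_neq0.
  exists a, (b * a); split=> //; apply/SL2_eqP; rewrite SL2_mulE gE /= mulmx2 !nzE //.
  have -> : d = a^-1 by apply: (mulfI a0); rewrite dg mulfV.
  by rewrite c0; rewrite ?(invrK, invrN, invr1); congr mx2; field; rewrite ?a0.
exists (a / c), (- c), (d / c); split; first by rewrite oppr_eq0.
apply/SL2_eqP; rewrite !SL2_mulE gE /= !mulmx2 !nzE ?oppr_eq0 // ?(invrK, invrN, invr1).
have -> : b = (a * d - 1) / c by rewrite -dg; field; rewrite ?c0.
by rewrite ?(invrK, invrN, invr1); congr mx2; field; rewrite ?oppr_eq0 ?c0.
Qed.

Lemma borelP (g : SL2 F) : g \in @borel F ->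
  exists c a, c != 0 /\ g = (ux a * hx c)%g.
Proof.
rewrite unfold_in => gB; case: (bruhat g) => // -[a [c [b [c0 gE]]]].
move: gB; rewrite gE !SL2_mulE /= !mulmx2 mxE /= nzE //.
by rewrite !(mul0r, mulr0, add0r, addr0, mulr1, mulN1r, mul1r) oppr_eq0 (negPf c0).
Qed.

Lemma ux_borel a : ux a \in @borel F.
Proof. by rewrite unfold_in /= mxE. Qed.

Lemma hx_borel c : hx c \in @borel F.
Proof. by rewrite unfold_in /= mxE. Qed.

End Matrices.

(** * Finite subfields of an algebraic closure of a finite field *)

(** A list of elements is kept rather than a predicate, for summing over it. *)
Definition fsubfield (F : fieldType) (K : seq F) :=
  [/\ uniq K, (0 \in K) && (1 \in K),
      forall x y, x \in K -> y \in K -> x + y \in K,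
      forall x y, x \in K -> y \in K -> x * y \in K
    & forall x, x \in K -> (- x \in K) && (x^-1 \in K)].

Definition locally_finite_field (F : fieldType) := forall (xs : seq F) (B : nat),
  exists K : seq F, [/\ fsubfield K, {subset xs <= K} & (B < size K)%N].

Lemma closed_field_many (F : closedFieldType) (n : nat) :
  exists s : seq F, uniq s /\ size s = n.
Proof.
elim: n => [|n [s [us ss]]]; first by exists [::].
have : \prod_(a <- s) ('X - a%:P) != 0 :> {poly F}.
  by rewrite monic_neq0 // monic_prod // => i _; rewrite monicXsubC.
move=> /closed_nonrootP[x]; rewrite root_prod_XsubC => xs.
by exists (x :: s); rewrite /= xs us ss.
Qed.

Lemma closed_field_roots (F : closedFieldType) (P : {poly F}) : P != 0 ->
  exists rs : seq F, forall x, root P x = (x \in rs).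
Proof.
move=> P0; have [rs Pe] := closed_field_poly_normal P; exists rs => x.
by rewrite Pe rootZ ?lead_coef_eq0 // root_prod_XsubC.
Qed.

Section AlgebraicClosure.
Context (Fq : finFieldType) (F : closedFieldType) (iota : {rmorphism Fq -> F}).
Hypothesis F_alg : forall x : F, algebraicOver iota x.

Local Notation q := #|Fq|.

Let q_gt0 : (0 < q)%N. Proof. exact: ltnW (finNzRing_gt1 Fq). Qed.

Let q_nat m : [pchar F].-nat (q ^ m)%N.
Proof.
have [p pr_p pF] := finPcharP Fq.
have pF' : p \in [pchar F] by rewrite (fmorph_pchar iota).
rewrite (eq_pnat _ (pcharf_eq pF')) pnatX; apply/orP; left.
by rewrite (card_pprimeChar pF) pnatX pnat_id.
Qed.

Let frobD m x y : (x + y) ^+ (q ^ m) = x ^+ (q ^ m) + y ^+ (q ^ m) :> F.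
Proof. exact: exprDn_pchar. Qed.

Let frobN m x : (- x) ^+ (q ^ m) = - x ^+ (q ^ m) :> F.
Proof. exact: exprNn_pchar. Qed.

Let frob_iota m (a : Fq) : iota a ^+ (q ^ m) = iota a.
Proof.
elim: m => [|m IH]; first by rewrite expn0 expr1.
by rewrite expnSr exprM IH -rmorphXn expf_card.
Qed.

Let frob_root P x : root (map_poly iota P) x -> root (map_poly iota P) (x ^+ q).
Proof.
have frob0 : (0 : F) ^+ q = 0 by rewrite expr0n gtn_eqF.
have frobD1 := frobD 1; have fiota := frob_iota 1; rewrite expn1 in frobD1 fiota.
rewrite /root !horner_coef => /eqP Px0; apply/eqP.
rewrite -[RHS]frob0 -{3}Px0 (big_morph (fun x => x ^+ q) frobD1 frob0).
by apply: eq_bigr => i _; rewrite coef_map exprMn fiota exprAC.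
Qed.

(** The Frobenius map permutes the finitely many conjugates of [x], so one of
    its powers fixes [x]. *)
Let frob_periodic (x : F) : exists2 m, (0 < m)%N & x ^+ (q ^ m) = x.
Proof.
have [P P0 Px] := F_alg x.
have [|rs rsP] := @closed_field_roots F (map_poly iota P).
  by rewrite map_poly_eq0.
have mem_rs i : x ^+ (q ^ i) \in rs.
  elim: i => [|i IH]; rewrite -rsP; first by rewrite expn0 expr1.
  by rewrite expnSr exprM frob_root // rsP.
pose f (i : nat) : F := x ^+ (q ^ i).
have : ~~ uniq [seq f i | i <- seq.iota 0 (size rs).+1].
  apply/negP => us; have sub_rs : {subset [seq f i | i <- seq.iota 0 (size rs).+1] <= rs}.
    by move=> y /mapP[i _ ->]; apply: mem_rs.
  by have := uniq_leq_size us sub_rs; rewrite size_map size_iota ltnn.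
move=> /(uniqPn 0)[i [j [ij]]]; rewrite size_map size_iota => jn.
rewrite !(nth_map 0%N) ?size_iota ?(ltn_trans ij) // !nth_iota ?(ltn_trans ij) //.
rewrite !add0n /f -{1}(subnK (ltnW ij)) expnD exprM => fij.
exists (j - i)%N; first by rewrite subn_gt0.
apply/eqP; rewrite -subr_eq0; apply/eqP.
have: (x ^+ (q ^ (j - i)) - x) ^+ (q ^ i) = 0.
  by rewrite frobD frobN -exprM mulnC -[(q ^ i * _)%N]mulnC exprM fij subrr.
by move/eqP; rewrite expf_eq0 => /andP[_ /eqP].
Qed.

Let frob_periodic_seq (xs : seq F) :
  exists2 m, (0 < m)%N & forall x, x \in xs -> x ^+ (q ^ m) = x.
Proof.
have frobM m n (x : F) : x ^+ (q ^ m) = x -> x ^+ (q ^ (m * n)) = x.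
  move=> xm; elim: n => [|n IH]; first by rewrite muln0 expn0 expr1.
  by rewrite mulnS expnD exprM xm.
elim: xs => [|x xs [m m0 IH]]; first by exists 1%N.
have [n n0 xn] := frob_periodic x; exists (m * n)%N; first by rewrite muln_gt0 m0.
by move=> y; rewrite inE => /predU1P[->|/IH/frobM]; rewrite // mulnC frobM.
Qed.

(** The elements fixed by a power of the Frobenius map form a finite subfield; a
    suitable power fixes any given finitely many elements. *)
Lemma locally_finite_algebraic_closure : locally_finite_field F.
Proof.
move=> xs B; have [ys [uys sys]] := closed_field_many F B.+1.
have [m m0 mP] := frob_periodic_seq (xs ++ ys).
have qm1 : (1 < q ^ m)%N.
  by rewrite -(expn0 q) ltn_exp2l // finNzRing_gt1.
have P0 : 'X^(q ^ m) - 'X != 0 :> {poly F}.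
  rewrite -size_poly_gt0 size_polyDl size_polyXn // size_polyN size_polyX.
  exact: qm1.
have [rs rsP] := closed_field_roots P0.
have memK x : (x \in undup rs) = (x ^+ (q ^ m) == x).
  by rewrite mem_undup -rsP rootE !hornerE subr_eq0.
exists (undup rs); split.
- split; first exact: undup_uniq.
  + by rewrite !memK expr1n eqxx expr0n gtn_eqF ?(ltn_trans _ qm1) /= ?eqxx.
  + by move=> x y; rewrite !memK => /eqP xK /eqP yK; rewrite frobD xK yK.
  + by move=> x y; rewrite !memK => /eqP xK /eqP yK; rewrite exprMn xK yK.
  + by move=> x; rewrite !memK => /eqP xK; rewrite frobN exprVn xK !eqxx.
- by move=> x xs_x; rewrite memK mP // mem_cat xs_x.
- rewrite -sys; apply: uniq_leq_size => // y ys_y.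
  by rewrite memK mP // mem_cat ys_y orbT.
Qed.

End AlgebraicClosure.

(** * Sums over a finite subfield *)

Section FiniteSubfieldSums.
Context (F : fieldType) (K : seq F) (Kf : fsubfield K).

Lemma fsubfield_uniq : uniq K. Proof. by case: Kf. Qed.
Lemma fsubfield0 : 0 \in K. Proof. by case: Kf => _ /andP[]. Qed.
Lemma fsubfield1 : 1 \in K. Proof. by case: Kf => _ /andP[]. Qed.
Lemma fsubfieldD x y : x \in K -> y \in K -> x + y \in K.
Proof. by case: Kf => _ _ + _ _; apply. Qed.
Lemma fsubfieldM x y : x \in K -> y \in K -> x * y \in K.
Proof. by case: Kf => _ _ _ + _; apply. Qed.
Lemma fsubfieldN x : x \in K -> - x \in K.
Proof. by case: Kf => _ _ _ _ h /h/andP[]. Qed.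
Lemma fsubfieldV x : x \in K -> x^-1 \in K.
Proof. by case: Kf => _ _ _ _ h /h/andP[]. Qed.

Lemma fsubfield_perm (h : F -> F) :
  injective h -> (forall x, x \in K -> h x \in K) -> perm_eq (map h K) K.
Proof.
move=> h_inj hK; have uK := fsubfield_uniq.
have uhK : uniq (map h K) by rewrite map_inj_uniq.
have sub : {subset map h K <= K} by move=> _ /mapP[x /hK ? ->].
have [|_ eqK] := uniq_min_size uhK sub; first by rewrite size_map.
exact: uniq_perm.
Qed.

Context (V : nmodType) (f : F -> V).

Lemma sum_fsubfieldD a : a \in K -> \sum_(z <- K) f (a + z) = \sum_(z <- K) f z.
Proof.
move=> aK; rewrite -[RHS](perm_big _ (fsubfield_perm (addrI a) _)) ?big_map //.
by move=> x; apply: fsubfieldD.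
Qed.

Lemma sum_fsubfieldM t : t \in K -> t != 0 ->
  \sum_(z <- K | z != 0) f (t * z) = \sum_(z <- K | z != 0) f z.
Proof.
move=> tK t0; rewrite -[RHS](perm_big _ (fsubfield_perm (mulfI t0) _)) ?big_map /=.
  by apply: eq_bigl => z; rewrite mulf_eq0 (negPf t0).
by move=> x; apply: fsubfieldM.
Qed.

Lemma sum_fsubfieldNV :
  \sum_(z <- K | z != 0) f (- z^-1) = \sum_(z <- K | z != 0) f z.
Proof.
have inj : injective (fun z : F => - z^-1) by apply: inj_comp oppr_inj invr_inj.
rewrite -[RHS](perm_big _ (fsubfield_perm inj _)) ?big_map /=.
  by apply: eq_bigl => z; rewrite oppr_eq0 invr_eq0.
by move=> x /fsubfieldV/fsubfieldN.
Qed.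

Lemma sum_fsubfield0 :
  \sum_(z <- K) f z = f 0 + \sum_(z <- K | z != 0) f z.
Proof.
by rewrite (bigD1_seq 0) ?fsubfield_uniq ?fsubfield0.
Qed.

Lemma sum_fsubfield_const (v : V) :
  \sum_(z <- K | z != 0) v = v *+ (size K).-1.
Proof.
rewrite big_const_seq iter_addr addr0; congr (_ *+ _).
rewrite -(count_predC (pred1 0) K) count_uniq_mem ?fsubfield_uniq //.
by rewrite fsubfield0.
Qed.

End FiniteSubfieldSums.

(** * Actions of the standard elements *)

Section GeneralActions.
Context (k : fieldType) (H : groupType) (M : gmod k H).
Implicit Types (g : H) (u v : M).

Lemma gact0 g : gact g 0 = 0 :> M.
Proof.
by have := @gact_linear _ _ M g (-1) 0 0; rewrite scaleN1r addNr scaleN1r addNr.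
Qed.

Lemma gactD g u v : gact g (u + v) = gact g u + gact g v.
Proof. by have := @gact_linear _ _ M g 1 u v; rewrite !scale1r. Qed.

Lemma gactZ g c u : gact g (c *: u) = c *: gact g u.
Proof. by have := @gact_linear _ _ M g c u 0; rewrite gact0 !addr0. Qed.

Lemma gactN g u : gact g (- u) = - gact g u.
Proof. by rewrite -scaleN1r gactZ scaleN1r. Qed.

Lemma gactB g u v : gact g (u - v) = gact g u - gact g v.
Proof. by rewrite gactD gactN. Qed.

Lemma gact_sum g I (r : seq I) (P : pred I) (f : I -> M) :
  gact g (\sum_(i <- r | P i) f i) = \sum_(i <- r | P i) gact g (f i).
Proof. exact: (big_morph _ (gactD g) (gact0 g)). Qed.

Lemma gact_inj g : injective (@gact _ _ M g).
Proof.
move=> u v /(congr1 (gact g^-1%g)).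
by rewrite -!gactM mulVg !gact1.
Qed.

End GeneralActions.

Notation xact a v := (gact (ux a) v).
Notation hact c v := (gact (hx c) v).
Notation wact v := (gact (wx _) v).
Notation lact e v := (gact (lx e) v).

Section Relations.
Context (F k : fieldType) (M : gmod k (SL2 F)).
Implicit Types (a b c e z : F) (u v : M).

Lemma xact0 v : xact 0 v = v.
Proof. by rewrite ux0 gact1. Qed.

Lemma xactD a b v : xact a (xact b v) = xact (a + b) v.
Proof. by rewrite -gactM uxD. Qed.

Lemma hact1 v : hact 1 v = v.
Proof. by rewrite hx1 gact1. Qed.

Lemma hactM c d v : c != 0 -> d != 0 -> hact c (hact d v) = hact (c * d) v.
Proof. by move=> c0 d0; rewrite -gactM hxM. Qed.

Lemma hactK c v : c != 0 -> hact c^-1 (hact c v) = v.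
Proof. by move=> c0; rewrite hactM ?invr_eq0 // mulVf // hact1. Qed.

Lemma hact_xact c a v : c != 0 -> hact c (xact a v) = xact (c ^+ 2 * a) (hact c v).
Proof. by move=> c0; rewrite -!gactM hx_ux. Qed.

Lemma hact_lact c a v : c != 0 -> hact c (lact (c ^+ 2 * a) v) = lact a (hact c v).
Proof. by move=> c0; rewrite -!gactM hx_lx. Qed.

Lemma wact_hact c v : c != 0 -> wact (hact c v) = hact c^-1 (wact v).
Proof. by move=> c0; rewrite -!gactM wx_hx. Qed.

Lemma wact_wact v : wact (wact v) = hact (-1) v.
Proof. by rewrite -!gactM wx_wx. Qed.

Lemma wact_xact_wact a v : a != 0 ->
  wact (xact a (wact v)) = xact (- a^-1) (hact (- a^-1) (wact (xact (- a^-1) v))).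
Proof. by move=> a0; have := congr1 (fun g => gact g v) (wx_ux_wx a0); rewrite !gactM. Qed.

Lemma lact1E v : lact 1 v = xact 1 (hact (-1) (wact (xact 1 v))).
Proof. by have := congr1 (fun g => gact g v) (lxE F); rewrite !gactM. Qed.

Lemma lactD a b v : lact a (lact b v) = lact (a + b) v.
Proof. by rewrite -gactM lxD. Qed.

Lemma lact0 v : lact 0 v = v.
Proof.
by have := lactD 0 0 v; rewrite addr0 => /gact_inj.
Qed.

Lemma lact_xact e z v : 1 + e * z != 0 ->
  lact e (xact z v) =
  xact (z / (1 + e * z)) (hact (1 + e * z)^-1 (lact (e / (1 + e * z)) v)).
Proof. by move=> ez; have := congr1 (fun g => gact g v) (lx_ux ez); rewrite !gactM. Qed.

Lemma lact_xactN e v : e != 0 ->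
  lact e (xact (- e^-1) v) = xact e^-1 (hact (- e^-1) (wact v)).
Proof. by move=> e0; have := congr1 (fun g => gact g v) (lx_uxN e0); rewrite !gactM. Qed.

Lemma lact_wact e v : lact e v = wact (xact (- e) (hact (-1) (wact v))).
Proof. by have := congr1 (fun g => gact g v) (lx_wx e); rewrite !gactM. Qed.

Definition lsub (N : set M) := N 0 /\ forall (r : k) u v, N u -> N v -> N (r *: u + v).

Definition submod (N : set M) := lsub N /\ forall g v, N v -> N (gact g v).

Lemma setT_submod : submod [set: M].
Proof. by []. Qed.

Lemma set0_submod : submod [set 0].
Proof.
by split; [split=> // r _ _ -> ->; rewrite scaler0 addr0 | move=> g _ ->; rewrite gact0].
Qed.

Section LSub.
Context (N : set M) (Nl : lsub N).
Lemma lsub0 : N 0. Proof. by case: Nl. Qed.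
Lemma lsubD u v : N u -> N v -> N (u + v).
Proof. by move=> Nu Nv; rewrite -[u]scale1r; apply: Nl.2. Qed.
Lemma lsubZ (r : k) u : N u -> N (r *: u).
Proof. by move=> Nu; rewrite -[_ *: _]addr0; apply: Nl.2 => //; apply: lsub0. Qed.
Lemma lsubN u : N u -> N (- u).
Proof. by rewrite -scaleN1r; apply: lsubZ. Qed.
Lemma lsubB u v : N u -> N v -> N (u - v).
Proof. by move=> Nu Nv; apply: lsubD => //; apply: lsubN. Qed.
Lemma lsub_sum I (r : seq I) (P : pred I) (f : I -> M) :
  (forall i, P i -> N (f i)) -> N (\sum_(i <- r | P i) f i).
Proof. by move=> Nf; elim/big_ind: _ => //; [apply: lsub0 | apply: lsubD]. Qed.
Lemma lsubZ_inv (r : k) u : r != 0 -> N (r *: u) -> N u.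
Proof. by move=> r0 /(lsubZ r^-1); rewrite scalerA mulVf ?scale1r. Qed.
End LSub.

(** By the Bruhat decomposition every element of the group is a product of
    elements [x(a)], [h(c)] and [s]. *)
Lemma submodP (N : set M) : lsub N ->
  (forall a v, N v -> N (xact a v)) -> (forall c v, c != 0 -> N v -> N (hact c v)) ->
  (forall v, N v -> N (wact v)) -> submod N.
Proof.
move=> Nl Nx Nh Nw; split=> // g v Nv.
case: (bruhat g) => [[c [a [c0 ->]]]|[a [c [b [c0 ->]]]]]; rewrite !gactM;
  by repeat first [exact: Nv | apply: (Nx) | apply: (Nh _ _ c0) | apply: (Nw)].
Qed.

End Relations.

(** * Characters of the torus and weight vectors *)

Lemma closed_field_sqrt (F : closedFieldType) (t : F) : exists c, c ^+ 2 = t.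
Proof.
have /closed_rootP[c] : size ('X^2 - t%:P : {poly F}) != 1%N.
  by rewrite size_XnsubC.
by rewrite rootE !hornerE subr_eq0 => /eqP; exists c.
Qed.

Lemma closed_field_sqrt_neq0 (F : closedFieldType) (t : F) :
  t != 0 -> exists2 c, c != 0 & c ^+ 2 = t.
Proof.
move=> t0; have [c ct] := closed_field_sqrt t; exists c => //.
by apply: contra_neq t0 => c0; rewrite -ct c0 expr0n.
Qed.

Section Characters.
Context (F k : fieldType).
Implicit Types (l m : torus_char F k) (c d : F).

Definition chi l c : k := l (hT c).

Lemma chi_neq0 l c : chi l c != 0.
Proof. exact: tchar_neq0. Qed.

Lemma hTM c d : c != 0 -> d != 0 -> hT (c * d) = (hT c * hT d)%g.
Proof. by move=> c0 d0; apply/val_inj; rewrite /= hxM. Qed.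

Lemma chiM l c d : c != 0 -> d != 0 -> chi l (c * d) = chi l c * chi l d.
Proof. by move=> c0 d0; rewrite /chi hTM // tcharM. Qed.

Lemma chi1 l : chi l 1 = 1.
Proof.
apply: (mulfI (chi_neq0 l 1)).
by rewrite -chiM ?oner_neq0 // !mulr1.
Qed.

Lemma chiV l c : c != 0 -> chi l c^-1 = (chi l c)^-1.
Proof.
move=> c0; apply: (mulfI (chi_neq0 l c)).
by rewrite -chiM ?invr_eq0 // !mulfV ?chi_neq0 // chi1.
Qed.

Lemma torus_char_eq l m : (forall c, c != 0 -> chi l c = chi m c) -> l = m.
Proof.
move=> lm; have {}lm : tchar l = tchar m.
  by apply/funext => t; have [c c0 ->] := torusE t; apply: lm.
case: l m lm => [l l1 l2] [m m1 m2] /= lm.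
by subst m; congr TorusChar; apply: Prop_irrelevance.
Qed.

Lemma torus_char_neq l m : l <> m -> exists2 c, c != 0 & chi l c != chi m c.
Proof.
move=> lm; apply: contrapT => noc; apply: lm; apply: torus_char_eq => c c0.
by apply: contrapT => /eqP lmc; apply: noc; exists c.
Qed.

Definition chi_one : torus_char F k :=
  @TorusChar F k (fun _ => 1) (fun _ => oner_neq0 k) (fun _ _ => esym (mulr1 1)).

Lemma chi_oneE c : chi chi_one c = 1.
Proof. by []. Qed.

Fact chi_inv_subproof1 l t : (l t)^-1 != 0.
Proof. by rewrite invr_eq0 tchar_neq0. Qed.
Fact chi_inv_subproof2 l s t : (l (s * t)%g)^-1 = (l s)^-1 * (l t)^-1.
Proof. by rewrite tcharM invfM. Qed.

Definition chi_inv l : torus_char F k :=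
  TorusChar (chi_inv_subproof1 l) (chi_inv_subproof2 l).

Lemma chi_invE l c : chi (chi_inv l) c = (chi l c)^-1.
Proof. by []. Qed.

Lemma chi_invK : involutive chi_inv.
Proof. by move=> l; apply: torus_char_eq => c _; rewrite !chi_invE invrK. Qed.

End Characters.

Arguments chi_one {F k}.

HB.instance Definition _ (F k : fieldType) := gen_eqMixin (torus_char F k).
HB.instance Definition _ (F k : fieldType) := gen_choiceMixin (torus_char F k).

Lemma chi_sq_neq1 (F : closedFieldType) (k : fieldType) (l : torus_char F k) :
  l <> chi_one -> exists2 c, c != 0 & chi l c ^+ 2 != 1.
Proof.
move=> /torus_char_neq[t t0]; rewrite chi_oneE.
have [c c0 ct] := closed_field_sqrt_neq0 t0.
by exists c => //; rewrite expr2 -chiM // -expr2 ct.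
Qed.

Lemma chi_inv_neq (F : closedFieldType) (k : fieldType) (l : torus_char F k) :
  l <> chi_one -> chi_inv l <> l.
Proof.
move=> /chi_sq_neq1[c c0 lc] /(congr1 (fun l => chi l c)); rewrite chi_invE => lV.
by case/eqP: lc; rewrite expr2 -{1}lV mulVf ?chi_neq0.
Qed.

Lemma chi_N1 (F : closedFieldType) (k : fieldType) (l : torus_char F k) :
  chi l (-1) ^+ 2 = 1.
Proof.
have N10 : -1 != 0 :> F by rewrite oppr_eq0 oner_neq0.
by rewrite expr2 -chiM // mulrNN mulr1 chi1.
Qed.

Section Weights.
Context (F k : fieldType) (M : gmod k (SL2 F)).
Implicit Types (l m : torus_char F k) (c d : F) (u v : M).

Lemma weight_spaceP l v :
  weight_space l v <-> forall c, c != 0 -> hact c v = chi l c *: v.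
Proof.
split=> [lv c c0|lv t]; first by rewrite -lv.
by have [c c0 ->] := torusE t; rewrite -lv.
Qed.

Lemma weightE l v c : weight_space l v -> hact c v = chi l c *: v.
Proof. by move=> lv; rewrite -(lv (hT c)). Qed.

Lemma lsub_weight l : lsub (@weight_space F k M l).
Proof.
split=> [t|r u v lu lv t]; first by rewrite gact0 scaler0.
by rewrite gactD gactZ lu lv scalerDr !scalerA mulrC.
Qed.

Lemma weight_wact l v : weight_space l v -> weight_space (chi_inv l) (wact v).
Proof.
move=> /weight_spaceP lv; apply/weight_spaceP => c c0.
have cV : c^-1 != 0 by rewrite invr_eq0.
by rewrite -{1}[c]invrK -wact_hact // lv // gactZ chi_invE chiV // .
Qed.

Lemma weight_hact l v c : weight_space l v -> weight_space l (hact c v).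
Proof. by move=> lv; rewrite (weightE _ lv); apply: (lsubZ (lsub_weight l)). Qed.

(** Weight vectors of distinct weights are linearly independent: the components
    of weight other than [l] are removed one weight at a time, by applying
    [h(c) - chi l' c] for a [c] separating [l'] from [l]. *)
Lemma weights_independent (I : Type) (r : seq I) (wt : I -> torus_char F k)
    (u : I -> M) l :
  (forall i, weight_space (wt i) (u i)) -> \sum_(i <- r) u i = 0 ->
  \sum_(i <- r | wt i == l) u i = 0.
Proof.
have : all (fun i => wt i \in l :: map wt r) r.
  have := allss (map wt r); rewrite all_map; apply: sub_all => i /=.
  by rewrite inE orbC => ->.
move: (map wt r) => ls; elim: ls r u => [|l0 ls IH] r u wt_r lu sumu.
  rewrite -[RHS]sumu; elim: r wt_r {sumu} => [|i r IHr] /=; first by rewrite !big_nil.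
  by rewrite inE !big_cons => /andP[-> /IHr ->].
have [ll0|/eqP/torus_char_neq[c c0 lc]] := eqVneq l0 l.
  apply: IH => //; apply: sub_all wt_r => i.
  by rewrite !inE ll0 orbA orbb.
pose r' := [seq i <- r | wt i != l0].
pose u' i := (chi (wt i) c - chi l0 c) *: u i.
have : \sum_(i <- r' | wt i == l) u' i = 0.
  apply: IH.
  - rewrite all_filter; apply: sub_all wt_r => i /=; rewrite !inE.
    by case: (wt i == l0) => //=.
  - by move=> i; apply: (lsubZ (lsub_weight _)).
  have := congr1 (fun v => hact c v - chi l0 c *: v) sumu.
  rewrite gact_sum gact0 scaler0 subr0 scaler_sumr -sumrB => sum0; rewrite -[RHS]sum0.
  rewrite big_filter big_mkcond; apply: eq_bigr => i _.
  by rewrite /u' (weightE c (lu i)) -scalerBl; case: eqP => //= ->; rewrite subrr scale0r.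
rewrite big_filter_cond.
rewrite (eq_big (fun i => wt i == l) (fun i => (chi l c - chi l0 c) *: u i)).
- rewrite -scaler_sumr => /eqP; rewrite scaler_eq0 subr_eq0 eq_sym (negPf lc).
  by move/eqP.
- by move=> i; rewrite andb_idl // => /eqP->; apply: contraNneq lc => ->.
- by move=> i /andP[_ /eqP wi]; rewrite /u' wi.
Qed.

Definition Ufixed v := forall a, xact a v = v.

Lemma lsub_Ufixed : lsub Ufixed.
Proof.
by split=> [a|r u v fu fv a]; rewrite ?gact0 // gactD gactZ fu fv.
Qed.

Lemma Ufixed_hact c v : c != 0 -> Ufixed v -> Ufixed (hact c v).
Proof.
move=> c0 fv a; have c20 : c ^+ 2 != 0 by rewrite expf_neq0.
by rewrite -[a](mulKf c20) mulrCA -hact_xact // fv.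
Qed.

(** The upper and the lower unipotent elements generate the whole group. *)
Lemma Ufixed_Gfixed v : Ufixed v -> Ufixed (wact v) -> forall g, gact g v = v.
Proof.
move=> fv fwv; have N10 : -1 != 0 :> F by rewrite oppr_eq0 oner_neq0.
have lv e : lact e v = v.
  rewrite lact_wact; have /(_ (- e)) -> := Ufixed_hact N10 fwv.
  by rewrite wact_hact // wact_wact invrN1 hactM // mulrNN mulr1 hact1.
have hv c : c != 0 -> hact c v = v.
  move=> c0; have := @lact_xact _ _ M 1 (c^-1 - 1) v.
  rewrite mul1r addrC subrK invrK !lv fv.
  have [_ fhv] : c != 0 /\ Ufixed (hact c v) by split=> //; apply: Ufixed_hact.
  by rewrite lv fhv invr_eq0 => /(_ c0).
have wv : wact v = v.
  have := lact1E v; rewrite lv fv; have /(_ 1) -> := Ufixed_hact N10 fwv => vE.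
  by rewrite {1}vE wact_hact // wact_wact invrN1 hactM // mulrNN mulr1 hact1.
move=> g; case: (bruhat g) => [[c [a [c0 ->]]]|[a [c [b [c0 ->]]]]];
  by rewrite !gactM ?(fv, hv, wv).
Qed.

Lemma Gfixed_weight l v : v <> 0 -> (forall g, gact g v = v) ->
  weight_space l v -> l = chi_one.
Proof.
move=> v0 gv lv; apply: torus_char_eq => c c0; rewrite chi_oneE.
have := weightE c lv; rewrite gv => /eqP; rewrite -subr_eq0 -{1}[v]scale1r -scalerBl.
by rewrite scaler_eq0 subr_eq0 => /orP[/eqP<-//|/eqP].
Qed.

End Weights.

(** * The [kU]-module generated by a weight vector *)

Section USpan.
Context (F k : fieldType) (M : gmod k (SL2 F)).
Implicit Types (l m : torus_char F k) (a c y : F) (u v x : M) (s : seq (k * F)).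

Definition usum s x : M := \sum_(p <- s) p.1 *: xact p.2 x.

Definition ucoef s y : k := \sum_(p <- s | p.2 == y) p.1.

Definition Uspan x : set M := [set v | exists s, v = usum s x].

Definition Ufree x := forall s, usum s x = 0 -> forall y, ucoef s y = 0.

Lemma usumE (Y : seq F) s x : uniq Y -> {subset map snd s <= Y} ->
  usum s x = \sum_(y <- Y) ucoef s y *: xact y x.
Proof.
move=> uY sY; under [RHS]eq_bigr do rewrite scaler_suml.
rewrite /usum (exchange_big_dep xpredT) //= big_seq [RHS]big_seq.
apply: eq_bigr => p ps; rewrite -big_filter.
have -> : [seq i <- Y | p.2 == i] = [:: p.2].
  rewrite (eq_filter (a2 := pred1 p.2)); last by move=> i; rewrite /= eq_sym.
  by rewrite filter_pred1_uniq // sY // map_f.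
by rewrite big_seq1.
Qed.

Lemma usum_cat s s' x : usum (s ++ s') x = usum s x + usum s' x.
Proof. exact: big_cat. Qed.

Lemma ucoef_cat s s' y : ucoef (s ++ s') y = ucoef s y + ucoef s' y.
Proof. exact: big_cat. Qed.

Definition uscale (r : k) s := [seq (r * p.1, p.2) | p <- s].

Lemma usum_scale (r : k) s x : usum (uscale r s) x = r *: usum s x.
Proof.
rewrite /usum big_map scaler_sumr; apply: eq_bigr => p _ /=.
by rewrite scalerA.
Qed.

Lemma ucoef_scale (r : k) s y : ucoef (uscale r s) y = r * ucoef s y.
Proof. by rewrite /ucoef big_map mulr_sumr. Qed.

Definition ushift a s : seq (k * F) := [seq (p.1, a + p.2) | p <- s].

Lemma usum_shift a s x : usum (ushift a s) x = xact a (usum s x).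
Proof.
rewrite /usum big_map gact_sum; apply: eq_bigr => p _ /=.
by rewrite gactZ xactD.
Qed.

Lemma ucoef_shift a s y : ucoef (ushift a s) y = ucoef s (y - a).
Proof.
by rewrite /ucoef big_map; apply: eq_bigl => p /=; rewrite addrC (can2_eq (addrK a) (subrK a)).
Qed.

Definition udil c s : seq (k * F) := [seq (p.1, c ^+ 2 * p.2) | p <- s].

Lemma usum_dil c s x : c != 0 -> usum (udil c s) (hact c x) = hact c (usum s x).
Proof.
move=> c0; rewrite /usum big_map gact_sum; apply: eq_bigr => p _ /=.
by rewrite gactZ hact_xact.
Qed.

Lemma ucoef_dil c s y : c != 0 -> ucoef (udil c s) y = ucoef s (y / c ^+ 2).
Proof.
move=> c0; have c20 : c ^+ 2 != 0 by rewrite expf_neq0.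
by rewrite /ucoef big_map; apply: eq_bigl => p /=; rewrite mulrC (can2_eq (mulfK c20) (mulfVK c20)).
Qed.

Lemma usum_scalar s r x : usum s (r *: x) = r *: usum s x.
Proof.
rewrite /usum scaler_sumr; apply: eq_bigr => p _.
by rewrite gactZ !scalerA mulrC.
Qed.

Lemma lsub_Uspan x : lsub (Uspan x).
Proof.
split=> [|r _ _ [s ->] [s' ->]]; first by exists [::]; rewrite /usum big_nil.
by exists (uscale r s ++ s'); rewrite usum_cat usum_scale.
Qed.

Lemma Uspan_id x : Uspan x x.
Proof. by exists [:: (1, 0)]; rewrite /usum big_seq1 scale1r xact0. Qed.

Lemma Uspan_xact a x v : Uspan x v -> Uspan x (xact a v).
Proof. by move=> [s ->]; exists (ushift a s); rewrite usum_shift. Qed.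

Lemma Uspan_hact c l x v : weight_space l x -> c != 0 ->
  Uspan x v -> Uspan x (hact c v).
Proof.
move=> lx c0 [s ->]; exists (uscale (chi l c) (udil c s)).
by rewrite -usum_dil // (weightE c lx) usum_scale usum_scalar.
Qed.

Lemma Uspan0 v : Uspan 0 v -> v = 0.
Proof. by move=> [s ->]; rewrite /usum big1 // => p _; rewrite gact0 scaler0. Qed.

Lemma Uspan_fixed x v : Ufixed x -> Uspan x v -> exists r, v = r *: x.
Proof.
move=> fx [s ->]; exists (\sum_(p <- s) p.1).
by rewrite scaler_suml; apply: eq_bigr => p _; rewrite fx.
Qed.

Lemma ucoef0_out s y : y \notin map snd s -> ucoef s y = 0.
Proof.
move=> ys; rewrite /ucoef big_seq_cond big1 // => p /andP[ps /eqP py].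
by case/negP: ys; rewrite -py map_f.
Qed.

Lemma usum_eq0 s x : (forall y, ucoef s y = 0) -> usum s x = 0.
Proof.
move=> s0; rewrite (@usumE (undup (map snd s))) ?undup_uniq //.
  by rewrite big1 // => y _; rewrite s0 scale0r.
by move=> y; rewrite mem_undup.
Qed.

Lemma usum_free_eq s s' x : Ufree x -> usum s x = usum s' x -> ucoef s =1 ucoef s'.
Proof.
move=> frx ss y; apply/eqP; rewrite -subr_eq0 -mulN1r -ucoef_scale -ucoef_cat.
by apply/eqP/frx; rewrite usum_cat usum_scale scaleN1r ss subrr.
Qed.

End USpan.

Section Dichotomy.
Context (F : closedFieldType) (k : fieldType) (M : gmod k (SL2 F)).
Implicit Types (l m : torus_char F k) (a c y : F) (u v x : M) (s : seq (k * F)).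
Hypothesis k_char0 : [pchar k] =i pred0.
Hypothesis F_fin : locally_finite_field F.

Lemma natr_eq0 n : (n%:R == 0 :> k) = (n == 0)%N.
Proof. by have [/(_ k_char0)-> _] := pcharf0P k. Qed.

Lemma natr_inj n n' : n%:R = n'%:R :> k -> n = n'.
Proof.
wlog le_nn : n n' / (n <= n')%N.
  by move=> IH e; case/orP: (leq_total n n') => le; [|apply/esym]; apply: IH.
move=> e; have : (n' - n)%:R == 0 :> k by rewrite natrB // e subrr.
by rewrite natr_eq0 subn_eq0 => le; apply/eqP; rewrite eqn_leq le_nn.
Qed.

(** Averaging a relation over the torus of a finite subfield [K] turns it into
    a combination of [x] and of the sum of the [K]-translates of [x]. *)
Lemma usum_average (K : seq F) s l x a : fsubfield K -> weight_space l x ->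
    usum s x = 0 -> {subset map snd s <= K} -> a \in K ->
  ((size K).-1%:R * ucoef s 0 - \sum_(p <- s | p.2 != 0) p.1)
    *: (xact a x - x) = 0.
Proof.
move=> Kf lx sx0 sK aK; set n := (size K).-1; set r' := \sum_(p <- s | _) _.
pose S := \sum_(z <- K) xact z x.
have rel t : t != 0 -> \sum_(p <- s) p.1 *: xact (t * p.2) x = 0.
  move=> t0; have [c c0 <-] := closed_field_sqrt_neq0 t0.
  have := usum_dil s x c0; rewrite sx0 gact0 (weightE c lx) usum_scalar => /eqP.
  by rewrite scaler_eq0 (negPf (chi_neq0 _ _)) /usum big_map => /eqP.
have : \sum_(t <- K | t != 0) \sum_(p <- s) p.1 *: xact (t * p.2) x = 0.
  by apply: big1 => t t0; apply: rel.
rewrite exchange_big /=.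
have sum_t p : p \in s -> \sum_(t <- K | t != 0) p.1 *: xact (t * p.2) x =
    if p.2 == 0 then (n%:R * p.1) *: x else p.1 *: (S - x).
  move=> ps; rewrite -scaler_sumr; case: eqP => [->|/eqP p0].
    under eq_bigr do rewrite mulr0 xact0.
    by rewrite sum_fsubfield_const // -scaler_nat scalerA mulrC.
  congr (_ *: _); rewrite /S (sum_fsubfield0 Kf) xact0 addrAC subrr add0r.
  rewrite -(sum_fsubfieldM Kf _ _ p0) ?sK ?map_f //.
  by apply: eq_bigr => t _; rewrite mulrC.
rewrite big_seq (eq_bigr _ sum_t) -big_seq (bigID (fun p => p.2 == 0)) /=.
rewrite (eq_bigr (fun p => (n%:R * p.1) *: x)); last by move=> p ->.
rewrite [X in _ + X](eq_bigr (fun p => p.1 *: (S - x))); last first.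
  by move=> p /negPf->.
rewrite -!scaler_suml -mulr_sumr -/(ucoef s 0) -/r' => E.
have {E} E : (n%:R * ucoef s 0 - r') *: x = - (r' *: S).
  apply/eqP; rewrite -addr_eq0 -[X in _ == X]E scalerBl scalerDr scalerN.
  by rewrite addrA addrAC eqxx.
rewrite scalerDr scalerN -gactZ E gactN gactZ.
suff -> : xact a S = S by rewrite subrr.
by rewrite /S gact_sum -[RHS](sum_fsubfieldD Kf _ aK); apply: eq_bigr => z _; rewrite xactD.
Qed.

(** A nontrivial relation between the translates of [x] may be translated so that
    its coefficient at [0] is nonzero. In [usum_average] the scalar factor then
    depends on the size of the subfield, so it cannot vanish for two subfields
    of different sizes. *)
Lemma Ufixed_or_Ufree l x : weight_space l x -> Ufixed x \/ Ufree x.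
Proof.
move=> lx; apply: contrapT => /not_orP[nfix]; apply=> s sx y.
apply: contrapT => /eqP sy; apply: nfix => a; apply/eqP; rewrite -subr_eq0.
pose s' := ushift (- y) s.
have s'x : usum s' x = 0 by rewrite usum_shift sx gact0.
have s'0 : ucoef s' 0 != 0 by rewrite ucoef_shift opprK add0r.
have [K [Kf sK _]] := F_fin (a :: map snd s') 0.
have [K' [Kf' sK' KK]] := F_fin (a :: map snd s') (size K).
have sub (L : seq F) : {subset a :: map snd s' <= L} -> {subset map snd s' <= L}.
  by move=> h z zs; apply: h; rewrite inE zs orbT.
have /eqP := usum_average Kf lx s'x (sub _ sK) (sK _ (mem_head _ _)).
have /eqP := usum_average Kf' lx s'x (sub _ sK') (sK' _ (mem_head _ _)).
rewrite !scaler_eq0 => /orP[/eqP e1|//] /orP[/eqP e2|//]; exfalso.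
have : (size K').-1%:R * ucoef s' 0 = (size K).-1%:R * ucoef s' 0.
  by apply: (addIr (- \sum_(p <- s' | p.2 != 0) p.1)); rewrite e1 e2.
move/(mulIf s'0)/natr_inj; have := fsubfield0 Kf.
case: (K) KK => // z K1 /=; case: (K') => //= z' K1' lt _ e.
by rewrite e ltnn in lt.
Qed.

(** In a free [kU]-module on a weight vector, the support of a weight vector is
    stable under a scaling by arbitrary nonzero squares. *)
Lemma Uspan_weight l m x v : weight_space l x -> weight_space m v -> Uspan x v ->
  exists r, v = r *: x.
Proof.
move=> lx mv xv; have [fx|frx] := Ufixed_or_Ufree lx; first exact: Uspan_fixed.
case: xv mv => s -> mv; exists (ucoef s 0).
have coef0 y : y != 0 -> ucoef s y = 0.
  move=> y0; apply: contrapT => /eqP sy.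
  have [z zs] : exists z, z \notin 0 :: [seq t / y | t <- map snd s].
    have [K [Kf _ ltK]] := F_fin [::] (size (0 :: [seq t / y | t <- map snd s])).
    apply: contrapT => noz; move: ltK; rewrite ltnNge => /negP; apply.
    apply: uniq_leq_size; first exact: fsubfield_uniq.
    by move=> z _; apply: contrapT => /negP zn; apply: noz; exists z.
  move: zs; rewrite inE negb_or => /andP[z0 zs].
  have [c c0 cz] := closed_field_sqrt_neq0 z0.
  have := weightE c mv.
  rewrite -usum_dil // (weightE c lx) -usum_scale.
  rewrite usum_scalar -usum_scale => /(usum_free_eq frx)/(_ (z * y)).
  rewrite !ucoef_scale ucoef_dil // cz [z * y]mulrC mulfK //.
  have -> : ucoef s (y * z) = 0.
    apply: ucoef0_out; apply: contra zs => zs; apply/mapP; exists (y * z) => //.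
    by rewrite mulrC mulKf ?mulfK.
  by rewrite mulr0 => /eqP; rewrite mulf_eq0 (negPf (chi_neq0 _ _)) (negPf sy).
rewrite (@usumE _ _ _ (undup (0 :: map snd s))) ?undup_uniq //; last first.
  by move=> y ys; rewrite mem_undup inE ys orbT.
rewrite (bigD1_seq 0) ?undup_uniq ?mem_undup ?mem_head //= big1 ?addr0 ?xact0 //.
by move=> y y0; rewrite coef0 // scale0r.
Qed.

(** A finitely supported function on [F] is not translation-invariant. *)
Lemma Uspan_free_Ufixed x v : Ufree x -> Uspan x v -> Ufixed v -> v = 0.
Proof.
move=> frx [s ->] fv; apply: usum_eq0 => y; apply: contrapT => /eqP sy.
have [K [Kf sK ltK]] := F_fin [::] (size (map snd s)).
suff : (size K <= size (map snd s))%N by rewrite leqNgt ltK.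
rewrite -(size_map (fun z => y + z)); apply: uniq_leq_size.
  by rewrite map_inj_uniq ?fsubfield_uniq //; apply: addrI.
move=> _ /mapP[z _ ->]; apply: contrapT => /negP/ucoef0_out e.
have := fv (- z); rewrite -usum_shift => /(usum_free_eq frx)/(_ y).
by rewrite ucoef_shift opprK e => /esym/eqP; rewrite (negPf sy).
Qed.

End Dichotomy.

(** * Modules split as direct sums of cyclic [kU]-modules *)

Section Split.
Context (F k : fieldType) (M : gmod k (SL2 F)).

Definition Udirect n (xi : 'I_n -> M) := forall w : 'I_n -> M,
  (forall i, Uspan (xi i) (w i)) -> \sum_i w i = 0 -> forall i, w i = 0.

Definition Uspanning n (xi : 'I_n -> M) := forall m, exists w : 'I_n -> M,
  (forall i, Uspan (xi i) (w i)) /\ m = \sum_i w i.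

Lemma kU_spanP (x v : M) : kU_span x v <-> Uspan x v.
Proof.
split=> [[n [c [u [uU ->]]]]|[s ->]].
  apply: (lsub_sum (lsub_Uspan x)) => i _; apply: (lsubZ (lsub_Uspan x)).
  have [g gU <-] := uU i; have [a ->] := unipotentP gU.
  exact/Uspan_xact/Uspan_id.
exists (size s), (fun i => (tnth (in_tuple s) i).1),
  (fun i => xact (tnth (in_tuple s) i).2 x); split.
  by move=> i; exists (ux (tnth (in_tuple s) i).2) => //; apply: ux_unipotent.
by rewrite /usum big_tnth.
Qed.

(** The vectors are carried over from the external direct sum to [M] along the
    given isomorphism. *)
Lemma in_CG_split : in_CG M -> exists n (xi : 'I_n -> M) (lam : 'I_n -> torus_char F k),
  [/\ forall i, weight_space (lam i) (xi i), Udirect xi & Uspanning xi].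
Proof.
move=> [n [_ [x [xT [phi [phil phiB phiI phiR]]]]]]; exists n.
have [lam lamP] : exists lam, forall i, weight_space (lam i) (x i).
  by have [lam] := choice xT; exists lam.
pose d (i : 'I_n) (v : M) (j : 'I_n) : M := if j == i then v else 0.
have dR i v : Uspan (x i) v -> exists m, phi m = d i v.
  move=> xv; suff : range phi (d i v) by case=> m _ <-; exists m.
  rewrite phiR /= => j; apply/kU_spanP; rewrite /d.
  by case: eqP => [->//|_]; apply: lsub0; apply: lsub_Uspan.
have [xi xiP] := choice (fun i => dR i _ (Uspan_id (x i))).
have phi0 : phi 0 = fun=> 0.
  by have := phil (-1) 0 0; rewrite scaleN1r addNr => ->; rewrite scaleN1r addNr.
have phiD u v i : phi (u + v) i = phi u i + phi v i.
  by rewrite -[u]scale1r phil !scale1r.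
have phiZ r u i : phi (r *: u) i = r *: phi u i.
  by rewrite -[r *: u]addr0 phil phi0 /= addr0.
have phi_sum I (r : seq I) (P : pred I) f i :
    phi (\sum_(j <- r | P j) f j) i = \sum_(j <- r | P j) phi (f j) i.
  by apply: (big_morph (fun u => phi u i)) => [u v|]; [apply: phiD | rewrite phi0].
have phi_usum i s j : phi (usum s (xi i)) j = d i (usum s (x i)) j.
  rewrite phi_sum /d; under eq_bigr do rewrite phiZ phiB ?ux_borel // xiP.
  rewrite /d; case: eqP => // _.
  by rewrite big1 // => p _; rewrite gact0 scaler0.
exists xi, lam; split.
- move=> i; apply/weight_spaceP => c c0; apply: phiI; apply/funext => j.
  rewrite phiB ?hx_borel // phiZ xiP /d; case: eqP => _.
    by rewrite (weightE c (lamP i)).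
  by rewrite gact0 scaler0.
- move=> w wU w0 i; apply: phiI; rewrite phi0; apply/funext => j.
  have dw l : phi (w l) = d l (phi (w l) l).
    by have [s ->] := wU l; apply/funext => j'; rewrite !phi_usum /d eqxx.
  rewrite dw /d; case: eqP => // _.
  have := congr1 (fun v => phi v i) w0; rewrite phi0 phi_sum (bigD1 i) //=.
  rewrite [X in _ + X]big1 ?addr0 // => l li.
  by rewrite dw /d eq_sym (negPf li).
- move=> m; have phim i : Uspan (x i) (phi m i).
    apply/kU_spanP; have : range phi (phi m) by exists m.
    by rewrite phiR.
  have [s sE] := choice phim; exists (fun i => usum (s i) (xi i)); split.
    by move=> i; exists (s i).
  apply: phiI; apply/funext => j; rewrite phi_sum (bigD1 j) //= phi_usum /d eqxx.
  rewrite big1 ?addr0 // => i ij; rewrite phi_usum /d.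
  by rewrite eq_sym (negPf ij).
Qed.

End Split.

Section Coordinates.
Context (F : closedFieldType) (k : fieldType) (M : gmod k (SL2 F)).
Hypothesis k_char0 : [pchar k] =i pred0.
Hypothesis F_fin : locally_finite_field F.
Context (n : nat) (xi : 'I_n -> M) (lam : 'I_n -> torus_char F k).
Hypotheses (xiw : forall i, weight_space (lam i) (xi i))
  (xid : Udirect xi) (xis : Uspanning xi).
Implicit Types (u v m : M) (i j : 'I_n) (a c e y z : F).

Definition decomp m (s : 'I_n -> seq (k * F)) := m = \sum_i usum (s i) (xi i).

Fact decomp_ex m : exists s, decomp m s.
Proof.
have [w [wU ->]] := xis m; have [s sP] := choice wU; exists s.
by apply: eq_bigr => i _; rewrite sP.
Qed.

(** The coefficient of [x(y) xi_i] in [m]; by convention it is [0] when [xi_i]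
    is fixed by [U], since it is then not determined by [m]. *)
Definition co m i y : k :=
  if `[< Ufree (xi i) >] then ucoef (sval (cid (decomp_ex m)) i) y else 0.

Lemma coE m s i y : decomp m s ->
  co m i y = if `[< Ufree (xi i) >] then ucoef (s i) y else 0.
Proof.
move=> ms; rewrite /co; case: asboolP => // fri; case: cid => s' /= ms'.
apply: (usum_free_eq fri); apply/eqP; rewrite -subr_eq0; apply/eqP.
apply: (xid (w := fun i => usum (s' i) (xi i) - usum (s i) (xi i))).
  by move=> j; apply: (lsubB (lsub_Uspan _)); [exists (s' j) | exists (s j)].
by rewrite sumrB -ms' -ms subrr.
Qed.

Lemma co_lin (r : k) u v i y : co (r *: u + v) i y = r * co u i y + co v i y.
Proof.
have [s us] := decomp_ex u; have [s' vs] := decomp_ex v.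
rewrite (coE _ _ us) (coE _ _ vs).
rewrite (@coE _ (fun i => uscale r (s i) ++ s' i)); last first.
  rewrite /decomp us vs scaler_sumr -big_split; apply: eq_bigr => j _.
  by rewrite usum_cat usum_scale.
case: asboolP => _; last by rewrite mulr0 addr0.
by rewrite ucoef_cat ucoef_scale.
Qed.

Lemma co0 i y : co 0 i y = 0.
Proof. by have := co_lin (-1) 0 0 i y; rewrite scaler0 addr0 mulN1r addNr. Qed.

Lemma coD u v i y : co (u + v) i y = co u i y + co v i y.
Proof. by rewrite -[u]scale1r co_lin mul1r scale1r. Qed.

Lemma coZ r u i y : co (r *: u) i y = r * co u i y.
Proof. by rewrite -[r *: u]addr0 co_lin co0 addr0. Qed.

Lemma coB u v i y : co (u - v) i y = co u i y - co v i y.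
Proof. by rewrite coD -scaleN1r coZ mulN1r. Qed.

Lemma co_sum I (r : seq I) (P : pred I) f i y :
  co (\sum_(j <- r | P j) f j) i y = \sum_(j <- r | P j) co (f j) i y.
Proof. exact: (big_morph (fun u => co u i y) (fun u v => coD u v i y) (co0 i y)). Qed.

Lemma co_xact a m i y : co (xact a m) i y = co m i (y - a).
Proof.
have [s ms] := decomp_ex m; rewrite (coE _ _ ms).
rewrite (@coE _ (fun i => ushift a (s i))) ?ucoef_shift //.
by rewrite /decomp {1}ms gact_sum; apply: eq_bigr => j _; rewrite usum_shift.
Qed.

Lemma co_hact c m i y : c != 0 ->
  co (hact c m) i y = chi (lam i) c * co m i (y / c ^+ 2).
Proof.
move=> c0; have [s ms] := decomp_ex m; rewrite (coE _ _ ms).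
rewrite (@coE _ (fun i => uscale (chi (lam i) c) (udil c (s i)))); last first.
  rewrite /decomp {1}ms gact_sum; apply: eq_bigr => j _.
  by rewrite -usum_dil // (weightE c (xiw j)) usum_scale usum_scalar.
by case: asboolP => _; rewrite ?mulr0 // ucoef_scale ucoef_dil.
Qed.

Lemma Ufree_xi_fixed i : ~ Ufree (xi i) -> Ufixed (xi i).
Proof. by have [//|fr nfr] := Ufixed_or_Ufree k_char0 F_fin (xiw i). Qed.

Lemma co_support m : exists Y : seq F, forall i y, y \notin Y -> co m i y = 0.
Proof.
have [s ms] := decomp_ex m.
exists (flatten [seq map snd (s i) | i <- enum 'I_n]) => i y yY.
rewrite (coE _ _ ms); case: ifP => // _; apply: ucoef0_out.
apply: contra yY => ys; apply/flattenP; exists (map snd (s i)) => //.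
by apply: map_f; rewrite mem_enum.
Qed.

(** The finite support of the coefficients is invariant under all translations. *)
Lemma Ufixed_co m i y : Ufixed m -> co m i y = 0.
Proof.
move=> fm; apply: contrapT => /eqP my; have [Y Y0] := co_support m.
have [K [Kf _ ltK]] := F_fin [::] (size Y).
suff : (size K <= size Y)%N by rewrite leqNgt ltK.
rewrite -[size K](size_map (fun z => y + z)); apply: uniq_leq_size.
  by rewrite map_inj_uniq ?(fsubfield_uniq Kf) //; apply: addrI.
move=> _ /mapP[z _ ->]; apply: contrapT => /negP/Y0 => /(_ i).
have := co_xact (- z) m i y; rewrite fm opprK => <- e.
by rewrite e eqxx in my.
Qed.

(** By [weight_xispan] this is the span of all weight vectors of [M]; hence it is
    stable under [s]. *)
Definition xispan : set M := [set m | exists r : 'I_n -> k, m = \sum_i r i *: xi i].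

Lemma lsub_xispan : lsub xispan.
Proof.
split=> [|r _ _ [s ->] [s' ->]].
  by exists (fun=> 0); rewrite big1 // => i _; rewrite scale0r.
exists (fun i => r * s i + s' i); rewrite scaler_sumr -big_split.
by apply: eq_bigr => i _; rewrite scalerDl scalerA.
Qed.

Lemma xispan_xi i : xispan (xi i).
Proof.
exists (fun j => (j == i)%:R); rewrite (bigD1 i) //= eqxx scale1r big1 ?addr0 //.
by move=> j /negPf->; rewrite scale0r.
Qed.

Lemma co_xi i j y : co (xi j) i y = (`[< Ufree (xi i) >] && (i == j) && (y == 0))%:R.
Proof.
rewrite (@coE _ (fun l => if l == j then [:: (1, 0)] else [::])).
  case: asboolP => //= _; case: eqP => _ /=; rewrite /ucoef ?big_nil //.
  by rewrite big_mkcond big_seq1 /= eq_sym; case: eqP.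
rewrite /decomp (bigD1 j) //= eqxx big1 => [|l /negPf->].
  by rewrite addr0 /usum big_seq1 scale1r xact0.
by rewrite /usum big_nil.
Qed.

Lemma co_xispan m i y : xispan m -> y != 0 -> co m i y = 0.
Proof.
move=> [r ->] y0; rewrite co_sum big1 // => j _.
by rewrite coZ co_xi (negPf y0) andbF mulr0.
Qed.

(** The scalars [r i] account for the [xi_i] fixed by [U], whose coefficients are
    not recorded by [co]. *)
Lemma co_reconstruct m (Y : seq F) : uniq Y ->
  (forall i y, y \notin Y -> co m i y = 0) ->
  exists r : 'I_n -> k, (forall i, Ufree (xi i) -> r i = 0) /\
    m = \sum_i r i *: xi i + \sum_(y <- Y) xact y (\sum_i co m i y *: xi i).
Proof.
move=> uY mY; have [s ms] := decomp_ex m.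
exists (fun i => if `[< Ufree (xi i) >] then 0 else \sum_(p <- s i) p.1); split.
  by move=> i fri; rewrite asboolT.
under [X in _ + X]eq_bigr do rewrite gact_sum; rewrite exchange_big /= -big_split {1}ms.
apply: eq_bigr => i _; case: asboolP => [fri|nfr].
  rewrite scale0r /= add0r.
  pose s' := [seq (co m i y, y) | y <- Y].
  have -> : \sum_(y <- Y) xact y (co m i y *: xi i) = usum s' (xi i).
    by rewrite /usum big_map; apply: eq_bigr => y _; rewrite gactZ.
  apply/eqP; rewrite -subr_eq0 -[X in _ - X]scale1r -scaleNr -usum_scale -usum_cat.
  apply/eqP/usum_eq0 => y; rewrite ucoef_cat ucoef_scale mulN1r.
  have coms : co m i y = ucoef (s i) y by rewrite (coE _ _ ms) asboolT.
  rewrite -coms /ucoef big_map /= -big_filter; have [yY|yY] := boolP (y \in Y).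
    by rewrite filter_pred1_uniq // big_seq1 subrr.
  rewrite big_filter big_seq_cond big1 ?subr0 ?mY // => z /andP[zY /eqP zy].
  by rewrite -zy zY in yY.
have fi := Ufree_xi_fixed nfr.
rewrite /= [X in _ + X]big1 ?addr0 => [|y _].
  by rewrite /usum scaler_suml; apply: eq_bigr => p _; rewrite fi.
by rewrite (coE _ _ ms) asboolF // scale0r gact0.
Qed.

Lemma co0_fixed m : (forall i y, co m i y = 0) -> Ufixed m /\ xispan m.
Proof.
move=> m0; have [||r [rP ->]] := @co_reconstruct m [::] => //.
rewrite big_nil addr0; split; last by exists r.
apply: (lsub_sum (@lsub_Ufixed _ _ M)) => i _.
have [/rP->|/Ufree_xi_fixed fi] := pselect (Ufree (xi i)).
  by rewrite scale0r; apply: lsub0 (@lsub_Ufixed _ _ M).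
exact: lsubZ (@lsub_Ufixed _ _ M) _ _ fi.
Qed.

Lemma Ufixed_xispan m : Ufixed m -> xispan m.
Proof. by move=> fm; have [] := @co0_fixed m (fun i y => Ufixed_co i y fm). Qed.

Lemma xispanP m : (forall i y, y != 0 -> co m i y = 0) -> xispan m.
Proof.
move=> m0; have [||r [rP ->]] := @co_reconstruct m [:: 0] => //.
  by move=> i y; rewrite inE => /m0.
rewrite big_seq1 xact0; apply: (lsubD lsub_xispan); first by exists r.
by exists (fun i => co m i 0).
Qed.

Lemma weight_xispan l m : weight_space l m -> xispan m.
Proof.
move=> lm; have [w [wU mw]] := xis m.
have wl i : weight_space l (w i).
  apply/weight_spaceP => c c0; apply/eqP; rewrite -subr_eq0; apply/eqP.
  apply: (xid (w := fun i => hact c (w i) - chi l c *: w i)) => [j|].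
    apply: (lsubB (lsub_Uspan _)); first exact: Uspan_hact (xiw j) c0 _.
    exact: (lsubZ (lsub_Uspan _)).
  by rewrite sumrB -gact_sum -scaler_sumr -mw (weightE c lm) subrr.
have [r rP] := choice (fun i => Uspan_weight k_char0 F_fin (xiw i) (wl i) (wU i)).
by exists r; rewrite mw; apply: eq_bigr => i _; apply: rP.
Qed.

Lemma xispan_hact c m : c != 0 -> xispan m -> xispan (hact c m).
Proof.
move=> c0 [r ->]; exists (fun i => chi (lam i) c * r i).
rewrite gact_sum; apply: eq_bigr => i _.
by rewrite gactZ (weightE c (xiw i)) !scalerA mulrC.
Qed.

Lemma xispan_wact m : xispan m -> xispan (wact m).
Proof.
move=> [r ->]; rewrite gact_sum; apply: (lsub_sum lsub_xispan) => i _.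
rewrite gactZ; apply: (lsubZ lsub_xispan).
exact: weight_xispan (weight_wact (xiw i)).
Qed.

End Coordinates.

(** * Torus-equivariant representations of the additive group *)

(** A finite-dimensional representation of the additive group of [F] whose
    matrix entries are scaled by characters under the torus is constant: summing
    over a subfield [K] with [q] elements yields [A + (q - 1) N], where [N] does
    not depend on [K]; that [1/q] times it is idempotent for two values of [q]
    forces [N = A]. *)
Lemma additive_rep_trivial (F : closedFieldType) (k : fieldType) n
    (rho : F -> 'M[k]_n) (psi : 'I_n -> 'I_n -> F -> k) :
  [pchar k] =i pred0 -> locally_finite_field F ->
  (forall e e', rho (e + e') = rho e *m rho e') ->
  (forall c e i j, c != 0 -> rho (c ^+ 2 * e) i j = psi i j c * rho e i j) ->
  forall e, rho e = rho 0.
Proof.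
move=> k_char0 F_fin rhoD rhoT e.
pose triv i j := `[< forall c, c != 0 -> psi i j c = 1 >].
have wit (p : 'I_n * 'I_n) : exists c, c != 0 /\ (~~ triv p.1 p.2 -> psi p.1 p.2 c != 1).
  case: (boolP (triv p.1 p.2)) => [_|/asboolPn ntriv]; first by exists 1; rewrite oner_neq0.
  apply: contrapT => noc; apply: ntriv => c c0; apply: contrapT => /eqP pc.
  by apply: noc; exists c.
have [c cP] := choice wit.
pose N : 'M[k]_n := \matrix_(i, j) if triv i j then rho 1 i j else 0.
pose A := rho 0.
pose good (K : seq F) := fsubfield K /\ {subset e :: codom (fun p => c p ^+ 2) <= K}.
have sumK K : good K -> \sum_(z <- K) rho z = A + (size K).-1%:R *: N.
  move=> [Kf cK]; rewrite (sum_fsubfield0 Kf); congr (_ + _).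
  apply/matrixP => i j; rewrite summxE !mxE; case: (boolP (triv i j)) => [tr|ntr].
    rewrite (eq_bigr (fun=> rho 1 i j)) ?sum_fsubfield_const ?mulr_natl //.
    move=> z z0; have [d d0 dz] := closed_field_sqrt_neq0 z0.
    by rewrite -[z]mulr1 -dz rhoT // (asboolP _ tr) // mul1r.
  rewrite mulr0; set S := LHS; have [c0 /(_ ntr) pc] := cP (i, j).
  have : psi i j (c (i, j)) * S = S.
    rewrite {1}/S mulr_sumr.
    have t0 : c (i, j) ^+ 2 != 0 by rewrite expf_neq0.
    have tK : c (i, j) ^+ 2 \in K.
      by apply: cK; rewrite inE (codom_f (fun p => c p ^+ 2)) orbT.
    rewrite -[RHS](sum_fsubfieldM Kf _ tK t0).
    by apply: eq_bigr => z z0; rewrite rhoT.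
  move/eqP; rewrite -subr_eq0 -{2}[S]mul1r -mulrBl mulf_eq0 subr_eq0 (negPf pc).
  by move/eqP.
have q1 K : good K -> (1 < size K)%N.
  move=> [Kf _]; have : {subset [:: 0; 1] <= K}.
    by move=> z; rewrite !inE => /orP[]/eqP->; [apply: fsubfield0 | apply: fsubfield1].
  by move/uniq_leq_size; apply; rewrite /= andbT inE eq_sym oner_neq0.
have idemK K : good K -> (\sum_(z <- K) rho z) *m (\sum_(z <- K) rho z) =
    (size K)%:R *: \sum_(z <- K) rho z.
  move=> [Kf _]; rewrite mulmx_suml; set S := \sum_(z <- K) rho z.
  rewrite big_seq (eq_bigr (fun=> S)) => [|z zK].
    by rewrite -big_seq big_const_seq count_predT iter_addr_0 scaler_nat.
  rewrite mulmx_sumr -[RHS](sum_fsubfieldD Kf _ zK).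
  by apply: eq_bigr => z' _; rewrite rhoD.
have q0 K : good K -> (size K)%:R = (size K).-1%:R + 1 :> k.
  by move=> Kg; rewrite natr1 prednK // ltnW ?q1.
have q10 K : good K -> (size K).-1%:R != 0 :> k.
  by move=> Kg; rewrite natr_eq0 // -lt0n -ltnS prednK ?q1 // ltnW ?q1.
(* [A] is the idempotent [rho 0]; it is a unit for [N], because every
   [rho e] factors through it. *)
have AA : A *m A = A by rewrite -rhoD addr0.
have AE K : A *m (\sum_(z <- K) rho z) = \sum_(z <- K) rho z.
  by rewrite mulmx_sumr; apply: eq_bigr => z _; rewrite -rhoD add0r.
have EA K : (\sum_(z <- K) rho z) *m A = \sum_(z <- K) rho z.
  by rewrite mulmx_suml; apply: eq_bigr => z _; rewrite -rhoD addr0.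
have AN K : good K -> A *m N = N /\ N *m A = N.
  move=> Kg; have := AE K; have := EA K; rewrite sumK // mulmxDl mulmxDr AA.
  move=> /addrI; rewrite -scalemxAl => /(scalerI (q10 K Kg)) e1.
  by move=> /addrI; rewrite -scalemxAr => /(scalerI (q10 K Kg)) e2.
have eqK K : good K -> 2%:R *: N + (size K).-1%:R *: (N *m N) - A - (size K)%:R *: N = 0.
  move=> Kg; have [AN1 NA1] := AN K Kg.
  have := idemK K Kg; rewrite sumK // mulmxDl !mulmxDr AA -!scalemxAr -!scalemxAl.
  rewrite AN1 NA1 scalerA => /eqP; rewrite -subr_eq0 => /eqP E.
  apply: (scalerI (q10 K Kg)); rewrite scaler0 -[RHS]E.
  rewrite (q0 K Kg); apply/matrixP => i j; rewrite !mxE; ring.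
have [K [Kf Ks _]] := F_fin (e :: codom (fun p => c p ^+ 2)) 0.
have [K' [Kf' Ks' ltK]] := F_fin (e :: codom (fun p => c p ^+ 2)) (size K).
have Kg : good K by []. have Kg' : good K' by [].
(* Subtract the quadratic equations for [N] given by the two subfields. *)
have NN : N *m N = N.
  apply/eqP; rewrite -subr_eq0; apply/eqP.
  have d0 : (size K')%:R - (size K)%:R != 0 :> k.
    by rewrite subr_eq0; apply: contraTneq ltK => /(natr_inj k_char0)->; rewrite ltnn.
  apply: (scalerI d0); rewrite scaler0 -[RHS](subrr 0) -{1}(eqK K' Kg') -(eqK K Kg).
  rewrite !q0 //; apply/matrixP => i j; rewrite !mxE; ring.
have NA : N = A.
  have := eqK K Kg; rewrite NN => E; apply/eqP; rewrite -subr_eq0 -[X in _ == X]E.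
  by rewrite q0 //; apply/eqP/matrixP => i j; rewrite !mxE; ring.
have sumKA : \sum_(z <- K) rho z = (size K)%:R *: A.
  by rewrite sumK // NA -{1}[A]scale1r -scalerDl addrC -q0.
have qK : (size K)%:R != 0 :> k by rewrite natr_eq0 // -lt0n ltnW ?q1.
have eK : e \in K by apply: Ks; rewrite mem_head.
have : rho e *m (\sum_(z <- K) rho z) = \sum_(z <- K) rho z.
  rewrite mulmx_sumr -[RHS](sum_fsubfieldD Kf _ eK).
  by apply: eq_bigr => z _; rewrite rhoD.
rewrite sumKA -scalemxAr => /(scalerI qK) E.
by rewrite -[RHS]E /A -rhoD addr0.
Qed.

(** * The action of the Weyl element on T-eigenvectors *)

Section Support.
Context (F : closedFieldType) (k : fieldType) (M : gmod k (SL2 F)).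
Hypothesis k_char0 : [pchar k] =i pred0.
Hypothesis F_fin : locally_finite_field F.
Context (n : nat) (xi : 'I_n -> M) (lam : 'I_n -> torus_char F k).
Hypotheses (xiw : forall i, weight_space (lam i) (xi i))
  (xid : Udirect xi) (xis : Uspanning xi).
Implicit Types (u v m : M) (i j l : 'I_n) (a c e y z : F).

Local Notation cf := (@co F k M n xi xis).

Let coxw := xispan_wact k_char0 F_fin xiw xid xis.
Let coxh := @xispan_hact F k M n xi lam xiw.
Let coDx := coD xid xis.
Let coZx := coZ xid xis.
Let cosumx := co_sum xid xis.
Let coxx := co_xact xid xis.
Let cohx := co_hact xiw xid xis.
Let coxs := co_xispan xid xis.

Let N10 : -1 != 0 :> F. Proof. by rewrite oppr_eq0 oner_neq0. Qed.

(** Write [y(e) v = y(e) x(- e^-1) v] and use [y(e) x(- e^-1) = x(e^-1) h s]. *)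
Lemma co_lact_fixed v e i p : Ufixed v -> e != 0 -> p != e^-1 -> cf (lact e v) i p = 0.
Proof.
move=> fv e0 pe; rewrite -{1}(fv (- e^-1)) lact_xactN // coxx.
apply: coxs; last by rewrite subr_eq0.
apply: coxh; first by rewrite oppr_eq0 invr_eq0.
by apply: coxw; apply: (Ufixed_xispan k_char0 F_fin xiw xid xis).
Qed.

Lemma co_lact_scale e c i j y : c != 0 ->
  cf (lact (c ^+ 2 * e) (xi j)) i y =
    chi (lam j) c / chi (lam i) c * cf (lact e (xi j)) i (y * c ^+ 2).
Proof.
move=> c0; have cV0 : c^-1 != 0 by rewrite invr_eq0.
rewrite -(hactK (lact _ _) c0) hact_lact // (weightE c (xiw j)) cohx //.
by rewrite gactZ coZx chiV // exprVn invrK mulrA [_^-1 * _]mulrC.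
Qed.

Lemma co_lact_xact e z i j p : e != 0 -> 1 + e * z != 0 ->
  exists r, cf (lact e (xact z (xi j))) i p =
            r * cf (lact 1 (xi j)) i ((p * (1 + e * z) - z) * e).
Proof.
move=> e0 ez0; rewrite lact_xact // coxx.
have eV : (1 + e * z)^-1 != 0 by rewrite invr_eq0.
have t0 : e / (1 + e * z) != 0 by rewrite mulf_neq0.
have [c c0 ct] := closed_field_sqrt_neq0 t0.
rewrite cohx // -[e / _]mulr1 -ct co_lact_scale // ct mulrA; eexists.
by rewrite exprVn invrK; congr (_ * cf _ _ _); field; rewrite ez0.
Qed.

(** Expand [y(1 + e) xi_j = y(e) (y(1) xi_j)]. As [e] varies, the positions on
    the two sides are rational functions of [e] that agree only at a position of
    [y(1) xi_j] equal to [0] or [1], so for a generic [e] the coefficients at any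
    other position have to vanish. *)
Lemma co_lact1_support i j y0 : y0 != 0 -> y0 != 1 -> cf (lact 1 (xi j)) i y0 = 0.
Proof.
move=> y00 y01.
have [Y [uY Y0]] : exists Y, uniq Y /\
    forall l i y, y \notin Y -> cf (lact 1 (xi l)) i y = 0.
  have [Z ZP] := choice (fun l => co_support xid xis (lact 1 (xi l))).
  exists (undup (flatten (codom Z))); split=> [|l i' y]; first exact: undup_uniq.
  rewrite mem_undup => yZ; apply: ZP; apply: contra yZ => yZ.
  by apply/flattenP; exists (Z l) => //; apply: codom_f.
(* For [e] not a root of [P], no pair of a position [z] of [y(1) xi_j] and a
   position [y] of [y(1) xi_l] contributes to the position [y0 / (1 + e)] of
   [y(e) (y(1) xi_j)]: this is the condition given by [Q z y]. *)
pose Q (z y : F) : {poly F} := Poly [:: - y; y0 - z - y; (y0 - 1) * z].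
pose R (z : F) : {poly F} := Poly [:: 1; z].
pose P : {poly F} := 'X * Poly [:: 1; 1] * Poly [:: -1; y0 - 1] *
   (\prod_(z <- Y) R z) * (\prod_(z <- Y) \prod_(y <- Y) Q z y).
have Poly0 (s : seq F) b : nth 0 s b != 0 -> Poly s != 0.
  by apply: contraNneq => s0; rewrite -coef_Poly s0 coef0.
have P0 : P != 0.
  rewrite !mulf_neq0 ?polyX_eq0 ?(@Poly0 _ 0%N) ?oner_neq0 //.
    by rewrite prodf_seq_neq0; apply/allP => z _; apply: (@Poly0 _ 0%N); rewrite oner_neq0.
  rewrite prodf_seq_neq0; apply/allP => z _; rewrite prodf_seq_neq0; apply/allP => y _ /=.
  have [y0'|] := eqVneq y 0; last by move=> y'; apply: (@Poly0 _ 0%N); rewrite /= oppr_eq0.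
  have [zy|] := eqVneq z y0.
    by apply: (@Poly0 _ 2%N); rewrite /= zy mulf_neq0 // subr_eq0.
  by move=> zy; apply: (@Poly0 _ 1%N); rewrite /= y0' subr0 subr_eq0 eq_sym.
have /closed_nonrootP[e] := P0.
rewrite /root !hornerM !horner_prod !mulf_eq0 !negb_or hornerX !horner_Poly /=.
rewrite !(mul0r, add0r, mul1r) !prodf_seq_neq0 addrC.
move=> /andP[/andP[/andP[/andP[e0 e1] ey] /allP eR] /allP eQ].
have {}eR z : z \in Y -> 1 + e * z != 0.
  by move=> /eR/=; rewrite horner_Poly /= mul0r add0r addrC mulrC.
have {}eQ z y : z \in Y -> y \in Y ->
    (y0 - 1) * z * e ^+ 2 + (y0 - z - y) * e - y != 0.
  move=> /eQ/=; rewrite horner_prod prodf_seq_neq0 => /allP h /h /=.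
  by rewrite horner_Poly /=; congr (_ != 0); ring.
have e10 : e + 1 != 0 by rewrite addrC.
pose p := y0 / (e + 1).
have [c c0 ce] := closed_field_sqrt_neq0 e10.
have : cf (lact (e + 1) (xi j)) i p = 0.
  rewrite -lactD.
  have [//||r [r0 ->]] :=
    @co_reconstruct _ _ _ k_char0 F_fin _ _ _ xiw xid xis (lact 1 (xi j)) Y.
    by move=> l y; apply: Y0.
  rewrite gactD coDx !gact_sum !cosumx big1 ?add0r => [|l _].
    rewrite big_seq big1 // => z zY.
    rewrite gact_sum gact_sum cosumx big1 // => l _.
    rewrite !gactZ coZx; have [r' ->] := co_lact_xact i l p e0 (eR z zY).
    have -> : cf (lact 1 (xi l)) i ((p * (1 + e * z) - z) * e) = 0.
      apply: Y0; apply/negP => qY.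
      by case/eqP: (eQ _ _ zY qY); rewrite /p; field.
    by rewrite !mulr0.
  rewrite gactZ coZx; have [/r0->|nfr] := pselect (Ufree (xi l)); first by rewrite mul0r.
  rewrite co_lact_fixed ?mulr0 //; first exact: Ufree_xi_fixed nfr.
  rewrite /p; apply: contraNneq ey => pe.
  have : y0 = e^-1 * (e + 1) by rewrite -pe mulfVK.
  by move=> ->; apply/eqP; field.
rewrite -[e + 1]mulr1 -ce co_lact_scale // /p ce mulfVK // => /eqP.
by rewrite mulf_eq0 mulf_eq0 invr_eq0 !(negPf (chi_neq0 _ _)) => /eqP.
Qed.

Lemma co_lact_support e i j y : e != 0 -> y != 0 -> y != e^-1 ->
  cf (lact e (xi j)) i y = 0.
Proof.
move=> e0 y0 ye; have [c c0 ce] := closed_field_sqrt_neq0 e0.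
rewrite -[e]mulr1 -ce co_lact_scale // co_lact1_support ?mulr0 // ce.
  by rewrite mulf_neq0.
by apply: contra_neq ye => ye; apply: (mulIf e0); rewrite ye mulVf.
Qed.

(** Modulo [U]-fixed vectors, the component of [y(e) xi_j] at position [0] defines
    a representation of the additive group on the span of the free [xi_i]. *)
Let rho e : 'M[k]_n := \matrix_(i, j) cf (lact e (xi j)) i 0.

Let co_lact_xact0 e z i j : e != 0 -> z != 0 -> cf (lact e (xact z (xi j))) i 0 = 0.
Proof.
move=> e0 z0; have [ez|ez] := eqVneq (1 + e * z) 0; last first.
  have [r ->] := co_lact_xact i j 0 e0 ez.
  rewrite mul0r sub0r co_lact1_support ?mulr0 //.
    by rewrite mulf_neq0 // oppr_eq0.
  by apply: contra_neq ez => ez; rewrite mulrC -[z * e]opprK -mulNr ez subrr.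
have -> : z = - e^-1.
  apply: (mulfI e0); apply/eqP; rewrite mulrN mulfV // -addr_eq0 addrC.
  exact/eqP.
rewrite lact_xactN // coxx; apply: coxs; last by rewrite sub0r oppr_eq0 invr_eq0.
apply: coxh; first by rewrite oppr_eq0 invr_eq0.
by apply: coxw; apply: xispan_xi.
Qed.

Let rhoD e e' : rho (e + e') = rho e *m rho e'.
Proof.
apply/matrixP => i j; rewrite !mxE -lactD.
have co_xi0 l i' : cf (xi l) i' 0 = (`[< Ufree (xi i') >] && (i' == l))%:R.
  by rewrite (co_xi xid xis) eqxx andbT.
have [->|e0] := eqVneq e 0.
  rewrite lact0 (bigD1 i) //= big1 ?addr0 => [|l li]; last first.
    by rewrite mxE lact0 co_xi0 eq_sym (negPf li) andbF mul0r.
  rewrite !mxE lact0 co_xi0 eqxx andbT; case: asboolP => [_|nfr]; first by rewrite mul1r.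
  by rewrite mul0r /co asboolF.
have [->|e'0] := eqVneq e' 0.
  rewrite lact0 (bigD1 j) //= big1 ?addr0 => [|l lj]; last first.
    by rewrite !mxE lact0 co_xi0 (negPf lj) andbF mulr0.
  rewrite !mxE lact0 co_xi0 eqxx andbT; case: asboolP => [_|nfr]; first by rewrite mulr1.
  rewrite mulr0; apply: co_lact_fixed => //; first exact: Ufree_xi_fixed nfr.
  by rewrite eq_sym invr_eq0.
have e'V : e'^-1 != 0 by rewrite invr_eq0.
have [||r [r0 E]] := @co_reconstruct _ _ _ k_char0 F_fin _ _ _ xiw xid xis (lact e' (xi j)) [:: 0; e'^-1].
- by rewrite /= inE eq_sym e'V.
- by move=> l y; rewrite !inE negb_or => /andP[y0 ye]; apply: co_lact_support.
rewrite {}E gactD coDx big_cons big_seq1 xact0 gactD coDx.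
have -> : cf (lact e (\sum_l r l *: xi l)) i 0 = 0.
  rewrite gact_sum cosumx big1 // => l _; rewrite gactZ coZx.
  have [/r0->|nfr] := pselect (Ufree (xi l)); first by rewrite mul0r.
  rewrite co_lact_fixed ?mulr0 //; first exact: Ufree_xi_fixed nfr.
  by rewrite eq_sym invr_eq0.
rewrite add0r [X in _ + X](_ : _ = 0) ?addr0 => [|//].
  rewrite gact_sum cosumx; apply: eq_bigr => l _.
  by rewrite gactZ coZx !mxE mulrC.
rewrite !gact_sum cosumx big1 // => l _.
by rewrite !gactZ coZx co_lact_xact0 ?mulr0.
Qed.

Let rho_const e : rho e = rho 0.
Proof.
apply: (@additive_rep_trivial _ _ _ rho (fun i j c => chi (lam j) c / chi (lam i) c)) => //.
by move=> c e' i j c0; rewrite !mxE co_lact_scale // mul0r.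
Qed.

Lemma xact_lact_xispan u : xispan xi u -> xispan xi (xact (-1) (lact 1 u - u)).
Proof.
move=> [r ->]; rewrite gact_sum -sumrB gact_sum.
apply: (lsub_sum (lsub_xispan xi)) => j _; rewrite gactZ -scalerBr gactZ.
apply: (lsubZ (lsub_xispan xi)). apply: (xispanP k_char0 F_fin xiw xid (xis := xis)) => i y y0.
rewrite coxx opprK (coB xid xis).
have [y1|y1] := eqVneq (y + 1) 0.
  have := congr1 (fun A : 'M_n => A i j) (rho_const 1).
  by rewrite !mxE lact0 y1 => ->; rewrite subrr.
have y2 : y + 1 != 1 by rewrite -subr_eq0 addrK.
by rewrite co_lact1_support // coxs ?subr0 //; apply: xispan_xi.
Qed.

(** The vector [s^-1 u], written with [s^-1 = h(-1) s]. *)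
Definition wVact (u : M) : M := hact (-1) (wact u).

(** This is [0] on Steinberg vectors, where [s^-1 x(1) u = x(-1) u + s^-1 u], and
    [u] on [U]-fixed vectors. *)
Definition Upart (u : M) : M := wVact u - (wVact (xact 1 u) - xact (-1) u).

(** Both [Upart u] and its translate [x(-1) (Upart u)] are in the span of the
    [xi_i]: for the latter, compute the square of [s^-1 x(1)] on [u] in two ways.
    So [Upart u] has no coefficient at any position. *)
Lemma Upart_fixed u : xispan xi u -> Ufixed (Upart u) /\ xispan xi (Upart u).
Proof.
have wVs v : xispan xi v -> xispan xi (wVact v).
  by move=> vs; apply: coxh => //; apply: coxw.
pose D v := wVact (xact 1 v) - xact (-1) v.
have Ds v : xispan xi v -> xispan xi (D v).
  move/xact_lact_xispan; rewrite lact1E gactB !xactD addNr xact0.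
  by [].
move=> us; have Us : xispan xi (Upart u).
  by apply: (lsubB (lsub_xispan xi)); [apply: wVs | apply: Ds].
split=> //.
have sq : wVact (xact 1 (wVact (xact 1 u))) = xact (-1) (wVact u).
  have h1 (v : M) : xact 1 (hact (-1) v) = hact (-1) (xact 1 v).
    by rewrite hact_xact // sqrrN expr1n mulr1.
  rewrite /wVact h1 wact_hact // invrN1 hactM // mulrNN mulr1 hact1.
  by rewrite wact_xact_wact ?oner_neq0 // invr1 xactD addNr xact0.
have gE v : wVact (xact 1 v) = xact (-1) v + D v by rewrite addrC subrK.
have wVD v v' : wVact (v + v') = wVact v + wVact v' by rewrite /wVact !gactD.
have xs : xispan xi (xact (-1) (Upart u)).
  have -> : xact (-1) (Upart u) = wVact u + D (D u).
    rewrite gactB -sq -/(D u) [in xact 1 (wVact _)]gE gactD wVD xactD subrr xact0 gE.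
    by rewrite addrA addrAC addrK.
  by apply: (lsubD (lsub_xispan xi)); [apply: wVs | do 2!apply: (Ds)].
apply: (co0_fixed k_char0 F_fin xiw xid (xis := xis) _).1 => i y.
have [->|y0] := eqVneq y 0; last exact: coxs.
have := coxx (-1) (Upart u) i (-1); rewrite subrr => <-.
exact: coxs.
Qed.

End Support.

(** * Standard vectors *)

Section StandardVectors.
Context (F k : fieldType) (M : gmod k (SL2 F)).

(** The images of the generator [s 1 - 1] of the Steinberg module under the
    homomorphisms from that module to [M]. *)
Definition steinberg_vector : set M := [set e | [/\ forall c, c != 0 -> hact c e = e,
  wact e = - e & wact (xact 1 e) = xact (-1) e - e]].

Definition Uweight (l : torus_char F k) : set M :=
  [set v | Ufixed v /\ weight_space l v].

Definition std (l : option (torus_char F k)) : set M :=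
  if l is Some l then Uweight l else steinberg_vector.

(** Generation by finitely many standard vectors: equivalently, being a quotient
    of a finite direct sum of Steinberg modules and of modules induced from
    characters of [B]. *)
Definition std_generated := exists gs : seq M,
  (forall g, g \in gs -> exists l, std l g) /\
  (forall N : set M, submod N -> (forall g, g \in gs -> N g) -> forall m, N m).

Lemma lsub_Uweight l : lsub (Uweight l).
Proof.
split; first by split; [apply: lsub0 (@lsub_Ufixed _ _ M) | apply: lsub0 (lsub_weight _ _)].
move=> r u v [fu lu] [fv lv]; split; first exact: (@lsub_Ufixed _ _ M).2.
exact: (lsub_weight M l).2.
Qed.

Lemma lsub_steinberg : lsub steinberg_vector.
Proof.
split=> [|r u v [u1 u2 u3] [v1 v2 v3]].
  by split=> *; rewrite ?gact0 ?oppr0 ?addr0.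
split=> [c c0||]; rewrite !gactD !gactZ ?u1 ?v1 //; first by rewrite u2 v2 scalerN opprD.
by rewrite u3 v3 scalerBr opprD addrACA.
Qed.

Lemma lsub_std l : lsub (std l).
Proof. by case: l => [l|]; [apply: lsub_Uweight | apply: lsub_steinberg]. Qed.

Lemma std_weight l g : std l g -> weight_space (odflt chi_one l) g.
Proof.
case: l => [l [_ //]|[h _ _]]; apply/weight_spaceP => c c0.
by rewrite h // scale1r.
Qed.

End StandardVectors.

Lemma sum_fibers0 (I : Type) (T : eqType) (V : nmodType) (r : seq I) (wt : I -> T)
    (u : I -> V) :
  (forall t, \sum_(i <- r | wt i == t) u i = 0) -> \sum_(i <- r) u i = 0.
Proof.
move=> u0; transitivity (\sum_(t <- undup (map wt r)) \sum_(i <- r | wt i == t) u i).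
  rewrite (exchange_big_dep xpredT) //=.
  have : all (fun i => wt i \in undup (map wt r)) r.
    have := allss (map wt r); rewrite all_map; apply: sub_all => i /=.
    by rewrite mem_undup.
  move: (undup_uniq (map wt r)); move: (undup _) => ts uts.
  elim: r {u0} => [|i r IH]; first by rewrite !big_nil.
  rewrite !big_cons /= => /andP[its /IH <-]; congr (_ + _).
  rewrite -big_filter (eq_filter (a2 := pred1 (wt i))); last by move=> t; rewrite /= eq_sym.
  by rewrite filter_pred1_uniq // big_seq1.
by apply: big1 => t _; apply: u0.
Qed.

Section CGGenerated.
Context (F : closedFieldType) (k : fieldType) (M : gmod k (SL2 F)).
Hypothesis k_char0 : [pchar k] =i pred0.
Hypothesis F_fin : locally_finite_field F.
Context (n : nat) (xi : 'I_n -> M) (lam : 'I_n -> torus_char F k).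
Hypotheses (xiw : forall i, weight_space (lam i) (xi i))
  (xid : Udirect xi) (xis : Uspanning xi).
Implicit Types (l : torus_char F k) (u v m : M).

Let N10 : -1 != 0 :> F. Proof. by rewrite oppr_eq0 oner_neq0. Qed.

Let wVD u v : wVact (u + v) = wVact u + wVact v.
Proof. by rewrite /wVact !gactD. Qed.
Let wVZ (r : k) u : wVact (r *: u) = r *: wVact u.
Proof. by rewrite /wVact !gactZ. Qed.
Let wVB u v : wVact (u - v) = wVact u - wVact v.
Proof. by rewrite /wVact !gactB. Qed.
Let wV_sum (I : Type) (r : seq I) (P : pred I) (f : I -> M) :
  wVact (\sum_(i <- r | P i) f i) = \sum_(i <- r | P i) wVact (f i).
Proof. by rewrite /wVact !gact_sum. Qed.

Let weight_wV l u : weight_space l u -> weight_space (chi_inv l) (wVact u).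
Proof. by move=> lu; apply/weight_hact/weight_wact. Qed.

Let wact_wV u : wact (wVact u) = u.
Proof. by rewrite /wVact wact_hact // invrN1 wact_wact hactM // mulrNN mulr1 hact1. Qed.

Let Upart_id v : Ufixed v -> Upart v = v.
Proof. by move=> fv; rewrite /Upart !fv opprB addrCA subrr addr0. Qed.

Let UpartB u v : Upart (u - v) = Upart u - Upart v.
Proof.
have subACA (x y z t : M) : (x - y) - (z - t) = (x - z) - (y - t).
  by rewrite !opprB addrACA [RHS]addrACA [- z - y]addrC.
by rewrite /Upart !gactB !wVB [X in _ - X = _]subACA [LHS]subACA.
Qed.

(** Compare [y(1) (y(-1) u)] with [u]. *)
Lemma Upart_reflection l u c : c ^+ 2 = -1 -> xispan xi u -> weight_space l u ->
  u + wVact u = Upart u + chi l c *: wVact (hact c^-1 (Upart u)).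
Proof.
move=> c2 us lu; have c0 : c != 0.
  by apply: contraTneq N10 => c0; rewrite -c2 c0 expr0n eqxx.
have cV0 : c^-1 != 0 by rewrite invr_eq0.
have cV2 : c^-1 ^+ 2 = -1 by rewrite exprVn c2 invrN1.
pose D := wVact (xact 1 u) - xact (-1) u.
have DE : D = wVact u - Upart u by rewrite /Upart opprB addrC subrK.
have l1 : lact 1 u = u + xact 1 D.
  by rewrite lact1E /D gactB xactD subrr xact0 addrC subrK.
have lN1 : lact (-1) u = u + xact (-1) (chi l c *: hact c^-1 D).
  apply: (@gact_inj _ _ M (hx c)).
  have -> : -1 = c ^+ 2 * 1 :> F by rewrite mulr1.
  rewrite hact_lact // (weightE c lu) gactZ l1 gactD (weightE c lu) scalerDr.
  congr (_ + _); rewrite !gactZ; congr (_ *: _).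
  by rewrite mulr1 c2 hact_xact // c2 mulrNN mulr1 hactM // mulfV // hact1.
have := @lactD _ _ M 1 (-1) u; rewrite subrr lact0 lN1 gactD l1.
have -> (v : M) : lact 1 (xact (-1) v) = xact 1 (wVact v).
  by have := @lact_xactN _ _ M 1 v (oner_neq0 _); rewrite invr1.
rewrite -addrA -gactD -[RHS]addr0 => /addrI; rewrite -[RHS](@gact0 _ _ M (ux 1)) => /gact_inj.
rewrite wVZ DE gactB wVB scalerBr.
have wVw : weight_space (chi_inv l) (wVact u) by apply: weight_wV.
have -> : chi l c *: wVact (hact c^-1 (wVact u)) = u.
  rewrite (weightE _ wVw) wVZ scalerA chi_invE chiV // invrK.
  have -> : wVact (wVact u) = hact (-1) u.
    by rewrite /wVact wact_hact // invrN1 hactM // mulrNN mulr1 hact1 wact_wact.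
  rewrite (weightE _ lu) scalerA -chiM // -expr2 c2 -expr2 chi_N1 scale1r.
  by [].
move=> E; apply/eqP; rewrite -subr_eq0 -[X in _ == X]E; apply/eqP.
by rewrite opprD [u + _]addrC addrACA.
Qed.

(** The [xi_i] that occur in the [U]-fixed vector [Upart u] are fixed by [U]. *)
Lemma Upart_weights u : xispan xi u -> exists p : 'I_n -> M,
  (forall i, Uweight (lam i) (p i)) /\ Upart u = \sum_i p i.
Proof.
move=> us; have [fU _] := Upart_fixed k_char0 F_fin xiw xid xis us.
have [||r [r0 E]] := co_reconstruct k_char0 F_fin xiw xid (xis := xis) (m := Upart u) (Y := [::]) => //.
  by move=> i y _; apply: (Ufixed_co F_fin xid).
exists (fun i => r i *: xi i); split; last by rewrite {1}E big_nil addr0.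
move=> i; split; last exact: lsubZ (lsub_weight M _) _ _ (xiw i).
have [/r0->|nfr] := pselect (Ufree (xi i)).
  by rewrite scale0r; apply: lsub0 (@lsub_Ufixed _ _ M).
apply: (lsubZ (@lsub_Ufixed _ _ M)).
exact: Ufree_xi_fixed nfr.
Qed.

Let weight_component l l' u (p q : 'I_n -> M) : weight_space l u ->
  (forall j, weight_space (lam j) (p j)) ->
  (forall j, weight_space (chi_inv (lam j)) (q j)) ->
  u + wVact u = \sum_j p j + \sum_j q j ->
  (if l == l' then u else 0) + (if chi_inv l == l' then wVact u else 0) =
  \sum_(j | lam j == l') p j + \sum_(j | chi_inv (lam j) == l') q j.
Proof.
move=> lu pw qw E.
pose wt (x : (bool + 'I_n) + 'I_n) := match x with
  | inl (inl true) => l | inl (inl false) => chi_inv l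
  | inl (inr j) => lam j | inr j => chi_inv (lam j) end.
pose w (x : (bool + 'I_n) + 'I_n) : M := match x with
  | inl (inl true) => u | inl (inl false) => wVact u
  | inl (inr j) => - p j | inr j => - q j end.
have : \sum_(x | wt x == l') w x = 0.
  apply: (@weights_independent _ _ M _ (index_enum _) wt w l') => [[[[]|j]|j]|] //=; [exact: weight_wV | | |].
  - exact: lsubN (lsub_weight M _) _ (pw j).
  - exact: lsubN (lsub_weight M _) _ (qw j).
  rewrite !big_sumType /= big_bool /= E !sumrN.
  by rewrite [X in X - _ - _]addrC addrK subrr.
rewrite !big_sumType /= big_mkcond big_bool /= !sumrN => /eqP.
by rewrite -addrA -opprD subr_eq0 => /eqP.
Qed.

Let Upart0_steinberg (e : M) : (forall d, hact d e = e) -> wVact e = - e ->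
  Upart e = 0 -> steinberg_vector e.
Proof.
move=> eT wVe; split=> [d _||]; first exact: eT.
  by rewrite -wVe /wVact -[in RHS](eT (-1)) wact_hact // invrN1 hactM // mulrNN mulr1 hact1.
have hx1 : hact (-1) (xact 1 e) = xact 1 e by rewrite hact_xact // eT sqrrN expr1n mulr1.
have : Upart e = 0 by []; rewrite /Upart => /eqP; rewrite subr_eq0 wVe => /eqP ->.
by rewrite addrC subrK /wVact -{1}hx1 wact_hact // invrN1.
Qed.

(** Decompose the identity [Upart_reflection] into weight components. If the weight
    [l] of [xi_i] is not trivial, then the component of weight [l] writes [xi_i] in
    terms of [U]-fixed vectors of weights [l] and [l^-1]. Otherwise [Upart xi_i] is
    fixed by [B], and the difference [xi_i - Upart xi_i] is a Steinberg vector. *)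
Lemma xi_std i : exists g1 g2 : M, [/\ exists o, std o g1, exists o, std o g2
  & forall N : set M, submod N -> N g1 -> N g2 -> N (xi i)].
Proof.
have := xiw i; set l := lam i; set u := xi i => lu.
have us : xispan xi u by apply: xispan_xi.
have [p [pU pE]] := Upart_weights us.
have [c c2] := closed_field_sqrt (-1 : F).
have c0 : c != 0 by apply: contraTneq N10 => c0; rewrite -c2 c0 expr0n eqxx.
pose r j : k := chi l c * chi (lam j) c^-1.
have refl : u + wVact u = \sum_j p j + \sum_j wVact (r j *: p j).
  rewrite (Upart_reflection c2 us lu) -pE; congr (_ + _).
  rewrite pE gact_sum wV_sum scaler_sumr; apply: eq_bigr => j _.
  by rewrite (weightE _ (pU j).2) !wVZ scalerA.
have comp l' := weight_component l' lu (fun j => (pU j).2)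
   (fun j => weight_wV (lsubZ (lsub_weight M _) (r j) (pU j).2)) refl.
have sumU l' (P : pred 'I_n) (q : 'I_n -> k) : (forall j, P j -> lam j = l') ->
    Uweight l' (\sum_(j | P j) q j *: p j).
  move=> Pl; apply: (lsub_sum (lsub_Uweight M l')) => j Pj.
  by apply: (lsubZ (lsub_Uweight M l')); rewrite -(Pl j Pj).
have [l1|/eqP l1] := eqVneq l chi_one; last first.
  exists (\sum_(j | lam j == l) p j), (\sum_(j | lam j == chi_inv l) r j *: p j); split.
  - exists (Some l); have /= := sumU l (fun j => lam j == l) (fun=> 1) (fun j h => eqP h).
    by under eq_bigr do rewrite scale1r.
  - by exists (Some (chi_inv l)); apply: (sumU _ _ r) => j /eqP.
  move=> N [Nl Ng] N1 N2; have := comp l; rewrite eqxx ifN; last exact/eqP/chi_inv_neq.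
  rewrite addr0 => ->; apply: (lsubD Nl) => //.
  rewrite -wV_sum (eq_bigl (fun j => lam j == chi_inv l)); last first.
    by move=> j; rewrite -(inj_eq (inv_inj (@chi_invK F k))) chi_invK.
  by do 2!apply: (Ng).
have inv1 : chi_inv chi_one = chi_one :> torus_char F k.
  by apply: torus_char_eq => d _; rewrite chi_invE invr1.
have Up1 : Upart u = \sum_(j | lam j == chi_one) p j.
  rewrite pE (bigID (fun j => lam j == chi_one)) /= [X in _ + X = _](_ : _ = 0) ?addr0 //.
  rewrite -big_filter; apply: (sum_fibers0 (wt := lam)) => l'; rewrite big_filter_cond.
  have [->|/eqP l'1] := eqVneq l' chi_one.
    by rewrite big_pred0 // => j; rewrite andNb.
  rewrite (eq_bigl (fun j => lam j == l')); last first.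
    by move=> j; rewrite andb_idl // => /eqP->; apply/eqP.
  set P := LHS; have PU : Uweight l' P.
    have := sumU l' (fun j => lam j == l') (fun=> 1) (fun j h => eqP h).
    by under eq_bigr do rewrite scale1r.
  have l'F : (chi_one == l') = false by rewrite eq_sym; apply/eqP.
  have := comp l'; rewrite l1 inv1 l'F addr0.
  set Q := \sum_(j | _) wVact _; move=> /esym/eqP; rewrite -/P addr_eq0 => /eqP PQ.
  apply: contrapT => P0; apply: l'1.
  apply: (Gfixed_weight P0 _ PU.2); apply: Ufixed_Gfixed; first exact: PU.1.
  rewrite PQ gactN /Q -wV_sum wact_wV; apply: (lsubN (@lsub_Ufixed _ _ M)).
  apply: (lsub_sum (@lsub_Ufixed _ _ M)) => j _.
  exact: lsubZ (@lsub_Ufixed _ _ M) _ _ (pU j).1.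
set v := Upart u in refl Up1.
have vU : Uweight chi_one v.
  have := sumU chi_one (fun j => lam j == chi_one) (fun=> 1) (fun j h => eqP h).
  by under eq_bigr do rewrite scale1r; rewrite -Up1.
have T1 (d : F) (x : M) : weight_space chi_one x -> hact d x = x.
  by move=> /weightE->; rewrite chi_oneE scale1r.
have eT d : hact d (u - v) = u - v by rewrite gactB (T1 _ _ vU.2) T1 // -l1.
have wVe : wVact (u - v) = - (u - v).
  have := Upart_reflection c2 us lu; rewrite -/v (T1 _ _ vU.2) l1 chi_oneE scale1r => E.
  apply/eqP; rewrite -addr_eq0 wVB; apply/eqP.
  by rewrite addrC addrACA E -opprD subrr.
exists (u - v), v; split; [exists None | by exists (Some chi_one) |]; last first.
  by move=> N [Nl _] N1 N2; rewrite -[u](subrK v); apply: (lsubD Nl).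
apply: Upart0_steinberg wVe _ => [d|]; first exact: eT.
by rewrite UpartB -/v (Upart_id vU.1) subrr.
Qed.

Lemma CG_std_generated : std_generated M.
Proof.
have [g1 h1] := choice xi_std; have [g2 h2] := choice h1.
exists (codom g1 ++ codom g2); split=> [g|N Ns Ng m].
  by rewrite mem_cat => /orP[]/codomP[i ->]; have [] := h2 i.
have [w [wU ->]] := xis m; have [Nl Nx] := Ns.
apply: (lsub_sum Nl) => i _; have [s ->] := wU i.
apply: (lsub_sum Nl) => p _; apply: (lsubZ Nl); apply: Nx.
have [_ _] := h2 i; apply=> //; apply: Ng; rewrite mem_cat codom_f ?orbT //.
Qed.

End CGGenerated.

Lemma in_CG_std_generated (F : closedFieldType) (k : fieldType) (M : gmod k (SL2 F)) :
  [pchar k] =i pred0 -> locally_finite_field F -> in_CG M -> std_generated M.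
Proof.
move=> k_char0 F_fin /in_CG_split[n [xi [lam [xiw xid xis]]]].
exact: CG_std_generated xiw xid xis.
Qed.

(** * Cells *)

Section Cells.
Context (F : closedFieldType) (k : fieldType) (M : gmod k (SL2 F)).
Hypothesis k_char0 : [pchar k] =i pred0.
Hypothesis F_fin : locally_finite_field F.
Implicit Types (l : torus_char F k) (o : option (torus_char F k)) (u v e g z : M)
  (N C : set M) (a c : F).

Let N10 : -1 != 0 :> F. Proof. by rewrite oppr_eq0 oner_neq0. Qed.

(** The [B]-submodule spanned by a standard vector [g], together with [kU s g]
    when the weight is nontrivial; it is the whole submodule generated by [g]
    except when [g] is fixed by [B]. *)
Definition cell o g : set M := match o with
  | None => Uspan g
  | Some l => if l == chi_one then [set z | exists r : k, z = r *: g]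
      else [set z | exists r w, Uspan (wact g) w /\ z = r *: g + w]
  end.

Lemma steinberg_wact e a : steinberg_vector e -> a != 0 ->
  wact (xact a e) = xact (- a^-1) e - e.
Proof.
move=> [eh ew ex] a0; have [c c0 <-] := closed_field_sqrt_neq0 a0.
have cV0 : c^-1 != 0 by rewrite invr_eq0.
have -> : xact (c ^+ 2) e = hact c (xact 1 e) by rewrite hact_xact // mulr1 eh.
by rewrite wact_hact // ex gactB hact_xact // !eh // mulrN1 exprVn.
Qed.

Lemma Uweight_wact l v a : Uweight l v -> a != 0 ->
  wact (xact a (wact v)) = chi l (- a) *: xact (- a^-1) (wact v).
Proof.
move=> [fv lv] a0; rewrite wact_xact_wact // fv.
rewrite (weightE _ (weight_wact lv)) gactZ chi_invE; congr (_ *: _).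
by rewrite -invrN -chiV ?invr_eq0 ?oppr_eq0 // invrK.
Qed.

Lemma Uweight_wact_wact l v : Uweight l v -> wact (wact v) = chi l (-1) *: v.
Proof. by move=> [_ lv]; rewrite wact_wact (weightE _ lv). Qed.

(** The model is the indicator function [v] of the point fixed by [B] on the
    projective line: [s v - v] generates the functions with sum zero. *)
Lemma steinberg_aug v : Uweight chi_one v -> steinberg_vector (wact v - v).
Proof.
move=> vU; have [fv lv] := vU.
have hv c : hact c v = v by rewrite (weightE _ lv) chi_oneE scale1r.
split=> [c c0||].
- rewrite gactB hv; congr (_ - _).
  by rewrite -[in LHS](hv c) wact_hact // hactM ?invr_eq0 // mulfV // hact1.
- by rewrite gactB wact_wact hv opprB.
rewrite !gactB fv (Uweight_wact vU) ?oner_neq0 // chi_oneE scale1r invr1 fv.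
by rewrite opprB addrA subrK.
Qed.

Lemma lsub_cell o g : lsub (cell o g).
Proof.
case: o => [l|] /=; last exact: lsub_Uspan.
case: ifP => _; split.
- by exists 0; rewrite scale0r.
- by move=> r _ _ [x ->] [y ->]; exists (r * x + y); rewrite scalerDl scalerA.
- by exists 0, 0; split; [apply: lsub0 (lsub_Uspan _) | rewrite scale0r addr0].
move=> r _ _ [x [w [wU ->]]] [y [w' [w'U ->]]]; exists (r * x + y), (r *: w + w').
split; first exact: (lsub_Uspan _).2.
by rewrite scalerDl scalerDr scalerA addrACA.
Qed.

Lemma cell_id o g : cell o g g.
Proof.
case: o => [l|] /=; last exact: Uspan_id.
case: ifP => _; first by exists 1; rewrite scale1r.
by exists 1, 0; split; [apply: lsub0 (lsub_Uspan _) | rewrite scale1r addr0].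
Qed.

Lemma cell0 o z : cell o 0 z -> z = 0.
Proof.
case: o => [l|] /=; last exact: Uspan0.
by case: ifP => _ [r]; rewrite ?gact0 scaler0 // => -[w [/Uspan0-> ->]]; rewrite addr0.
Qed.

Lemma cell_sub o g N : submod N -> N g -> forall z, cell o g z -> N z.
Proof.
move=> [Nl Ng] Ngg z; have sub_U x w : N x -> Uspan x w -> N w.
  move=> Nx [s ->]; apply: (lsub_sum Nl) => p _; apply: (lsubZ Nl); exact: Ng.
case: o => [l|] /=; last exact: sub_U.
case: ifP => _; first by move=> [r ->]; apply: (lsubZ Nl).
move=> [r [w [wU ->]]]; apply: (lsubD Nl); first exact: (lsubZ Nl).
by apply: sub_U wU; apply: Ng.
Qed.

Lemma cell_xact o g a z : std o g -> cell o g z -> cell o g (xact a z).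
Proof.
case: o => [l|] /=; last by move=> _; apply: Uspan_xact.
move=> [fg _]; case: ifP => _; first by move=> [r ->]; exists r; rewrite gactZ fg.
move=> [r [w [wU ->]]]; exists r, (xact a w); split; first exact: Uspan_xact.
by rewrite gactD gactZ fg.
Qed.

Lemma cell_hact o g c z : std o g -> c != 0 -> cell o g z -> cell o g (hact c z).
Proof.
move=> og c0; have := std_weight og; case: o og => [l|] /= og lg; last first.
  exact: Uspan_hact lg c0.
case: ifP => _ => [[r ->]|]; first by exists (r * chi l c); rewrite gactZ (weightE _ lg) scalerA.
move=> [r [w [wU ->]]]; exists (r * chi l c), (hact c w); split.
  exact: Uspan_hact (weight_wact lg) c0 wU.
by rewrite gactD gactZ (weightE _ lg) scalerA.
Qed.

Lemma cell_wact o g z : std o g -> o <> Some chi_one -> cell o g z -> cell o g (wact z).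
Proof.
case: o => [l|] /= og; last first.
  move=> _ [s ->]; rewrite gact_sum; apply: (lsub_sum (lsub_Uspan _)) => p _.
  rewrite gactZ; apply: (lsubZ (lsub_Uspan _)); have [->|p0] := eqVneq p.2 0.
    rewrite xact0; have [_ -> _] := og; apply: (lsubN (lsub_Uspan _)); exact: Uspan_id.
  rewrite steinberg_wact //; apply: (lsubB (lsub_Uspan _)); last exact: Uspan_id.
  exact/Uspan_xact/Uspan_id.
move=> l1; rewrite ifN; last by apply/eqP => ll; apply: l1; rewrite ll.
have Cl : lsub [set z | exists r w, Uspan (wact g) w /\ z = r *: g + w].
  have := lsub_cell (Some l) g; rewrite /= ifN //.
  by apply/eqP => ll; apply: l1; rewrite ll.
have C1 : [set z | exists r w, Uspan (wact g) w /\ z = r *: g + w] g.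
  by exists 1, 0; split; [apply: lsub0 (lsub_Uspan _) | rewrite scale1r addr0].
have C2 w : Uspan (wact g) w ->
    [set z | exists r w, Uspan (wact g) w /\ z = r *: g + w] w.
  by move=> wU; exists 0, w; split => //; rewrite scale0r add0r.
move=> [r [w [[s ->] ->]]]; rewrite gactD gactZ; apply: (lsubD Cl).
  by apply: (lsubZ Cl); apply: C2; apply: Uspan_id.
rewrite gact_sum; apply: (lsub_sum Cl) => p _; rewrite gactZ; apply: (lsubZ Cl).
have [->|p0] := eqVneq p.2 0.
  by rewrite xact0 (Uweight_wact_wact og); apply: (lsubZ Cl).
by rewrite (Uweight_wact og) //; apply: (lsubZ Cl); apply: C2; apply/Uspan_xact/Uspan_id.
Qed.

(** A trivial weight is excluded because a [B]-fixed vector need not be fixed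
    by [s]. *)
Lemma cell_submod o g : std o g -> o <> Some chi_one -> submod (cell o g).
Proof.
move=> og o1; apply: submodP; first exact: lsub_cell.
- by move=> a v; apply: cell_xact.
- by move=> c v c0; apply: cell_hact.
- by move=> v; apply: cell_wact.
Qed.

(** ** Sums over the translates by a finite subfield *)

Definition Usum (K : seq F) v := \sum_(x <- K) xact x v.

Lemma Usum_xact K v a : fsubfield K -> a \in K -> Usum K (xact a v) = Usum K v.
Proof.
move=> Kf aK; rewrite /Usum -[RHS](sum_fsubfieldD Kf _ aK).
by apply: eq_bigr => x _; rewrite xactD addrC.
Qed.

Lemma UsumZ K (r : k) v : Usum K (r *: v) = r *: Usum K v.
Proof. by rewrite /Usum scaler_sumr; apply: eq_bigr => x _; rewrite gactZ. Qed.

Lemma UsumD K u v : Usum K (u + v) = Usum K u + Usum K v.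
Proof. by rewrite /Usum -big_split; apply: eq_bigr => x _; rewrite gactD. Qed.

Lemma Usum_sum K I (r : seq I) (P : pred I) (f : I -> M) :
  Usum K (\sum_(i <- r | P i) f i) = \sum_(i <- r | P i) Usum K (f i).
Proof.
rewrite /Usum exchange_big /=; under eq_bigr do rewrite gact_sum.
by [].
Qed.

Lemma submod_Usum N K v : submod N -> N v -> N (Usum K v).
Proof. by move=> [Nl Ng] Nv; apply: (lsub_sum Nl) => x _; apply: Ng. Qed.

Lemma Usum_hact K l v c : fsubfield K -> weight_space l v -> c \in K -> c != 0 ->
  hact c (Usum K v) = chi l c *: Usum K v.
Proof.
move=> Kf lv cK c0; rewrite /Usum gact_sum scaler_sumr.
have c20 : c ^+ 2 != 0 by rewrite expf_neq0.
have c2K : c ^+ 2 \in K by apply: fsubfieldM.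
rewrite !(sum_fsubfield0 Kf) hact_xact // mulr0 (weightE _ lv) gactZ; congr (_ + _).
rewrite -[RHS](sum_fsubfieldM Kf _ c2K c20); apply: eq_bigr => x _.
by rewrite hact_xact // (weightE _ lv) gactZ.
Qed.

(** The coefficients serve for every large enough subfield [K], so that [K] may be
    chosen after the translation. *)
Lemma Uspan_translate x z : Uspan x z -> z <> 0 -> exists a (m : F -> k) (Y : seq F),
  m 0 != 0 /\ forall K, fsubfield K -> {subset Y <= K} ->
    xact a z = \sum_(y <- K) m y *: xact y x.
Proof.
move=> [s ->] z0; have [y0 sy0] : exists y, ucoef s y != 0.
  apply: contrapT => no; apply: z0; apply: usum_eq0 => y.
  by apply: contrapT => /eqP ny; apply: no; exists y.
exists (- y0), (ucoef (ushift (- y0) s)), (map snd (ushift (- y0) s)); split.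
  by rewrite ucoef_shift opprK add0r.
by move=> K Kf sK; rewrite -usum_shift (usumE _ (fsubfield_uniq Kf) sK).
Qed.

(** Summing the translates of [s z] over a large finite subfield produces the
    sum of the translates of [e] alone, from which [e] is recovered by [s]. *)
Lemma steinberg_simple N e z : submod N -> steinberg_vector e ->
  Uspan e z -> z <> 0 -> N z -> N e.
Proof.
move=> Ns est ez z0 Nz; have [Nl Ng] := Ns; have [_ ew _] := est.
have [a [m [Y [m0 mE]]]] := Uspan_translate ez z0.
have [K [Kf YK _]] := F_fin Y 0; have {}mE := mE K Kf YK.
have NK : N (Usum K e).
  suff : N (m 0 *: Usum K e) by apply: lsubZ_inv.
  have := submod_Usum K Ns (Ng (wx _) _ (Ng (ux a) _ Nz)).
  rewrite mE gact_sum (sum_fsubfield0 Kf) UsumD Usum_sum big1_seq ?addr0.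
    rewrite gactZ xact0 ew scalerN -scaleNr UsumZ scaleNr.
    by move/(lsubN Nl); rewrite opprK.
  move=> y /andP[y0 yK]; rewrite gactZ (steinberg_wact est y0).
  rewrite UsumZ -[- e]scaleN1r UsumD UsumZ scaleN1r Usum_xact ?subrr ?scaler0 //.
  by apply/(fsubfieldN Kf)/(fsubfieldV Kf).
suff : N ((size K).+1%:R *: e) by apply: (lsubZ_inv Nl); rewrite natr_eq0.
have -> : (size K).+1%:R *: e = Usum K e - wact (Usum K e).
  rewrite {2}/Usum gact_sum (sum_fsubfield0 Kf) xact0 ew.
  rewrite (eq_bigr (fun y => xact (- y^-1) e - e)) => [|y]; last exact: steinberg_wact.
  rewrite sumrB (sum_fsubfieldNV Kf (fun y => xact y e)) (sum_fsubfield_const Kf).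
  rewrite /Usum (sum_fsubfield0 Kf) xact0.
  have K0 : (0 < size K)%N by case: (K) (fsubfield0 Kf).
  rewrite -[in LHS](prednK K0) scaler_nat !mulrS opprD opprK opprB.
  by rewrite [e + (_ - _)]addrA addrACA subrr addr0.
by apply: (lsubB Nl) => //; apply: Ng.
Qed.

(** Here the two summands produced by the same device have different weights. *)
Lemma Uweight_simple N l g z : submod N -> Uweight l g -> l <> chi_one ->
  cell (Some l) g z -> z <> 0 -> N z -> N g.
Proof.
move=> Ns gU l1; rewrite /= ifN; last exact/eqP.
move=> [r [w [wU ->]]] z0 Nz; have [Nl Ng] := Ns.
have [w0|w0] := pselect (w = 0).
  move: z0 Nz; rewrite w0 addr0 => rg0; apply: lsubZ_inv => //.
  by apply/eqP => r0; apply: rg0; rewrite r0 scale0r.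
have [a [m [Y [m0 mE]]]] := Uspan_translate wU w0.
have [c c0 lc] := chi_sq_neq1 l1.
have [K [Kf YK _]] := F_fin (c :: Y) 0.
have {}mE := mE K Kf (fun y yY => YK y (mem_behead (s := c :: Y) yY)).
have cK : c \in K by apply: YK; rewrite mem_head.
have fUK : Usum K g = (size K)%:R *: g.
  rewrite /Usum (eq_bigr (fun=> g)) => [|x _]; last by rewrite gU.1.
  by rewrite big_const_seq count_predT iter_addr_0 scaler_nat.
pose mu := (size K)%:R * (m 0 * chi l (-1)).
have [kap NA] : exists kap : k, N (kap *: Usum K (wact g) + mu *: g).
  exists (r + \sum_(y <- K | y != 0) m y * chi l (- y)).
  have SE : Usum K (\sum_(y <- K | y != 0) wact (m y *: xact y (wact g))) =
      (\sum_(y <- K | y != 0) m y * chi l (- y)) *: Usum K (wact g).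
    rewrite Usum_sum scaler_suml big_seq_cond [RHS]big_seq_cond.
    apply: eq_bigr => y /andP[yK y0]; rewrite gactZ (Uweight_wact gU) //.
    by rewrite !UsumZ Usum_xact ?scalerA //; apply/(fsubfieldN Kf)/(fsubfieldV Kf).
  have := submod_Usum K Ns (Ng (wx _) _ (Ng (ux a) _ Nz)).
  rewrite gactD gactZ gU.1 mE gactD gactZ gact_sum (sum_fsubfield0 Kf) !UsumD SE.
  rewrite !(gactZ, UsumZ) xact0 (Uweight_wact_wact gU) !UsumZ fUK !scalerA.
  by rewrite addrCA scalerDl addrC /mu mulrC.
have K0 : (size K)%:R != 0 :> k.
  by rewrite natr_eq0 //; case: (K) (fsubfield0 Kf).
have mu0 : mu != 0 by rewrite !mulf_neq0 // chi_neq0.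
suff : N (((chi l c - (chi l c)^-1) * mu) *: g).
  apply: (lsubZ_inv Nl); rewrite mulf_neq0 // subr_eq0.
  by apply: contra lc => /eqP lV; rewrite expr2 {1}lV mulVf // chi_neq0.
have -> : ((chi l c - (chi l c)^-1) * mu) *: g =
    hact c (kap *: Usum K (wact g) + mu *: g)
    - (chi l c)^-1 *: (kap *: Usum K (wact g) + mu *: g).
  rewrite gactD !gactZ (Usum_hact Kf (weight_wact gU.2) cK c0) (weightE _ gU.2).
  rewrite scalerDr chi_invE !scalerA opprD addrACA [_ / _]mulrC subrr add0r.
  by rewrite -scalerBl [mu * _]mulrC -mulrBl.
by apply: (lsubB Nl); [apply: Ng | apply: (lsubZ Nl)].
Qed.

Lemma cell_simple N o g z : submod N -> std o g ->
  cell o g z -> z <> 0 -> N z -> N g.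
Proof.
move=> Ns; case: o => [l|] og; last exact: steinberg_simple.
have [l1|/eqP l1] := eqVneq l chi_one; last exact: Uweight_simple.
rewrite /= l1 eqxx => -[r ->] rg0; apply: (lsubZ_inv Ns.1).
by apply/eqP => r0; apply: rg0; rewrite r0 scale0r.
Qed.

End Cells.

(** * Filtrations by cells *)

Lemma seq_choice (T : eqType) (U : Type) (u0 : U) (s : seq T) (P : T -> U -> Prop) :
  (forall x, x \in s -> exists y, P x y) -> exists f, forall x, x \in s -> P x (f x).
Proof.
move=> sP; have /choice[f fP] : forall x, exists y, x \in s -> P x y.
  by move=> x; have [/sP[y]|_] := boolP (x \in s); [exists y | exists u0].
by exists f.
Qed.

Section Filtrations.
Context (F : closedFieldType) (k : fieldType) (M : gmod k (SL2 F)).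
Hypothesis k_char0 : [pchar k] =i pred0.
Hypothesis F_fin : locally_finite_field F.
Implicit Types (l : torus_char F k) (o : option (torus_char F k)) (u v e g z m : M)
  (N C : set M) (p : option (torus_char F k) * M) (L : seq (option (torus_char F k) * M)).

Definition addset N C : set M := [set x | exists n c, [/\ N n, C c & x = n + c]].

Lemma addset_lsub N C : lsub N -> lsub C -> lsub (addset N C).
Proof.
move=> Nl Cl; split=> [|r _ _ [x [c [Nx Cc ->]]] [y [d [Ny Cd ->]]]].
  by exists 0, 0; split; [apply: lsub0 | apply: lsub0 | rewrite addr0].
exists (r *: x + y), (r *: c + d); split; [exact: Nl.2 | exact: Cl.2 |].
by rewrite scalerDr addrACA.
Qed.

Lemma addsetl N C x : lsub C -> N x -> addset N C x.
Proof. by move=> Cl Nx; exists x, 0; split=> //; [apply: lsub0 | rewrite addr0]. Qed.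

Lemma addsetr N C x : lsub N -> C x -> addset N C x.
Proof. by move=> Nl Cx; exists 0, x; split=> //; [apply: lsub0 | rewrite add0r]. Qed.

Lemma addset_submod N C : submod N -> submod C -> submod (addset N C).
Proof.
move=> [Nl Ng] [Cl Cg]; split; first exact: addset_lsub.
move=> g _ [x [c [Nx Cc ->]]]; exists (gact g x), (gact g c).
by rewrite gactD; split; [apply: Ng | apply: Cg |].
Qed.

Lemma addset_cell_submod N o g : submod N -> std o g ->
  (o = Some chi_one -> N (wact g - g)) -> submod (addset N (cell o g)).
Proof.
move=> Ns og o1; have [o1'|no1] := pselect (o = Some chi_one); last first.
  exact: addset_submod (cell_submod og no1).
have [Nl Ng] := Ns; have Cl := lsub_cell o g.
apply: submodP; first exact: addset_lsub.
- move=> a _ [x [c [Nx Cc ->]]]; exists (xact a x), (xact a c).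
  by rewrite gactD; split; [apply: Ng | apply: cell_xact |].
- move=> b _ b0 [x [c [Nx Cc ->]]]; exists (hact b x), (hact b c).
  by rewrite gactD; split; [apply: Ng | apply: cell_hact |].
move=> _ [x [c [Nx Cc ->]]]; move: (Cc); rewrite {1}o1' /= eqxx => -[r cE].
exists (wact x + r *: (wact g - g)), c; split=> //; last first.
  by rewrite gactD -addrA scalerBr cE subrK gactZ.
by apply: (lsubD Nl); [apply: Ng | apply: (lsubZ Nl); apply: o1].
Qed.

(** Add the cells of the elements of [L] one after the other, skipping those
    whose generator has already been reached. *)
Lemma std_extend (P : set M -> Prop) L N :
  submod N -> P N ->
  (forall p, p \in L -> std p.1 p.2 /\ (p.1 = Some chi_one -> N (wact p.2 - p.2))) ->
  (forall N' p, submod N' -> P N' -> p \in L -> std p.1 p.2 -> ~ N' p.2 ->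
     (p.1 = Some chi_one -> N' (wact p.2 - p.2)) ->
     P (addset N' (cell p.1 p.2))) ->
  exists N', [/\ submod N', P N', N `<=` N', forall p, p \in L -> N' p.2
    & forall N'', submod N'' -> N `<=` N'' -> (forall p, p \in L -> N'' p.2) ->
        N' `<=` N''].
Proof.
elim: L N => [|p L IH] N Ns PN NL step.
  by exists N; split=> // N'' _ NN'' _.
have pL : p \in p :: L by rewrite mem_head.
have LL q : q \in L -> q \in p :: L by rewrite inE orbC => ->.
have [ps p1] := NL p pL.
have [Np|Np] := pselect (N p.2).
  have [||N' [N's PN' NN' N'L N'min]] := IH N Ns PN.
  - by move=> q /LL/NL.
  - by move=> N' q N's PN' /LL qL; apply: step.
  exists N'; split=> //; first by move=> q; rewrite inE => /predU1P[->|/N'L//]; apply: NN'.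
  by move=> N'' N''s NN'' N''L; apply: N'min => // q /LL/N''L.
have Cl := lsub_cell p.1 p.2.
have As := addset_cell_submod Ns ps p1.
have [||N' [N's PN' NN' N'L N'min]] := IH _ As (step N p Ns PN pL ps Np p1).
- by move=> q /LL/NL[qs q1]; split=> // /q1 ?; apply: addsetl.
- by move=> N' q N's PN' /LL qL; apply: step.
exists N'; split=> //; first by move=> x Nx; apply: NN'; apply: addsetl.
  move=> q; rewrite inE => /predU1P[->|/N'L//]; apply: NN'.
  by apply: addsetr Ns.1 _; apply: cell_id.
move=> N'' N''s NN'' N''L; apply: N'min => // [|q /LL/N''L//].
move=> _ [x [c [/NN'' N''x Cc ->]]]; apply: (lsubD N''s.1) => //.
by apply: cell_sub Cc => //; apply: N''L.
Qed.

(** The generators are listed so that [B]-fixed vectors come last, and so that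
    the difference [s v - v] is listed before the [B]-fixed vector [v]. *)
Lemma std_lists_in (A : option (torus_char F k) -> M -> Prop) (gs : seq M) :
  (forall v, A (Some chi_one) v -> A None (wact v - v)) ->
  (forall g, g \in gs -> exists o, std o g /\ A o g) ->
  (forall N, submod N -> (forall g, g \in gs -> N g) -> forall m, N m) ->
  exists L1 L2,
  [/\ forall p, p \in L1 -> [/\ std p.1 p.2, A p.1 p.2 & p.1 <> Some chi_one],
      forall p, p \in L2 -> [/\ std p.1 p.2, A p.1 p.2 & p.1 = Some chi_one],
      forall p, p \in L2 -> (None, wact p.2 - p.2) \in L1
    & forall N, submod N -> (forall p, p \in L1 ++ L2 -> N p.2) -> forall m, N m].
Proof.
move=> A1 gstd ggen.
have [o oP] := seq_choice None gstd.
pose L1 := [seq if o g == Some chi_one then (None, wact g - g) else (o g, g) | g <- gs].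
pose L2 := [seq (o g, g) | g <- gs & o g == Some chi_one].
exists L1, L2; split.
- move=> p /mapP[g gg ->]; have [] := oP g gg.
  case: eqP => [->|//] /= gU gA; split=> //; first exact: steinberg_aug.
  exact: A1.
- move=> p /mapP[g]; rewrite mem_filter => /andP[/eqP o1 gg] ->.
  by have [] := oP g gg.
- move=> p /mapP[g]; rewrite mem_filter => /andP[o1 gg] -> /=.
  by apply/mapP; exists g => //; rewrite o1.
move=> N Ns NL; apply: ggen => // g gg; have [o1|o1] := boolP (o g == Some chi_one).
  apply: (NL (o g, g)); rewrite mem_cat; apply/orP; right; apply/mapP; exists g => //.
  by rewrite mem_filter o1.
apply: (NL (o g, g)); rewrite mem_cat; apply/orP; left; apply/mapP; exists g => //.
by rewrite (negPf o1).
Qed.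

Lemma std_lists : std_generated M -> exists L1 L2,
  [/\ forall p, p \in L1 -> std p.1 p.2 /\ p.1 <> Some chi_one,
      forall p, p \in L2 -> std p.1 p.2 /\ p.1 = Some chi_one,
      forall p, p \in L2 -> (None, wact p.2 - p.2) \in L1
    & forall N, submod N -> (forall p, p \in L1 ++ L2 -> N p.2) -> forall m, N m].
Proof.
move=> [gs [gstd ggen]].
have [//||L1 [L2 [L1s L2s L12 gen]]] := @std_lists_in (fun _ _ => True) gs _ _ ggen.
  by move=> g /gstd[o og]; exists o.
by exists L1, L2; split=> // p; [move=> /L1s[] | move=> /L2s[]].
Qed.

Lemma std_ind_in (A : option (torus_char F k) -> M -> Prop) (gs : seq M)
    (P : set M -> Prop) N :
  (forall v, A (Some chi_one) v -> A None (wact v - v)) ->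
  (forall g, g \in gs -> exists o, std o g /\ A o g) ->
  (forall N, submod N -> (forall g, g \in gs -> N g) -> forall m, N m) ->
  submod N -> P N ->
  (forall N' o g, submod N' -> P N' -> std o g -> A o g -> ~ N' g ->
     (o = Some chi_one -> N' (wact g - g)) -> P (addset N' (cell o g))) ->
  P [set: M].
Proof.
move=> A1 gstd ggen Ns PN step.
have [L1 [L2 [L1s L2s L12 gen]]] := std_lists_in A1 gstd ggen.
have [||N1 [N1s PN1 NN1 N1L _]] := std_extend (L := L1) Ns PN.
- by move=> p /L1s[].
- by move=> N' [o g] N's PN' /L1s[_ gA _] og Ng o1; apply: step.
have [||N2 [N2s PN2 NN2 N2L _]] := std_extend (L := L2) N1s PN1.
- by move=> p pL; split=> [|_]; [have [] := L2s p pL | have := N1L _ (L12 p pL)].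
- by move=> N' [o g] N's PN' /L2s[_ gA _] og Ng o1; apply: step.
suff -> : [set: M] = N2 by [].
apply/seteqP; split=> // m _; apply: gen => // p; rewrite mem_cat => /orP[pL|/N2L//].
exact/NN2/N1L.
Qed.

(** Any module generated by standard vectors is reached from one of its submodules
    by adding cells, each of which is simple modulo what precedes it. *)
Lemma std_ind (P : set M -> Prop) N : std_generated M -> submod N -> P N ->
  (forall N' o g, submod N' -> P N' -> std o g -> ~ N' g ->
     (o = Some chi_one -> N' (wact g - g)) -> P (addset N' (cell o g))) ->
  P [set: M].
Proof.
move=> [gs [gstd ggen]] Ns PN step.
apply: (@std_ind_in (fun _ _ => True) gs P N _ _ ggen Ns PN) => // [g /gstd[o og]|].
  by exists o.
by move=> N' o g N's PN' og _; apply: step.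
Qed.

(** ** Splitting off cyclic [kU]-modules *)

(** The [xi_i] are required to be nonzero, so that their number is the dimension
    of the span of the weight vectors. *)
Definition Usplit N := exists n (xi : 'I_n -> M),
  [/\ forall i, xi i <> 0 /\ exists l, weight_space l (xi i), Udirect xi
    & forall m, N m <-> exists w, (forall i, Uspan (xi i) (w i)) /\ m = \sum_i w i].

Lemma Usplit_add N x l : Usplit N -> x <> 0 -> weight_space l x ->
  (forall z, Uspan x z -> N z -> z = 0) -> Usplit (addset N (Uspan x)).
Proof.
move=> [n [xi [xiw xid xiN]]] x0 lx xN.
pose ext T (t : T) (f : 'I_n -> T) (i : 'I_n.+1) := oapp f t (unlift ord0 i).
have ext0 T (t : T) f : ext T t f ord0 = t by rewrite /ext unlift_none.
have extS T (t : T) f i : ext T t f (lift ord0 i) = f i by rewrite /ext liftK.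
exists n.+1, (ext M x xi); split.
- move=> i; case: (unliftP ord0 i) => [j|] ->; first by rewrite extS.
  by rewrite ext0; split=> //; exists l.
- move=> w wU; rewrite big_ord_recl => w0.
  have Nw : N (\sum_(i < n) w (lift ord0 i)).
    apply/xiN; exists (fun i => w (lift ord0 i)); split=> // i.
    by have := wU (lift ord0 i); rewrite extS.
  have w0U : Uspan x (w ord0) by have := wU ord0; rewrite ext0.
  have w00 : w ord0 = 0.
    have w0E : w ord0 = - \sum_(i < n) w (lift ord0 i) by apply/eqP; rewrite -addr_eq0 w0.
    apply: xN => //; rewrite w0E; apply/xiN; exists (fun i => - w (lift ord0 i)).
    split; last by rewrite sumrN.
    move=> i; apply: (lsubN (lsub_Uspan _)).
    by have := wU (lift ord0 i); rewrite extS.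
  rewrite w00 add0r in w0.
  have w'0 := xid (fun i => w (lift ord0 i)) _ w0.
  move=> i; case: (unliftP ord0 i) => [j|] -> //; apply: w'0 => j'.
  by have := wU (lift ord0 j'); rewrite extS.
move=> m; split=> [[y [c [/xiN[w [wU ->]] xc ->]]]|[w [wU ->]]].
  exists (ext M c w); split; last first.
    by rewrite big_ord_recl ext0 addrC; congr (_ + _); apply: eq_bigr => i _; rewrite extS.
  by move=> i; case: (unliftP ord0 i) => [j|] ->; rewrite ?extS ?ext0.
exists (\sum_(i < n) w (lift ord0 i)), (w ord0); split; last by rewrite big_ord_recl addrC.
  apply/xiN; exists (fun i => w (lift ord0 i)); split=> // i.
  by have := wU (lift ord0 i); rewrite extS.
by have := wU ord0; rewrite ext0.
Qed.

(** The cell of [g] is [kU g], with a second summand [kU s g] if the weight is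
    nontrivial; these meet the preceding submodule trivially. *)
Lemma std_generated_Usplit : std_generated M -> Usplit [set: M].
Proof.
move=> /(@std_ind Usplit [set 0]); apply.
- exact: set0_submod.
- exists 0%N, (fun=> 0); split=> [[]//|w _ _ []//|m]; split=> [->|[w [_ ->]]].
    by exists (fun=> 0); rewrite big_ord0; split=> // -[].
  by rewrite big_ord0.
move=> N o g Ns Nsp og Ng o1; have [Nl _] := Ns.
have g0 : g <> 0 by move=> g0; apply: Ng; rewrite g0; apply: lsub0.
have gw := std_weight og.
have cN z : cell o g z -> N z -> z = 0.
  by move=> cz Nz; apply: contrapT => z0; apply: Ng; apply: cell_simple cz z0 Nz.
case: o og gw cN {o1} => [l|] og gw cN; last exact: Usplit_add gw cN.
have gspan z : Uspan g z <-> exists r : k, z = r *: g.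
  split=> [/(Uspan_fixed og.1)//|[r ->]].
  by apply: (lsubZ (lsub_Uspan _)); apply: Uspan_id.
have [l1|l1] := eqVneq l chi_one.
  have -> : cell (Some l) g = Uspan g.
    by apply/seteqP; split=> z; rewrite /= l1 eqxx => /gspan.
  apply: Usplit_add gw _ => // z /gspan gz; apply: cN.
  by rewrite /= l1 eqxx.
have -> : addset N (cell (Some l) g) = addset (addset N (Uspan g)) (Uspan (wact g)).
  apply/seteqP; split=> z; rewrite /= (negPf l1).
    move=> [x [_ [Nx [r [w [wU ->]]] ->]]]; exists (x + r *: g), w; rewrite addrA.
    by split=> //; exists x, (r *: g); split=> //; apply/gspan; exists r.
  move=> [_ [w [[x [_ [Nx /gspan[r ->] ->]]] wU ->]]]; exists x, (r *: g + w).
  by rewrite addrA; split=> //; exists r, w.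
apply: Usplit_add (weight_wact gw) _; first apply: Usplit_add gw _ => //.
- move=> z /gspan[r ->]; apply: cN; rewrite /= (negPf l1); exists r, 0.
  by split; [apply: lsub0 (lsub_Uspan _) | rewrite addr0].
- by move=> wg0; apply: g0; apply: (@gact_inj _ _ M (wx _)); rewrite wg0 gact0.
move=> z wz [x [_ [Nx /gspan[r ->] zE]]].
have x0 : x = 0.
  apply: cN => //; rewrite /= (negPf l1); exists (- r), z; split=> //.
  by rewrite zE scaleNr addrCA addNr addr0.
have fz : Ufixed z by rewrite zE x0 add0r; apply: (lsubZ (@lsub_Ufixed _ _ M)); apply: og.1.
have [fwg|frwg] := Ufixed_or_Ufree k_char0 F_fin (weight_wact gw); last first.
  exact: Uspan_free_Ufixed frwg wz fz.
case/eqP: l1; apply: Gfixed_weight g0 _ gw.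
exact: Ufixed_Gfixed og.1 fwg.
Qed.

Lemma Usplit_in_CG : Usplit [set: M] -> in_CG M.
Proof.
move=> [n [xi [xiw0 xid xis0]]].
have xis : Uspanning xi by move=> m; apply/xis0.
have [lam xiw] := choice (fun i => (xiw0 i).2).
exists n; split.
  exists xi; split.
    move=> c c0 i.
    have cU j : Uspan (xi j) (c j *: xi j).
      by apply: (lsubZ (lsub_Uspan _)); apply: Uspan_id.
    have /eqP := xid _ cU c0 i; rewrite scaler_eq0 => /orP[/eqP//|/eqP xi0].
    by case: (xiw0 i).1.
  apply/seteqP; split=> v.
    move=> [q [c [x [xr ->]]]]; exists q, c, x; split=> // i.
    by have [j _ <-] := xr i; exists (lam j).
  move=> [q [c [x [xT ->]]]].
  have xiT : xispan xi (\sum_(i < q) c i *: x i).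
    apply: (lsub_sum (lsub_xispan xi)) => i _; apply: (lsubZ (lsub_xispan xi)).
    have [l lx] := xT i; exact: weight_xispan xiw xid xis l _ lx.
  have [r ->] := xiT; exists n, r, xi; split=> // i; by exists i.
exists xi; split; first by move=> i; exists (lam i).
have [phi phiP] := choice xis.
have phiE m w : (forall i, Uspan (xi i) (w i)) -> m = \sum_i w i -> phi m = w.
  move=> wU mw; apply/funext => i; apply/eqP; rewrite -subr_eq0; apply/eqP.
  apply: (xid (fun i => phi m i - w i)) => [j|].
    by apply: (lsubB (lsub_Uspan _)) => //; apply: (phiP m).1.
  by rewrite sumrB -mw -(phiP m).2 subrr.
exists phi; split.
- move=> r u v; apply: phiE => [i|].
    by apply: (lsub_Uspan _).2; [apply: (phiP u).1 | apply: (phiP v).1].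
  by rewrite big_split /= -scaler_sumr -(phiP u).2 -(phiP v).2.
- move=> b /borelP[c [a [c0 ->]]] v i.
  rewrite (phiE _ (fun i => gact (ux a * hx c)%g (phi v i))) // => [j|].
    rewrite gactM; apply: Uspan_xact; apply: Uspan_hact (xiw j) c0 _.
    exact: (phiP v).1.
  by rewrite -gact_sum -(phiP v).2.
- by move=> u v uv; rewrite (phiP u).2 (phiP v).2 uv.
apply/seteqP; split=> w.
  by move=> [m _ <-] i; apply/kU_spanP; apply: (phiP m).1.
move=> wU; exists (\sum_i w i) => //; apply: phiE => // i.
exact/kU_spanP.
Qed.

Lemma std_generated_in_CG : std_generated M -> in_CG M.
Proof. by move=> /std_generated_Usplit/Usplit_in_CG. Qed.

End Filtrations.

(** * Submodules of modules generated by standard vectors *)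

Section SubClosure.
Context (F : closedFieldType) (k : fieldType) (M : gmod k (SL2 F)).
Hypothesis k_char0 : [pchar k] =i pred0.
Hypothesis F_fin : locally_finite_field F.
Implicit Types (l : torus_char F k) (o : option (torus_char F k)) (u v e g z m : M)
  (N C X W : set M).

Definition line v : set M := [set z | exists r : k, z = r *: v].

Fixpoint kspan (vs : seq M) : set M :=
  if vs is v :: vs' then addset (line v) (kspan vs') else [set 0].

Lemma lsub_line v : lsub (line v).
Proof.
split=> [|t _ _ [r ->] [q ->]]; first by exists 0; rewrite scale0r.
by exists (t * r + q); rewrite scalerDl scalerA.
Qed.

Lemma lsub_kspan vs : lsub (kspan vs).
Proof.
elim: vs => [|v vs IH] /=; first by have [] := set0_submod M.
exact: addset_lsub (lsub_line v) IH.
Qed.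

Lemma kspan_mem vs v : v \in vs -> kspan vs v.
Proof.
elim: vs => [//|w vs IH]; rewrite inE => /predU1P[->|/IH vvs] /=.
  by apply: addsetl; [apply: lsub_kspan | exists 1; rewrite scale1r].
by apply: addsetr => //; apply: lsub_line.
Qed.

Lemma kspan_sub vs N : lsub N -> (forall v, v \in vs -> N v) -> kspan vs `<=` N.
Proof.
move=> Nl; elim: vs => [|v vs IH] Nvs /=; first by move=> _ ->; apply: lsub0 Nl.
move=> _ [_ [m [[r ->] vsm ->]]]; apply: (lsubD Nl).
  by apply: (lsubZ Nl); apply: Nvs; rewrite mem_head.
by apply: IH vsm => w wvs; apply: Nvs; rewrite inE wvs orbT.
Qed.

(** If [W] meets [C] trivially then it embeds in the span of [vs]. *)
Lemma finite_span_mod W C (vs : seq M) : lsub W -> lsub C ->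
  (forall x, W x -> C x -> x = 0) -> W `<=` addset C (kspan vs) ->
  exists ws : seq M, (forall w, w \in ws -> W w) /\
    forall N, lsub N -> (forall w, w \in ws -> N w) -> W `<=` N.
Proof.
elim: vs W => [|v vs IH] W Wl Cl WC Wvs.
  exists [::]; split=> // N Nl _ w Ww; have [c [_ [Cc -> wc]]] := Wvs w Ww.
  by rewrite addr0 in wc; rewrite (WC w) ?wc //; [apply: lsub0 | rewrite -wc].
pose D := addset C (kspan vs); have Dl : lsub D by apply: addset_lsub (lsub_kspan vs).
have WD w : W w -> exists t : k, D (w - t *: v).
  move=> /Wvs[c [_ [Cc [_ [m [[t ->] vsm ->]]] ->]]]; exists t, c, m.
  by rewrite addrCA [t *: v + _]addrC addrK.
pose W' w := W w /\ D w.
have W'l : lsub W'.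
  split; first by split; apply: lsub0.
  by move=> t x y [Wx Dx] [Wy Dy]; split; [apply: Wl.2 | apply: Dl.2].
have [||ws [wsW wsN]] := IH W' W'l Cl.
- by move=> x [Wx _]; apply: WC.
- by move=> w [_ Dw].
have [[w0 [t [Ww0 t0 Dw0]]]|no] :=
    pselect (exists w0 t, [/\ W w0, t != 0 & D (w0 - t *: v)]); last first.
  exists ws; split=> [w /wsW[]//|N Nl Nws w Ww].
  apply: (wsN N Nl Nws); split=> //; have [t Dt] := WD w Ww.
  have [t0|t0] := eqVneq t 0; first by rewrite t0 scale0r subr0 in Dt.
  by case: no; exists w, t.
exists (w0 :: ws); split=> [w|N Nl Nws w Ww].
  by rewrite inE => /predU1P[->//|/wsW[]].
have [t' Dt'] := WD w Ww; rewrite -[w](subrK ((t' / t) *: w0)).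
apply: (lsubD Nl); last by apply: (lsubZ Nl); apply: Nws; rewrite mem_head.
apply: (wsN N Nl) => [x xws|]; first by apply: Nws; rewrite inE xws orbT.
split; first by apply: (lsubB Wl) => //; apply: (lsubZ Wl).
have -> : w - (t' / t) *: w0 = (w - t' *: v) - (t' / t) *: (w0 - t *: v).
  by rewrite [in RHS]scalerBr scalerA mulfVK // opprB addrA subrK.
by apply: (lsubB Dl) => //; apply: (lsubZ Dl).
Qed.

(** The projection along [C] is equivariant, so it preserves the relations that
    define standard vectors. *)
Lemma std_proj X C o x c : submod X -> submod C ->
  (forall y, X y -> C y -> y = 0) -> X x -> C c -> std o (x + c) -> std o x.
Proof.
move=> [Xl Xg] [Cl Cg] XC Xx Cc.
have eqX y d y' d' : X y -> C d -> X y' -> C d' -> y + d = y' + d' -> y = y'.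
  move=> Xy Cd Xy' Cd' e; apply/eqP; rewrite -subr_eq0; apply/eqP; apply: XC.
    exact: (lsubB Xl).
  have -> : y - y' = d' - d by apply/eqP; rewrite subr_eq addrAC [d' + y']addrC -e addrK.
  exact: (lsubB Cl).
case: o => [l|] /=.
  move=> [fg lg]; split=> [a|].
    by apply: (eqX _ (xact a c) _ c) => //; try exact: Xg; try exact: Cg; rewrite -gactD fg.
  apply/weight_spaceP => d d0.
  apply: (eqX _ (hact d c) _ (chi l d *: c)); [exact: Xg|exact: Cg|exact: lsubZ|exact: lsubZ|].
  by rewrite -gactD -scalerDr (weightE _ lg).
move=> [eh ew ex]; split=> [d d0||].
- by apply: (eqX _ (hact d c) _ c); [exact: Xg|exact: Cg| | |rewrite -gactD eh].
- apply: (eqX _ (wact c) _ (- c)); [exact: Xg|exact: Cg|exact: lsubN|exact: lsubN|].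
  by rewrite -gactD ew opprD.
apply: (eqX _ (wact (xact 1 c)) _ (xact (-1) c - c)).
- by do 2!apply: (Xg).
- by do 2!apply: (Cg).
- by apply: (lsubB Xl) => //; apply: Xg.
- by apply: (lsubB Cl) => //; apply: Cg.
by rewrite -!gactD ex gactD opprD addrACA.
Qed.

(** The generators that are not fixed by [B], together with the differences
    [s v - v], generate a submodule [S] that is a sum of simple cells, so it is
    contained in [X + C] for a submodule [C] of [S] that meets [X] trivially. The
    projections of these generators to [X] along [C] are standard vectors.
    Modulo [S], only finitely many [B]-fixed vectors are left, and the elements of
    [X] congruent to their span modulo [C] are again fixed by [B]. *)
Lemma submod_std_generated X : std_generated M -> submod X ->
  exists gs : seq M, (forall g, g \in gs -> X g /\ exists o, std o g) /\
    forall N, submod N -> (forall g, g \in gs -> N g) -> X `<=` N.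
Proof.
move=> /std_lists[L1 [L2 [L1s L2s L12 gen]]] Xs; have [Xl Xg] := Xs.
pose P N := exists C, [/\ submod C, C `<=` N, forall x, X x -> C x -> x = 0
  & N `<=` addset X C].
have [||||S [Ss [C [Cs CS XC SXC]] _ SL1 Smin]] := @std_extend _ _ M P L1 [set 0].
- exact: set0_submod.
- exists [set 0]; split=> // [|x ->]; first exact: set0_submod.
  by exists 0, 0; split=> //; [apply: lsub0 | rewrite addr0].
- by move=> p /L1s[ps p1].
- move=> N [o g] Ns [C [Cs CN XC NXC]] /L1s/=[_ o1] og Ng _.
  have XCs := addset_submod Xs Cs.
  have cs := cell_submod og o1.
  have [XCg|XCg] := pselect (addset X C g).
    exists C; split=> //; first by move=> x /CN Nx; apply: addsetl (lsub_cell _ _) Nx.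
    move=> _ [x [c [/NXC XCx cc ->]]]; apply: (lsubD XCs.1) => //.
    exact: cell_sub cc.
  exists (addset C (cell o g)); split; first exact: addset_submod.
  - by move=> _ [x [c [Cx cc ->]]]; exists x, c; split=> //; apply: CN.
  - move=> y Xy [x [c [Cx cc yE]]].
    have c0 : c = 0.
      apply: contrapT => c0; apply: XCg; apply: (cell_simple k_char0 F_fin XCs og cc c0).
      exists y, (- x); split=> //; first exact: (lsubN Cs.1).
      by rewrite yE addrAC subrr add0r.
    by apply: XC => //; rewrite yE c0 addr0.
  move=> _ [x [c [/NXC[y [d [Xy Cd ->]]] cc ->]]]; exists y, (d + c).
  by rewrite addrA; split=> //; exists d, c.
have Cl := Cs.1.
have L1X p : p \in L1 -> exists x, X x /\ C (p.2 - x).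
  by move=> /SL1/SXC[x [c [Xx Cc ->]]]; exists x; rewrite addrAC subrr add0r.
have [pr prP] := seq_choice 0 L1X.
pose vs := map snd L2.
have vsU v : v \in vs -> Uweight chi_one v.
  by move=> /mapP[p pL ->]; have [+ p1] := L2s p pL; rewrite p1.
pose D := addset C (kspan vs).
have Dl : lsub D by apply: addset_lsub (lsub_kspan vs).
pose W m := X m /\ D m.
have Wl : lsub W.
  split; first by split; apply: lsub0.
  by move=> t x y [Xx Dx] [Xy Dy]; split; [apply: Xl.2 | apply: Dl.2].
have WU w : W w -> Uweight chi_one w.
  move=> [Xw [c [m [Cc vsm wE]]]].
  have mU : Uweight chi_one m by apply: (kspan_sub (lsub_Uweight M _) vsU vsm).
  have inv (g : SL2 F) : gact g m = m -> gact g w = w.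
    move=> gm; apply/eqP; rewrite -subr_eq0; apply/eqP; apply: XC.
      by apply: (lsubB Xl) => //; apply: Xg.
    rewrite wE gactD gm opprD addrACA subrr addr0.
    by apply: (lsubB Cl) => //; apply: Cs.2.
  split=> [a|]; first by apply: inv; apply: mU.1.
  apply/weight_spaceP => d d0; rewrite chi_oneE scale1r; apply: inv.
  by rewrite (weightE _ mU.2) chi_oneE scale1r.
have [||ws [wsW wsN]] := @finite_span_mod W C vs Wl Cl.
- by move=> x [Xx _]; apply: XC.
- by move=> w [].
exists (map pr L1 ++ ws); split.
  move=> g; rewrite mem_cat => /orP[/mapP[p pL ->]|/wsW Ww].
    have [Xp Cp] := prP p pL; split=> //; exists p.1.
    by apply: (std_proj Xs Cs XC Xp Cp); rewrite addrC subrK; have [] := L1s p pL.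
  by split; [case: Ww | exists (Some chi_one); apply: WU].
move=> N Ns Ngs x Xx.
pose N' y := N y /\ X y.
have N's : submod N'.
  split; first split; first by split; [apply: lsub0 Ns.1 | apply: lsub0].
    by move=> t u v [Nu Xu] [Nv Xv]; split; [apply: Ns.1.2 | apply: Xl.2].
  by move=> g v [Nv Xv]; split; [apply: Ns.2 | apply: Xg].
have N'C := addset_submod N's Cs.
have SN' : S `<=` addset N' C.
  apply: Smin => // [_ ->|p pL]; first exact: lsub0 N'C.1.
  have [Xp Cp] := prP p pL; exists (pr p), (p.2 - pr p).
  split=> //; last by rewrite addrC subrK.
  by split=> //; apply: Ngs; rewrite mem_cat map_f.
have [//|||S2 [S2s S2P S2S S2L _]] := @std_extend _ _ M
    (fun N0 => N0 `<=` addset S (kspan vs)) L2 S Ss.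
- by move=> y Sy; apply: addsetl => //; apply: lsub_kspan.
- by move=> p pL; split=> [|_]; [have [] := L2s p pL | apply: (SL1 _ (L12 p pL))].
- move=> N0 p _ N0P pL _ _ _ _ [y [c [/N0P SKy cc ->]]].
  apply: (lsubD (addset_lsub Ss.1 (lsub_kspan vs))) => //; apply: addsetr Ss.1 _.
  have [_ p1] := L2s p pL; move: cc; rewrite p1 /= eqxx => -[r ->].
  by apply: (lsubZ (lsub_kspan vs)); apply/kspan_mem/map_f.
have : S2 x.
  apply: (gen _ S2s) => p; rewrite mem_cat => /orP[pL|]; last exact: S2L.
  exact/S2S/SL1.
move=> /S2P[y [m [/SN'[n [c [[Nn Xn] Cc ->]]] vsm xE]]].
have Wxn : W (x - n).
  split; first exact: (lsubB Xl).
  by exists c, m; split=> //; apply/eqP; rewrite subr_eq xE -addrA addrC.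
rewrite -[x](subrK n); apply: (lsubD Ns.1) => //.
apply: (wsN N Ns.1) => // w ww; apply: Ngs; by rewrite mem_cat ww orbT.
Qed.

End SubClosure.

(** * Submodules, quotients and products *)

Section SubModule.
Context (F k : fieldType) (M : gmod k (SL2 F)) (X : set M) (Xs : submod X).

Definition sub_pred of submod X : {pred M} := fun x => `[< X x >].

Record submodule := Submodule { sub_val :> M; sub_valP : sub_val \in sub_pred Xs }.

HB.instance Definition _ := [isSub for sub_val].
HB.instance Definition _ := [Choice of submodule by <:].

Fact sub_pred_closed : submod_closed (sub_pred Xs).
Proof.
split; first by apply/asboolP/(lsub0 Xs.1).
by move=> a u v /asboolP Xu /asboolP Xv; apply/asboolP/Xs.1.2.
Qed.

HB.instance Definition _ := GRing.isSubmodClosed.Build k M (sub_pred Xs) sub_pred_closed.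
HB.instance Definition _ := [SubChoice_isSubLmodule of submodule by <:].

Lemma sub_valX (x : submodule) : X (sub_val x).
Proof. exact/asboolP/(sub_valP x). Qed.

Fact sub_act_subproof g (x : submodule) : gact g (sub_val x) \in sub_pred Xs.
Proof. by apply/asboolP/Xs.2/sub_valX. Qed.

Definition sub_act g (x : submodule) : submodule := Submodule (sub_act_subproof g x).

Definition submodule_gmod : gmod k (SL2 F).
Proof.
refine (@GMod k (SL2 F) submodule sub_act _ _ _).
- by move=> g a u v; apply/val_inj; rewrite /= gactD gactZ.
- by move=> v; apply/val_inj; rewrite /= gact1.
- by move=> g h v; apply/val_inj; rewrite /= gactM.
Defined.

Definition sub_elt (x : M) (Xx : X x) : submodule_gmod :=
  @Submodule x (asboolT Xx).

End SubModule.

Section Quotient.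
Context (F k : fieldType) (M : gmod k (SL2 F)) (X : set M) (Xs : submod X).

Local Open Scope quotient_scope.

Definition quo_rel of submod X : rel M := fun x y => `[< X (x - y) >].

Fact quo_rel_equiv : equiv_class_of (quo_rel Xs).
Proof.
have Xl := Xs.1; split.
- by move=> x; apply/asboolP; rewrite subrr; apply: lsub0.
- by move=> x y; apply/asboolP/asboolP => /(lsubN Xl); rewrite opprB.
- move=> y x z /asboolP xy /asboolP yz; apply/asboolP.
  by have := lsubD Xl xy yz; rewrite addrA subrK.
Qed.

Canonical quo_equiv := EquivRelPack quo_rel_equiv.

Definition quotient := {eq_quot quo_equiv}.
HB.instance Definition _ := EqQuotient.on quotient.
HB.instance Definition _ := Choice.on quotient.

Definition qpi (x : M) : quotient := \pi_quotient x.

Lemma qpi_eq x y : qpi x = qpi y <-> X (x - y).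
Proof.
split=> [/eqP|xy]; last by apply/eqP; rewrite piE; apply/asboolP.
by rewrite piE => /asboolP.
Qed.

Lemma qpi_surj (q : quotient) : exists x, q = qpi x.
Proof. by exists (repr q); rewrite /qpi reprK. Qed.

Lemma qpi_repr x : X (repr (qpi x) - x).
Proof. by apply/qpi_eq; rewrite /qpi reprK. Qed.

Definition q_add (p q : quotient) := qpi (repr p + repr q).
Definition q_opp (p : quotient) := qpi (- repr p).
Definition q_scale (a : k) (p : quotient) := qpi (a *: repr p).
Definition q_act g (p : quotient) := qpi (gact g (repr p)).

Lemma q_addE x y : q_add (qpi x) (qpi y) = qpi (x + y).
Proof.
by apply/qpi_eq; rewrite opprD addrACA; apply: (lsubD Xs.1); apply: qpi_repr.
Qed.
Lemma q_oppE x : q_opp (qpi x) = qpi (- x).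
Proof. by apply/qpi_eq; rewrite -opprD; apply: (lsubN Xs.1); apply: qpi_repr. Qed.
Lemma q_scaleE a x : q_scale a (qpi x) = qpi (a *: x).
Proof. by apply/qpi_eq; rewrite -scalerBr; apply: (lsubZ Xs.1); apply: qpi_repr. Qed.
Lemma q_actE g x : q_act g (qpi x) = qpi (gact g x).
Proof. by apply/qpi_eq; rewrite -gactB; apply: Xs.2; apply: qpi_repr. Qed.

Fact q_addA : associative q_add.
Proof.
move=> p q r; have [x ->] := qpi_surj p; have [y ->] := qpi_surj q.
by have [z ->] := qpi_surj r; rewrite !q_addE addrA.
Qed.
Fact q_addC : commutative q_add.
Proof.
move=> p q; have [x ->] := qpi_surj p; have [y ->] := qpi_surj q.
by rewrite !q_addE addrC.
Qed.
Fact q_add0 : left_id (qpi 0) q_add.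
Proof. by move=> p; have [x ->] := qpi_surj p; rewrite q_addE add0r. Qed.
Fact q_addN : left_inverse (qpi 0) q_opp q_add.
Proof. by move=> p; have [x ->] := qpi_surj p; rewrite q_oppE q_addE addNr. Qed.

HB.instance Definition _ :=
  GRing.isZmodule.Build quotient q_addA q_addC q_add0 q_addN.

Fact q_scaleA a b p : q_scale a (q_scale b p) = q_scale (a * b) p.
Proof. by have [x ->] := qpi_surj p; rewrite !q_scaleE scalerA. Qed.
Fact q_scale1 : left_id 1 q_scale.
Proof. by move=> p; have [x ->] := qpi_surj p; rewrite !q_scaleE scale1r. Qed.
Fact q_scaleDr : right_distributive q_scale +%R.
Proof.
move=> a p q; have [x ->] := qpi_surj p; have [y ->] := qpi_surj q.
by rewrite [_ + _]q_addE !q_scaleE scalerDr -q_addE.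
Qed.
Fact q_scaleDl p : {morph q_scale^~ p : a b / a + b}.
Proof.
by move=> a b; have [x ->] := qpi_surj p; rewrite !q_scaleE scalerDl -q_addE.
Qed.

HB.instance Definition _ :=
  GRing.Zmodule_isLmodule.Build k quotient q_scaleA q_scale1 q_scaleDr q_scaleDl.

Lemma qpiD x y : qpi (x + y) = qpi x + qpi y.
Proof. by rewrite -q_addE. Qed.
Lemma qpiZ a x : qpi (a *: x) = a *: qpi x.
Proof. by rewrite -q_scaleE. Qed.

Definition quotient_gmod : gmod k (SL2 F).
Proof.
refine (@GMod k (SL2 F) quotient q_act _ _ _).
- move=> g a p q; have [x ->] := qpi_surj p; have [y ->] := qpi_surj q.
  by rewrite -qpiZ -qpiD !q_actE gactD gactZ qpiD qpiZ.
- by move=> p; have [x ->] := qpi_surj p; rewrite q_actE gact1.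
- by move=> g h p; have [x ->] := qpi_surj p; rewrite !q_actE gactM.
Defined.

End Quotient.

Section Product.
Context (F k : fieldType) (M N : gmod k (SL2 F)).

Definition prod_act g (x : (M * N)%type) : (M * N)%type := (gact g x.1, gact g x.2).

Definition product_gmod : gmod k (SL2 F).
Proof.
refine (@GMod k (SL2 F) (M * N)%type prod_act _ _ _).
- by move=> g a [u1 u2] [v1 v2]; rewrite /prod_act /= !gactD !gactZ.
- by move=> [v1 v2]; rewrite /prod_act /= !gact1.
- by move=> g h [v1 v2]; rewrite /prod_act /= !gactM.
Defined.

End Product.

(** All the simple objects will be found inside this module. *)
Section FunctionModule.
Context (F k : fieldType).

Definition fun_act (g : SL2 F) (f : SL2 F -> k^o) : SL2 F -> k^o :=
  fun x => f (g^-1 * x)%g.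

Definition function_gmod : gmod k (SL2 F).
Proof.
refine (@GMod k (SL2 F) (SL2 F -> k^o) fun_act _ _ _).
- by move=> g a u v.
- by move=> v; apply/funext => x; rewrite /fun_act invg1 mul1g.
- by move=> g h v; apply/funext => x; rewrite /fun_act invgM mulgA.
Defined.

End FunctionModule.

(** * Equivariant maps *)

Section Hom.
Context (F k : fieldType) (M N : gmod k (SL2 F)).

Lemma gmod_hom_eq (f g : gmod_hom M N) : (forall x, f x = g x) -> f = g.
Proof. by move=> fg; apply/val_inj/funext. Qed.

Lemma homD (f : gmod_hom M N) u v : f (u + v) = f u + f v.
Proof. by have := gmod_hom_linear f 1 u v; rewrite !scale1r. Qed.

Lemma hom0 (f : gmod_hom M N) : f 0 = 0.
Proof.
by have := gmod_hom_linear f (-1) 0 0; rewrite scaleN1r addNr scaleN1r addNr.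
Qed.

Lemma homZ (f : gmod_hom M N) a u : f (a *: u) = a *: f u.
Proof. by have := gmod_hom_linear f a u 0; rewrite hom0 !addr0. Qed.

Lemma homN (f : gmod_hom M N) u : f (- u) = - f u.
Proof. by rewrite -scaleN1r homZ scaleN1r. Qed.

Lemma homB (f : gmod_hom M N) u v : f (u - v) = f u - f v.
Proof. by rewrite homD homN. Qed.

Lemma hom_sum (f : gmod_hom M N) I (r : seq I) (P : pred I) (u : I -> M) :
  f (\sum_(i <- r | P i) u i) = \sum_(i <- r | P i) f (u i).
Proof. exact: (big_morph _ (homD f) (hom0 f)). Qed.

Definition mkhom (f : M -> N) (fl : linear f)
  (fg : forall g v, f (gact g v) = gact g (f v)) : gmod_hom M N :=
  GModHom (asboolT (conj fl fg)).

Lemma ker_submod (f : gmod_hom M N) : submod [set x | f x = 0].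
Proof.
split; first by split=> [|r u v]; rewrite /= ?hom0 // => fu fv; rewrite homD homZ fu fv scaler0 addr0.
by move=> g v /=; rewrite gmod_hom_act => ->; rewrite gact0.
Qed.

Lemma image_submod (f : gmod_hom M N) (X : set M) : submod X -> submod (f @` X).
Proof.
move=> [Xl Xg]; split; first split.
- by exists 0; [apply: lsub0 | rewrite hom0].
- move=> r _ _ [x Xx <-] [y Xy <-]; exists (r *: x + y); first exact: Xl.2.
  by rewrite homD homZ.
by move=> g _ [x Xx <-]; exists (gact g x); [apply: Xg | rewrite gmod_hom_act].
Qed.

Lemma preimage_submod (f : gmod_hom M N) (Y : set N) : submod Y -> submod (f @^-1` Y).
Proof.
move=> [Yl Yg]; split; first split.
- by rewrite /preimage /= hom0; apply: lsub0.
- by move=> r u v; rewrite /preimage /= homD homZ; apply: Yl.2.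
by move=> g v; rewrite /preimage /= gmod_hom_act; apply: Yg.
Qed.

Lemma hom_inj (f : gmod_hom M N) : (forall x, f x = 0 -> x = 0) -> injective f.
Proof.
move=> f0 x y fxy; apply/eqP; rewrite -subr_eq0; apply/eqP/f0.
by rewrite homB fxy subrr.
Qed.

Lemma std_hom (f : gmod_hom M N) o g : std o g -> std o (f g).
Proof.
case: o => [l|] /=.
  move=> [fg lg]; split=> [a|t]; first by rewrite -gmod_hom_act fg.
  by rewrite -gmod_hom_act lg homZ.
move=> [eh ew ex]; split=> [c c0||]; first by rewrite -gmod_hom_act eh.
  by rewrite -gmod_hom_act ew homN.
by rewrite -!gmod_hom_act ex homB.
Qed.

Lemma std_hom_inj (f : gmod_hom M N) o g : injective f -> std o (f g) -> std o g.
Proof.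
move=> fi; case: o => [l|] /=.
  move=> [fg lg]; split=> [a|t]; apply: fi; first by rewrite gmod_hom_act fg.
  by rewrite gmod_hom_act lg homZ.
move=> [eh ew ex]; split=> [c c0||]; apply: fi; first by rewrite gmod_hom_act eh.
  by rewrite gmod_hom_act ew homN.
by rewrite homB !gmod_hom_act ex.
Qed.

Lemma std_generated_surj (f : gmod_hom M N) : (forall y, exists x, f x = y) ->
  std_generated M -> std_generated N.
Proof.
move=> fs [gs [gstd ggen]]; exists (map f gs); split.
  by move=> _ /mapP[g /gstd[o og] ->]; exists o; apply: std_hom.
move=> Y Ys Yg y; have [x <-] := fs y.
by apply: (ggen (f @^-1` Y)) (preimage_submod f Ys) _ x => g gg; apply: Yg; apply: map_f.
Qed.

End Hom.

Section ProductMaps.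
Context (F k : fieldType) (M N : gmod k (SL2 F)).

Definition pr1 : gmod_hom (product_gmod M N) M :=
  @mkhom _ _ (product_gmod M N) M fst (fun _ _ _ => erefl) (fun _ _ => erefl).
Definition pr2 : gmod_hom (product_gmod M N) N :=
  @mkhom _ _ (product_gmod M N) N snd (fun _ _ _ => erefl) (fun _ _ => erefl).

Definition in1 : gmod_hom M (product_gmod M N) :=
  @mkhom _ _ M (product_gmod M N) (fun x => (x, 0))
  (fun a u v => congr1 (pair _) (esym (etrans (addr0 _) (scaler0 _ _))))
  (fun g v => congr1 (pair _) (esym (gact0 _ _))).
Definition in2 : gmod_hom N (product_gmod M N) :=
  @mkhom _ _ N (product_gmod M N) (fun y => (0, y))
  (fun a u v => congr1 (pair^~ _) (esym (etrans (addr0 _) (scaler0 _ _))))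
  (fun g v => congr1 (pair^~ _) (esym (gact0 _ _))).

Lemma pair_in12 (x : M) (y : N) : (x, y) = in1 x + in2 y :> product_gmod M N.
Proof. by transitivity ((x + 0, 0 + y) : product_gmod M N); first by rewrite addr0 add0r. Qed.

End ProductMaps.

Section Factorization.
Context (F k : fieldType) (M N : gmod k (SL2 F)).

Lemma hom_lift (L : gmod k (SL2 F)) (f : gmod_hom M N) (h : gmod_hom L N) :
  injective f -> (forall z, exists x, f x = h z) ->
  exists h' : gmod_hom L M, forall z, f (h' z) = h z.
Proof.
move=> fi hR; have [h' h'E] := choice hR.
have h'l : linear h'.
  by move=> a u v; apply: fi; rewrite homD homZ !h'E homD homZ.
have h'g g v : h' (gact g v) = gact g (h' v).
  by apply: fi; rewrite gmod_hom_act !h'E gmod_hom_act.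
by exists (mkhom h'l h'g).
Qed.

Lemma hom_descend (L : gmod k (SL2 F)) (f : gmod_hom M N) (h : gmod_hom M L) :
  (forall y, exists x, f x = y) -> (forall x, f x = 0 -> h x = 0) ->
  exists h' : gmod_hom N L, forall x, h' (f x) = h x.
Proof.
move=> fs fh; have [r rE] := choice fs.
have hr x : h (r (f x)) = h x.
  by apply/eqP; rewrite -subr_eq0 -homB; apply/eqP/fh; rewrite homB rE subrr.
pose h' y := h (r y).
have h'l : linear h'.
  move=> a u v; rewrite /h' -[in LHS](rE u) -[in LHS](rE v) -homZ -homD hr.
  by rewrite homD homZ.
have h'g g v : h' (gact g v) = gact g (h' v).
  by rewrite /h' -[in LHS](rE v) -gmod_hom_act hr gmod_hom_act.
by exists (mkhom h'l h'g) => x; apply: hr.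
Qed.

End Factorization.

Section StandardMaps.
Context (F k : fieldType) (M : gmod k (SL2 F)).

Definition sub_incl (X : set M) (Xs : submod X) : gmod_hom (submodule_gmod Xs) M :=
  @mkhom _ _ (submodule_gmod Xs) M (fun x => sub_val x) (fun _ _ _ => erefl)
    (fun _ _ => erefl).

Lemma sub_incl_inj (X : set M) (Xs : submod X) : injective (sub_incl Xs).
Proof. exact: val_inj. Qed.

Lemma sub_incl_range (X : set M) (Xs : submod X) x :
  X x <-> exists y, sub_incl Xs y = x.
Proof.
split=> [Xx|[y <-]]; last exact: sub_valX.
by exists (sub_elt Xs Xx).
Qed.

Definition quo_proj (X : set M) (Xs : submod X) : gmod_hom M (quotient_gmod Xs) :=
  @mkhom _ _ M (quotient_gmod Xs) (qpi Xs)
    (fun a u v => etrans (qpiD Xs _ _) (congr1 (+%R^~ _) (qpiZ Xs a u)))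
    (fun g v => esym (q_actE Xs g v)).

Lemma quo_proj_surj (X : set M) (Xs : submod X) y : exists x, quo_proj Xs x = y.
Proof. by have [x ->] := qpi_surj y; exists x. Qed.

Lemma quo_proj_ker (X : set M) (Xs : submod X) x : quo_proj Xs x = 0 <-> X x.
Proof.
have q0 : quo_proj Xs 0 = 0 by apply: hom0.
by rewrite -q0; split=> [/qpi_eq|Xx]; [|apply/qpi_eq]; rewrite subr0.
Qed.

End StandardMaps.

(** * The category of modules generated by standard vectors *)

Section Category.
Context (F : closedFieldType) (k : fieldType).
Hypothesis k_char0 : [pchar k] =i pred0.
Hypothesis F_fin : locally_finite_field F.
Local Notation C := (CG F k).
Implicit Types (X Y Z W : C).

(** Objects and morphisms of the full subcategory are convertible to modules and
    to equivariant maps; these functions make the conversions explicit. *)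
Definition md X : gmod k (SL2 F) := sval X.
Definition hm X Y (f : mor X Y) : gmod_hom (md X) (md Y) := f.
Definition mo X Y (f : gmod_hom (md X) (md Y)) : mor X Y := f.

Lemma compcE X Y Z (g : mor Y Z) (f : mor X Y) x : hm (g \c f) x = hm g (hm f x).
Proof. by []. Qed.

Lemma idcE X x : hm (idc X) x = x. Proof. by []. Qed.

Lemma hm0 X Y x : hm (0 : mor X Y) x = 0. Proof. by []. Qed.

Lemma mor_eq X Y (f g : mor X Y) : (forall x, hm f x = hm g x) -> f = g.
Proof. exact: gmod_hom_eq. Qed.

Lemma CG_std X : std_generated (md X).
Proof. exact: in_CG_std_generated (svalP X). Qed.

Definition mkCG (M : gmod k (SL2 F)) (Ms : std_generated M) : C :=
  exist _ M (std_generated_in_CG k_char0 F_fin Ms).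

Lemma sub_std_generated (M : gmod k (SL2 F)) (N : set M) (Ns : submod N) :
  std_generated M -> std_generated (submodule_gmod Ns).
Proof.
move=> /submod_std_generated-/(_ k_char0 F_fin N Ns)[gs [gsN gen]].
have incl := sub_incl_range Ns.
have [|r rE] := seq_choice (0 : submodule_gmod Ns)
  (s := gs) (P := fun g y => sub_incl Ns y = g); first by move=> g /gsN[/incl].
exists (map r gs); split.
  move=> _ /mapP[g gg ->]; have [_ [o og]] := gsN g gg; exists o.
  by apply: (std_hom_inj (@sub_incl_inj _ _ _ _ Ns)); rewrite rE.
move=> Y Ys Yg y; have : (sub_incl Ns @` Y) (sub_incl Ns y).
  apply: (gen _ (image_submod (sub_incl Ns) Ys)) => [g gg|].
    by exists (r g); [apply: Yg; apply: map_f | apply: rE].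
  by apply/incl; exists y.
by case=> y' Yy' /sub_incl_inj<-.
Qed.

Lemma quo_std_generated (M : gmod k (SL2 F)) (N : set M) (Ns : submod N) :
  std_generated M -> std_generated (quotient_gmod Ns).
Proof. exact: std_generated_surj (@quo_proj_surj _ _ _ _ Ns). Qed.

Lemma prod_std_generated (M N : gmod k (SL2 F)) :
  std_generated M -> std_generated N -> std_generated (product_gmod M N).
Proof.
move=> [gs [gstd ggen]] [hs [hstd hgen]].
exists (map (in1 M N) gs ++ map (in2 M N) hs); split.
  move=> g; rewrite mem_cat => /orP[]/mapP[x].
    by move=> /gstd[o ox] ->; exists o; apply: std_hom.
  by move=> /hstd[o ox] ->; exists o; apply: std_hom.
move=> Y Ys Yg [x y]; rewrite pair_in12.
apply: (lsubD Ys.1).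
  apply: (ggen _ (preimage_submod (in1 M N) Ys)) => g gg; apply: Yg.
  by rewrite mem_cat map_f.
apply: (hgen _ (preimage_submod (in2 M N) Ys)) => g gg; apply: Yg.
by rewrite mem_cat map_f ?orbT.
Qed.

Definition subCG X (N : set (md X)) (Ns : submod N) : C :=
  mkCG (sub_std_generated Ns (CG_std X)).
Definition inclCG X (N : set (md X)) (Ns : submod N) : mor (subCG Ns) X :=
  mo (X := subCG Ns) (sub_incl Ns).
Definition quoCG X (N : set (md X)) (Ns : submod N) : C :=
  mkCG (quo_std_generated Ns (CG_std X)).
Definition projCG X (N : set (md X)) (Ns : submod N) : mor X (quoCG Ns) :=
  mo (Y := quoCG Ns) (quo_proj Ns).

Lemma inclCG_inj X (N : set (md X)) (Ns : submod N) : injective (hm (inclCG Ns)).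
Proof. exact: sub_incl_inj. Qed.

Lemma inclCG_range X (N : set (md X)) (Ns : submod N) x :
  N x <-> exists y, hm (inclCG Ns) y = x.
Proof. exact: sub_incl_range. Qed.

Lemma projCG_surj X (N : set (md X)) (Ns : submod N) y : exists x, hm (projCG Ns) x = y.
Proof. exact: quo_proj_surj. Qed.

Lemma projCG_ker X (N : set (md X)) (Ns : submod N) x : hm (projCG Ns) x = 0 <-> N x.
Proof. exact: quo_proj_ker. Qed.

Lemma is_zeroP X : is_zero X <-> forall x : md X, x = 0.
Proof.
split=> [X0 x|X0 Y]; first by rewrite -(idcE x) ((X0 X).1 (idc X)).
split=> f; apply: mor_eq => x; last exact: X0.
by rewrite (X0 x) hom0.
Qed.

Lemma monoP X Y (f : mor X Y) : mono f <-> injective (hm f).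
Proof.
split=> [fm|fi W g h gh]; last first.
  apply: mor_eq => x; apply: fi; rewrite -!compcE.
  by rewrite gh.
apply: hom_inj => x fx; have Ks := ker_submod (hm f).
have /fm E : f \c inclCG Ks = f \c (0 : mor (subCG Ks) X).
  apply: mor_eq => y; rewrite !compcE hm0 hom0.
  exact: ((inclCG_range Ks _).2 (ex_intro _ y erefl)).
have [y <-] := (inclCG_range Ks x).1 fx.
by rewrite E hm0.
Qed.

Lemma range_submod X Y (f : mor X Y) : submod (range (hm f)).
Proof. exact: image_submod (setT_submod _). Qed.

Lemma epiP X Y (f : mor X Y) : epi f <-> forall y, exists x, hm f x = y.
Proof.
split=> [fe y|fs W g h gh]; last first.
  by apply: mor_eq => y; have [x <-] := fs y; rewrite -!compcE gh.
have Rs := range_submod f.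
have /fe E : projCG Rs \c f = (0 : mor Y (quoCG Rs)) \c f.
  by apply: mor_eq => x; rewrite !compcE hm0; apply/projCG_ker; exists x.
have /projCG_ker[x _ <-] : hm (projCG Rs) y = 0 by rewrite E hm0.
by exists x.
Qed.

Lemma mor_lift X Y Z (i : mor Y Z) (h : mor X Z) : injective (hm i) ->
  (forall x, exists y, hm i y = hm h x) -> exists h' : mor X Y, i \c h' = h.
Proof.
move=> ii ih; have [h' h'E] := hom_lift ii ih.
by exists (mo h'); apply: mor_eq.
Qed.

Lemma mor_descend X Y Z (p : mor X Y) (h : mor X Z) : (forall y, exists x, hm p x = y) ->
  (forall x, hm p x = 0 -> hm h x = 0) -> exists h' : mor Y Z, h' \c p = h.
Proof.
move=> ps ph; have [h' h'E] := hom_descend ps ph.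
by exists (mo h'); apply: mor_eq.
Qed.

Lemma is_kernelI X Y K (f : mor X Y) (i : mor K X) : injective (hm i) ->
  (forall x, hm f x = 0 <-> exists y, hm i y = x) -> is_kernel f i.
Proof.
move=> ii fi; split=> [|W g fg].
  by apply: mor_eq => y; rewrite compcE hm0; apply/fi; exists y.
have [h hE] : exists h : mor W K, i \c h = g.
  by apply: mor_lift => // x; apply/fi; rewrite -compcE fg hm0.
by exists h; split=> // h' h'E; apply: (monoP i).2 => //; rewrite hE.
Qed.

Lemma is_cokernelI X Y Q (f : mor X Y) (p : mor Y Q) :
  (forall q, exists y, hm p y = q) ->
  (forall y, hm p y = 0 <-> exists x, hm f x = y) -> is_cokernel f p.
Proof.
move=> ps pf; split=> [|W g gf].
  by apply: mor_eq => x; rewrite compcE hm0; apply/pf; exists x.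
have [h hE] : exists h : mor Q W, h \c p = g.
  by apply: mor_descend => // y /pf[x <-]; rewrite -compcE gf hm0.
by exists h; split=> // h' h'E; apply: (epiP p).2 => //; rewrite hE.
Qed.

(** Compare the given cokernel with the quotient by the range of [f]. *)
Lemma is_cokernelE X Y Q (f : mor X Y) (p : mor Y Q) : is_cokernel f p ->
  (forall q, exists y, hm p y = q) /\
  (forall y, hm p y = 0 <-> exists x, hm f x = y).
Proof.
move=> [pf pu]; split.
  apply/epiP => W g h gh; have [|h' [_ uni]] := pu W (g \c p).
    by rewrite -Defs.compA pf; apply: mor_eq => x; rewrite compcE !hm0 hom0.
  by rewrite -(uni g) // -(uni h).
have Rs := range_submod f; have [|h [hE _]] := pu _ (projCG Rs).
  by apply: mor_eq => x; rewrite compcE hm0; apply/projCG_ker; exists x.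
move=> y; split=> [py|[x <-]]; last by rewrite -compcE pf hm0.
have : hm (projCG Rs) y = 0 by rewrite -hE compcE py hom0.
by move/projCG_ker => [x _ <-]; exists x.
Qed.

Theorem CG_abelian : abelian_cat C.
Proof.
split.
  have zs : std_generated (submodule_gmod (set0_submod (function_gmod F k))).
    exists [::]; split=> // N Ns _ m; have -> : m = 0; last exact: lsub0 Ns.1.
    by apply: val_inj; have := sub_valX m.
  by exists (mkCG zs); apply/is_zeroP => x; apply: val_inj; have := sub_valX x.
split=> [X Y|].
  pose P := mkCG (prod_std_generated (CG_std X) (CG_std Y)).
  pose p1 : mor P X := mo (X := P) (pr1 (md X) (md Y)).
  pose p2 : mor P Y := mo (X := P) (pr2 (md X) (md Y)).
  exists P, p1, p2 => W f g.
  have hl : linear (fun w : md W => (hm f w, hm g w) : product_gmod (md X) (md Y)).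
    by move=> a u v; rewrite !homD !homZ.
  have hg h (v : md W) : ((hm f (gact h v), hm g (gact h v)) : product_gmod (md X) (md Y))
      = gact h ((hm f v, hm g v) : product_gmod (md X) (md Y)).
    by rewrite !gmod_hom_act.
  exists (mo (Y := P) (mkhom hl hg)); split; first by split; apply: mor_eq.
  move=> h [h1 h2]; apply: mor_eq => w; rewrite /= -h1 -h2.
  by rewrite /hm /= /p1 /p2 /=; case: (gmod_fun h w).
split=> [X Y f|].
  have Ks := ker_submod (hm f); exists (subCG Ks), (inclCG Ks).
  apply: is_kernelI; first exact: inclCG_inj.
  by move=> x; apply: (inclCG_range Ks).
split=> [X Y f|].
  have Rs := range_submod f; exists (quoCG Rs), (projCG Rs).
  apply: is_cokernelI; first exact: projCG_surj.
  by move=> y; split=> [/projCG_ker[x _ <-]|[x <-]]; [exists x | apply/projCG_ker; exists x].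
split=> X Y f.
  move=> /monoP fi; have Rs := range_submod f; exists (quoCG Rs), (projCG Rs).
  apply: is_kernelI => // y.
  by split=> [/projCG_ker[x _ <-]|[x <-]]; [exists x | apply/projCG_ker; exists x].
move=> /epiP fs; have Ks := ker_submod (hm f); exists (subCG Ks), (inclCG Ks).
apply: is_cokernelI => // y; exact: (inclCG_range Ks).
Qed.

(** ** Subobjects *)

Definition Im X (A : subobj X) : set (md X) := range (hm (sinc A)).

Lemma Im_submod X (A : subobj X) : submod (Im A).
Proof. exact: range_submod. Qed.

Lemma sinc_inj X (A : subobj X) : injective (hm (sinc A)).
Proof. exact/monoP/sinc_mono. Qed.

Lemma sub_leP X (A B : subobj X) : sub_le A B <-> Im A `<=` Im B.
Proof.
split=> [[f fE] _ [x _ <-]|AB].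
  by exists (hm f x) => //; rewrite -compcE fE.
apply: mor_lift; first exact: sinc_inj.
by move=> x; have [|y _ <-] := AB (hm (sinc A) x); [exists x | exists y].
Qed.

Definition subobj_of X (N : set (md X)) (Ns : submod N) : subobj X :=
  Subobj ((monoP (inclCG Ns)).2 (@inclCG_inj X N Ns)).

Lemma Im_subobj_of X (N : set (md X)) (Ns : submod N) : Im (subobj_of Ns) = N.
Proof.
apply/seteqP; split=> x; first by move=> [y _ <-]; apply/(inclCG_range Ns); exists y.
by move=> /(inclCG_range Ns)[y <-]; exists y.
Qed.

Lemma Im_subT X : Im (subT X) = [set: md X].
Proof. by apply/seteqP; split=> // x _; exists x. Qed.

Lemma zero_Im X (A : subobj X) : is_zero (sdom A) <-> Im A `<=` [set 0].
Proof.
split=> [/is_zeroP A0 _ [x _ <-]|A0]; first by rewrite (A0 x) hom0.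
apply/is_zeroP => x; apply: (@sinc_inj _ A); rewrite hom0.
by apply: A0; exists x.
Qed.

Lemma is_subquoP X (A B : subobj X) Q : is_subquo A B Q -> Im A `<=` Im B /\
  exists p : gmod_hom (md (sdom B)) (md Q), (forall q, exists y, p y = q) /\
    (forall y, p y = 0 <-> Im A (hm (sinc B) y)).
Proof.
move=> [i [p [iE /is_cokernelE[ps pker]]]]; split; first by apply/sub_leP; exists i.
exists (hm p); split=> // y; split=> [/pker[x <-]|[x _ xE]].
  by exists x => //; rewrite -iE.
by apply/pker; exists x; apply: (@sinc_inj _ B); rewrite -compcE iE.
Qed.

Lemma is_subquoI X (A B : subobj X) Q (p : mor (sdom B) Q) : Im A `<=` Im B ->
  (forall q, exists y, hm p y = q) ->
  (forall y, hm p y = 0 <-> Im A (hm (sinc B) y)) -> is_subquo A B Q.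
Proof.
move=> /sub_leP[i iE] ps pker; exists i, p; split=> //.
apply: is_cokernelI => // y; split=> [/pker[x _ xE]|[x <-]]; last first.
  by apply/pker; exists x => //; rewrite -compcE iE.
by exists x; apply: (@sinc_inj _ B); rewrite -compcE iE.
Qed.

Lemma simpleP X : simple_obj X <-> (exists x : md X, x <> 0) /\
  forall N : set (md X), submod N -> N `<=` [set 0] \/ forall x, N x.
Proof.
split=> [[X0 Xs]|[[x x0] Xs]].
  split.
    apply: contrapT => no; apply: X0; apply/is_zeroP => x.
    by apply: contrapT => x0; apply: no; exists x.
  move=> N Ns; have [/zero_Im|/sub_leP] := Xs (subobj_of Ns); rewrite ?Im_subobj_of.
    by left.
  by rewrite Im_subT => h; right=> x; apply: h.
split=> [/is_zeroP/(_ x)//|A].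
have [A0|AT] := Xs (Im A) (Im_submod A); first by left; apply/zero_Im.
by right; apply/sub_leP.
Qed.

(** Submodules are finitely generated, so directed families have a maximum. *)
Theorem CG_grothendieck : grothendieck_condition C.
Proof.
move=> X B I A BA [[i0] Adir] ABA.
pose N : set (md X) := [set x | exists i, Im (A i) x].
have Ns : submod N.
  split; first split; first by exists i0; apply: lsub0 (Im_submod _).1.
    move=> r u v [i Au] [j Av]; have [l [/sub_leP il /sub_leP jl]] := Adir i j.
    by exists l; apply: (Im_submod _).1.2; [apply: il | apply: jl].
  by move=> g v [i Av]; exists i; apply: (Im_submod _).2.
have [gs [gsN gen]] := submod_std_generated k_char0 F_fin (CG_std X) Ns.
have [l lgs] : exists l, forall g, g \in gs -> Im (A l) g.
  elim: gs {gen} gsN => [|g gs IH] gsN; first by exists i0.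
  have [|l lP] := IH; first by move=> h hgs; apply: gsN; rewrite inE hgs orbT.
  have [[j gj] _] := gsN g (mem_head _ _); have [m [/sub_leP lm /sub_leP jm]] := Adir l j.
  by exists m => h; rewrite inE => /predU1P[->|/lP/lm//]; apply: jm.
have Al i : sub_le (A i) (A l).
  apply/sub_leP => x Ax; apply: (gen _ (Im_submod (A l)) lgs).
  by exists i.
have [BAB BAA BAm] := ABA l.
exists (A l), (BA l); split=> //; split=> // i.
have [h1 h2 _] := ABA i; apply: BAm => //.
by apply/sub_leP => x /((sub_leP _ _).1 h2)/((sub_leP _ _).1 (Al i)).
Qed.

End Category.

(** * Extension of homomorphisms *)

Section Graphs.
Context (F : closedFieldType) (k : fieldType) (M I : gmod k (SL2 F)).
Hypothesis k_char0 : [pchar k] =i pred0.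
Hypothesis F_fin : locally_finite_field F.
Local Notation P := (product_gmod M I).
Implicit Types (D : set P) (N : set M) (o : option (torus_char F k)).

Lemma pairB (x x' : M) (y y' : I) : ((x, y) : P) - ((x', y') : P) = (x - x', y - y').
Proof. by []. Qed.

Lemma std_pair o g g' : std o g -> std o g' -> std o ((g, g') : P).
Proof. by move=> og og'; rewrite pair_in12; apply: (lsubD (lsub_std P o)); apply: std_hom. Qed.

(** A homomorphism defined on a submodule of [M] is represented by its graph. *)
Definition functional D := forall y, D (0, y) -> y = 0.

Definition dom D : set M := [set x | exists y, D (x, y)].

Lemma functionalP D x y y' : lsub D -> functional D -> D (x, y) -> D (x, y') -> y = y'.
Proof.
move=> Dl Df Dy Dy'; apply/eqP; rewrite -subr_eq0; apply/eqP/Df.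
by have := lsubB Dl Dy Dy'; rewrite pairB subrr.
Qed.

Lemma graph_std D o e e' : submod D -> functional D -> D (e, e') -> std o e -> std o e'.
Proof.
move=> Ds Df De oe; pose i := gmod_comp (pr1 M I) (sub_incl Ds).
have ii : injective i.
  apply: hom_inj => -[[x y] Dxy] /= x0; apply: val_inj => /=; rewrite x0.
  by have /asboolP := Dxy; rewrite x0 => /Df->.
have oe' : std o (sub_elt Ds De) by apply: (std_hom_inj ii).
exact: (std_hom (gmod_comp (pr2 M I) (sub_incl Ds)) oe').
Qed.

Lemma graph_hom D : submod D -> functional D -> (forall x, dom D x) ->
  exists h : gmod_hom M I, forall x, D (x, h x).
Proof.
move=> [Dl Dg] Df /choice[h hE].
have hl : linear h.
  move=> a u v; apply: (functionalP Dl Df (hE _)).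
  exact: (Dl.2 a _ _ (hE u) (hE v)).
have hg g v : h (gact g v) = gact g (h v).
  by apply: (functionalP Dl Df (hE _)); apply: (Dg g _ (hE v)).
by exists (mkhom hl hg).
Qed.

End Graphs.

Section CellHom.
Context (F k : fieldType) (M N : gmod k (SL2 F)) (f : gmod_hom M N).

Lemma hom_usum s x : f (usum s x) = usum s (f x).
Proof.
rewrite hom_sum; apply: eq_bigr => p _.
by rewrite homZ gmod_hom_act.
Qed.

Lemma hom_Uspan x y : Uspan (f x) y <-> exists2 z, Uspan x z & f z = y.
Proof.
split=> [[s ->]|[_ [s ->] <-]]; last by exists s; rewrite hom_usum.
by exists (usum s x); [exists s | rewrite hom_usum].
Qed.

End CellHom.

Section GraphExtension.
Context (F : closedFieldType) (k : fieldType) (M I : gmod k (SL2 F)).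
Hypothesis k_char0 : [pchar k] =i pred0.
Hypothesis F_fin : locally_finite_field F.
Implicit Types (N : set M) (o : option (torus_char F k)).

Lemma cell_hom (M' N' : gmod k (SL2 F)) (f : gmod_hom M' N') o g y :
  cell o (f g) y <-> exists2 z, cell o g z & f z = y.
Proof.
case: o => [l|] /=; last exact: hom_Uspan.
case: ifP => _; split.
- by move=> [r ->]; exists (r *: g); [exists r | rewrite homZ].
- by move=> [_ [r ->] <-]; exists r; rewrite homZ.
- move=> [r [w [wU ->]]]; rewrite -gmod_hom_act in wU.
  have [z zU zw] := (hom_Uspan f _ _).1 wU.
  by exists (r *: g + z); [exists r, z | rewrite homD homZ zw].
move=> [_ [r [w [wU ->]]] <-]; exists r, (f w); split; last by rewrite homD homZ.
by rewrite -gmod_hom_act; apply/hom_Uspan; exists w.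
Qed.

Local Notation P := (product_gmod M I).

(** The cell of [(g, g')] meets the preimage of [N] trivially, because it is
    simple and [g] is not in [N]. If [g] is fixed by [B], then its
    cell is a submodule only modulo [s g - g], whence the condition on [g']. *)
Lemma graph_extend (D : set P) N o g g' :
  submod D -> functional D -> dom D = N -> submod N -> std o g -> std o g' ->
  ~ N g -> (o = Some chi_one -> D (wact g - g, wact g' - g')) ->
  let D' := addset D (cell o ((g, g') : P)) in
  [/\ submod D', functional D' & dom D' = addset N (cell o g)].
Proof.
move=> Ds Df DN Ns og og' Ng o1 D'.
have oP : std o ((g, g') : P) by apply: std_pair.
have D's : submod D'.
  by apply: addset_cell_submod => // /o1 Dg; rewrite /= /prod_act /= pairB.
split=> // [y [[x y1] [z [Dxy cz E]]]|].
  have z0 : z = 0.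
    apply: contrapT => z0; apply: Ng.
    apply: (cell_simple k_char0 F_fin (preimage_submod (pr1 M I) Ns) oP cz z0).
    have -> : z = (- x, y - y1) by have := congr1 (fun u => u - ((x, y1) : P)) E;
      rewrite /= addrAC subrr add0r pairB sub0r => ->.
    by apply: (lsubN Ns.1); rewrite -DN; exists y1.
  by move: E Dxy; rewrite z0 addr0 => -[<- <-]; apply: Df.
apply/seteqP; split=> x.
  move=> [y [[x1 y1] [z [Dxy cz [-> _]]]]]; exists x1, z.1; split=> //.
    by rewrite -DN; exists y1.
  by apply/(cell_hom (pr1 M I) o ((g, g') : P)); exists z.
move=> [x1 [c [Nx1 /(cell_hom (pr1 M I) o ((g, g') : P))[z cz zc] ->]]].
have [y1 Dy1] : dom D x1 by rewrite DN.
by exists (y1 + z.2), (x1, y1), z; split=> //; rewrite -zc.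
Qed.

(** The only nonsplit extension between simple objects is that of the trivial
    module by the Steinberg module, generated by a [B]-fixed vector [z] such that
    [s z - z] generates the Steinberg module. *)
Definition steinberg_split := forall e : I, steinberg_vector e ->
  exists2 z, Uweight chi_one z & wact z - z = e.

(** The domain is enlarged one cell at a time. A generator that is not fixed by [B]
    may be sent to [0]; if [g] is fixed by [B], then the image of the Steinberg
    vector [s g - g] is already prescribed, and [steinberg_split] provides the
    image of [g]. *)
Lemma hom_extend (D : set P) : steinberg_split -> std_generated M ->
  submod D -> functional D ->
  exists h : gmod_hom M I, forall x y, D (x, y) -> h x = y.
Proof.
move=> Icrit Ms Ds Df.
pose Q N := exists D', [/\ submod D', functional D', dom D' = N & D `<=` D'].
have domE : dom D = pr1 M I @` D.
  by apply/seteqP; split=> [x [y Dxy]|_ [[x y] Dxy <-]]; [exists (x, y) | exists y].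
have [D' [D's D'f D'T DD']] : Q [set: M].
  apply: (std_ind (P := Q) (N := dom D) Ms).
  - by rewrite domE; apply: image_submod.
  - by exists D; split.
  move=> N o g Ns [D' [D's D'f D'N DD']] og Ng o1.
  have [g' [og' D'g]] : exists g', std o g' /\
      (o = Some chi_one -> D' (wact g - g, wact g' - g')).
    have [oE|no] := pselect (o = Some chi_one); last first.
      by exists 0; split=> //; apply: lsub0; apply: lsub_std.
    have [e' De'] : dom D' (wact g - g) by rewrite D'N; apply: o1.
    have [|z zU ze] := Icrit e'.
      apply: (graph_std (o := None) D's D'f De').
      by apply: steinberg_aug; rewrite oE in og.
    by exists z; split=> [|_]; [rewrite oE | rewrite ze].
  have [D''s D''f D''N] := graph_extend D's D'f D'N Ns og og' Ng D'g.
  exists (addset D' (cell o ((g, g') : P))); split=> // d /DD' D'd.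
  by apply: addsetl => //; apply: lsub_cell.
have [|h hE] := graph_hom D's D'f; first by rewrite D'T.
by exists h => x y /DD' D'xy; apply: (functionalP D's.1 D'f (hE x) D'xy).
Qed.

End GraphExtension.

(** ** Vectors of a given type *)

Section SteinbergSpan.
Context (F : closedFieldType) (k : fieldType) (M : gmod k (SL2 F)).
Hypothesis k_char0 : [pchar k] =i pred0.
Hypothesis F_fin : locally_finite_field F.
Implicit Types (l : torus_char F k) (o : option (torus_char F k)) (g v e z : M).

Lemma steinberg_Ufixed0 e : steinberg_vector e -> Ufixed e -> e = 0.
Proof.
by move=> [_ ew ex] fe; move: ex; rewrite !fe subrr ew => /eqP; rewrite oppr_eq0 => /eqP.
Qed.

Lemma weight_unique l l' v : v <> 0 -> weight_space l v -> weight_space l' v -> l = l'.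
Proof.
move=> v0 lv l'v; apply: torus_char_eq => c c0.
have := weightE c lv; rewrite (weightE c l'v) => /eqP.
by rewrite -subr_eq0 -scalerBl scaler_eq0 subr_eq0 => /orP[/eqP->//|/eqP].
Qed.

(** The weights of the two parts [k g] and [kU s g] of a cell are inverse to each
    other, so an element fixed by the torus or by [U] lies in one of the two. *)
Lemma std_cell o g m z : std o g -> (o = Some chi_one -> wact g = g) ->
  cell o g z -> std m z -> z <> 0 -> m = o /\ exists r : k, z = r *: g.
Proof.
case: o => [l|] og o1 cz mz z0; last first.
  have gw := std_weight og; have zw := std_weight mz.
  have [r zE] := Uspan_weight k_char0 F_fin gw zw cz.
  split; last by exists r.
  case: m mz {zw} => [l|//] [fz _]; case: z0; apply: steinberg_Ufixed0 fz.
  by rewrite zE; apply: (lsubZ (lsub_steinberg M)).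
have [l1|/eqP l1] := eqVneq l chi_one.
  have [r zE] : exists r : k, z = r *: g by move: cz; rewrite /= l1 eqxx.
  have zU : Uweight l z by rewrite zE; apply: (lsubZ (lsub_Uweight M l)).
  split; last by exists r.
  case: m mz => [l'|] mz; first by congr Some; apply: weight_unique z0 mz.2 zU.2.
  by case: z0; apply: (steinberg_Ufixed0 mz zU.1).
have g0 : g <> 0 by move=> g0; rewrite g0 in cz; apply: z0; apply: cell0 cz.
have gw := weight_wact og.2.
have fix0 x : Uspan (wact g) x -> Ufixed x -> x = 0.
  have [fwg|fr] := Ufixed_or_Ufree k_char0 F_fin gw; last exact: Uspan_free_Ufixed.
  by case: l1; apply: Gfixed_weight g0 _ og.2; apply: Ufixed_Gfixed og.1 fwg.
have fg r : Ufixed (r *: g) by apply: (lsubZ (@lsub_Ufixed _ _ M)); apply: og.1.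
move: cz; rewrite /= ifN; last exact/eqP.
move=> [r [w [wU zE]]]; case: m mz => [l'|] mz.
  have w0 : w = 0.
    apply: (fix0 w wU); rewrite -[w](addKr (r *: g)) -zE addrC.
    exact: (lsubB (@lsub_Ufixed _ _ M)) mz.1 (fg r).
  rewrite w0 addr0 in zE; split; last by exists r.
  congr Some; apply: weight_unique z0 mz.2 _.
  by rewrite zE; apply: (lsubZ (lsub_weight M l)); apply: og.2.
have [c c0 lc] := torus_char_neq l1; have [hz _ _] := mz.
have r0 : r = 0.
  have : (r - r * chi l c) *: g = 0.
    apply: fix0 (fg _); have -> : (r - r * chi l c) *: g = hact c w - w.
      have -> : w = z - r *: g by rewrite zE addrC addKr.
      by rewrite gactB hz // gactZ (weightE c og.2) scalerA scalerBl opprB [RHS]addrC addrA subrK.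
    by apply: (lsubB (lsub_Uspan _)) => //; apply: Uspan_hact gw c0 wU.
  move/eqP; rewrite scaler_eq0 -{1}[r]mulr1 -mulrBr mulf_eq0 => /orP[/orP[/eqP//|]|/eqP//].
  by rewrite subr_eq0 eq_sym (negPf lc).
rewrite r0 scale0r add0r in zE; rewrite -zE in wU.
have zw := std_weight (mz : std None z).
have [q zE'] := Uspan_weight k_char0 F_fin gw zw wU.
case: l1; rewrite -[l]chi_invK -(weight_unique z0 zw (l' := chi_inv l)).
  by apply: torus_char_eq => d _; rewrite chi_invE invr1.
by rewrite zE'; apply: (lsubZ (lsub_weight M _)).
Qed.

(** When a cell is added to a submodule, a Steinberg vector of the sum decomposes
    into Steinberg vectors of the two summands, and those of the cell are
    multiples of its generator by [std_cell]. *)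
Lemma steinberg_in_span (Z : set M) (gs : seq M) : lsub Z ->
  (forall v, Uweight chi_one v -> Z (wact v - v)) ->
  (forall g, g \in gs -> exists o, std o g /\ (o = None -> Z g)) ->
  (forall N, submod N -> (forall g, g \in gs -> N g) -> forall m, N m) ->
  forall e, steinberg_vector e -> Z e.
Proof.
move=> Zl Z1 gstd ggen e es.
pose A o g := (o = Some chi_one -> Uweight chi_one g) /\ (o = None -> Z g).
pose P N := forall e, N e -> steinberg_vector e -> Z e.
suff : P [set: M] by apply.
apply: (@std_ind_in F k M A gs P [set 0]) => //.
- by move=> v [vU _]; split=> // _; apply: Z1; apply: vU.
- by move=> g /gstd[o [og oZ]]; exists o; split=> //; split=> // o1; rewrite o1 in og.
- exact: set0_submod.
- by move=> _ -> _; apply: lsub0.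
move=> N o g Ns PN og [_ oZ] Ng o1 _ [n [z [Nn cz ->]]] nzs.
have [oE|no] := pselect (o = Some chi_one).
  move: cz; rewrite oE /= eqxx => -[r zE]; rewrite oE in og.
  have [r0|r0] := eqVneq r 0.
    by move: nzs; rewrite zE r0 scale0r addr0; apply: PN.
  case: Ng; apply: (lsubZ_inv Ns.1 r0); have [_ _ ex] := nzs.
  move: ex; rewrite zE !gactD !gactZ !og.1 opprD addrACA subrr addr0 => E.
  have Nwg : N (r *: wact g).
    have -> : r *: wact g = xact (-1) n - n - wact (xact 1 n).
      by rewrite -E addrAC subrr add0r.
    by do ![apply: (lsubB Ns.1) => //]; do ?apply: (Ns.2).
  have -> : r *: g = r *: wact g - r *: (wact g - g).
    by rewrite scalerBr opprB addrC subrK.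
  by apply: (lsubB Ns.1) => //; apply: (lsubZ Ns.1); apply: o1.
have cs := cell_submod og no.
have cN x : N x -> cell o g x -> x = 0.
  by move=> Nx cx; apply: contrapT => x0; apply: Ng; apply: (cell_simple k_char0 F_fin Ns og cx x0).
have ns : steinberg_vector n by apply: (std_proj (o := None) Ns cs cN Nn cz).
have zs : steinberg_vector z.
  by apply: (std_proj (o := None) cs Ns _ cz Nn) => [x cx Nx|]; [apply: cN | rewrite addrC].
apply: (lsubD Zl); first exact: PN.
have [->|z0] := pselect (z = 0); first exact: lsub0.
have [oE [r zE]] := @std_cell o g None z og (fun E => False_ind _ (no E)) cz zs z0.
by rewrite zE; apply: (lsubZ Zl); apply: oZ.
Qed.

End SteinbergSpan.

(** * The simple objects *)

Section ConcreteVectors.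
Context (F : closedFieldType) (k : fieldType).
Hypothesis k_char0 : [pchar k] =i pred0.
Hypothesis F_fin : locally_finite_field F.
Local Notation FM := (function_gmod F k).
Implicit Types (l : torus_char F k) (o : option (torus_char F k)).

Definition fone : FM := fun _ => 1.

(** The function supported on [B] that generates the module induced from the
    character [l] of [B]. *)
Definition feta l : FM := fun x =>
  if SL2val x 1 0 == 0 then (chi l (SL2val x 0 0))^-1 else 0.

Lemma fone_fixed g : gact g fone = fone. Proof. by []. Qed.

Lemma feta_std l : Uweight l (feta l).
Proof.
have uV (a : F) : ((ux a)^-1 = ux (- a))%g.
  by apply: (mulgI (ux a)); rewrite mulgV -uxD subrr ux0.
have hV (c : F) : c != 0 -> ((hx c)^-1 = hx c^-1)%g.
  by move=> c0; apply: (mulgI (hx c)); rewrite mulgV -hxM ?invr_eq0 // mulfV // hx1.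
split=> [a|].
  apply/funext => x; rewrite /= /fun_act uV /feta /= [SL2val x]mx2E mulmx2 !mxE /=.
  rewrite !(mul1r, mul0r, add0r); case: eqP => // ->.
  by rewrite mulr0 addr0.
apply/weight_spaceP => c c0; apply/funext => x.
rewrite [RHS](_ : _ = chi l c * (feta l x : k)) // /= /fun_act hV // /feta /=.
rewrite [SL2val x]mx2E mulmx2 !mxE /= nzE ?invr_eq0 // invrK.
rewrite !(mul0r, add0r, addr0) mulf_eq0 (negPf c0) /=; case: eqP => [x10|_]; last by rewrite mulr0.
have x00 : SL2val x 0 0 != 0.
  apply: contraTneq (SL2P x) => x00; rewrite [SL2val x]mx2E det_mx2 x00 x10.
  by rewrite mul0r mulr0 subr0 eq_sym oner_neq0.
by rewrite chiM ?invr_eq0 // chiV // invfM invrK.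
Qed.

Lemma feta_neq0 l : feta l <> 0.
Proof.
move=> /(congr1 (fun f : FM => f 1%g)); rewrite /feta /= !mxE /= eqxx chi1 invr1.
by move=> /eqP; apply/negP; apply: oner_neq0.
Qed.

(** The [B]-fixed function [feta chi_one] is not fixed by [G]; the constant function
    replaces it as a generator of the trivial module. *)
Definition fgen o : FM := match o with
  | None => wact (feta chi_one) - feta chi_one
  | Some l => if l == chi_one then fone else feta l
  end.

Lemma fone_std : Uweight chi_one fone.
Proof.
split=> [a|]; first exact: fone_fixed.
by apply/weight_spaceP => c c0; rewrite chi_oneE scale1r.
Qed.

Lemma fgen_std o : std o (fgen o).
Proof.
case: o => [l|] /=; last exact/steinberg_aug/feta_std.
by case: eqP => [->|_]; [apply: fone_std | apply: feta_std].
Qed.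

Lemma fgen_neq0 o : fgen o <> 0.
Proof.
case: o => [l|] /=.
  case: eqP => _; last exact: feta_neq0.
  by move=> /(congr1 (fun f : FM => f 1%g))/eqP; apply/negP; apply: oner_neq0.
move=> e0; have : (fun_act (wx F) (feta chi_one) 1%g : k) - (feta chi_one 1%g : k) = 0.
  exact: (congr1 (fun f : FM => f 1%g : k) e0).
rewrite /fun_act mulg1 /feta /=.
have -> : invmx (mx2 0 1 (-1) 0 : 'M[F]_2) = mx2 0 (-1) 1 0.
  have wu : (mx2 0 1 (-1) 0 : 'M[F]_2) \in unitmx.
    by rewrite unitmxE det_mx2 mulr0 mul1r sub0r opprK unitr1.
  apply: (can_inj (mulKmx wu)); rewrite mulmxV // mulmx2 mx2_1.
  by congr mx2; ring.
rewrite !mxE /= oner_eq0 eqxx invr1 sub0r => /eqP.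
by rewrite oppr_eq0 oner_eq0.
Qed.

Lemma fgen_fixed o : o = Some chi_one -> wact (fgen o) = fgen o.
Proof. by move=> -> /=; rewrite eqxx. Qed.

Lemma fgen_submod o : submod (cell o (fgen o)).
Proof.
have [oE|no] := pselect (o = Some chi_one); last exact: cell_submod (fgen_std o) no.
have := set0_submod FM => /addset_cell_submod-/(_ _ _ (fgen_std o)).
have -> : addset [set (0 : FM)] (cell o (fgen o)) = cell o (fgen o).
  apply/seteqP; split=> x; first by move=> [_ [c [-> cc ->]]]; rewrite add0r.
  by move=> cx; exists 0, x; rewrite add0r.
by apply=> /fgen_fixed->; rewrite subrr.
Qed.

Lemma cell_std_generated (M : gmod k (SL2 F)) o (g : M) (Ns : submod (cell o g)) :
  std o g -> std_generated (submodule_gmod Ns).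
Proof.
move=> og; exists [:: sub_elt Ns (cell_id o g)]; split=> [x|Y Ys Yg x].
  rewrite inE => /eqP->; exists o.
  exact: (std_hom_inj (@sub_incl_inj _ _ _ _ Ns)).
have Ig : (sub_incl Ns @` Y) g.
  by exists (sub_elt Ns (cell_id o g)) => //; apply: Yg; rewrite inE.
have [y Yy /sub_incl_inj<-//] := cell_sub (image_submod (sub_incl Ns) Ys) Ig (sub_valX x).
Qed.

Definition Sobj o : CG F k :=
  mkCG k_char0 F_fin (cell_std_generated (fgen_submod o) (fgen_std o)).

Definition Sgen o : md (Sobj o) := sub_elt (fgen_submod o) (cell_id o (fgen o)).

Lemma Sgen_std o : std o (Sgen o).
Proof. by apply: (std_hom_inj (@sub_incl_inj _ _ _ _ (fgen_submod o))); apply: fgen_std. Qed.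

Lemma Sgen_neq0 o : Sgen o <> 0.
Proof. by move=> /(congr1 (fun x => sub_val x)); apply: fgen_neq0. Qed.

Lemma Sobj_cell o (x : md (Sobj o)) : cell o (Sgen o) x.
Proof.
have cx := sub_valX x.
have [z zc /sub_incl_inj <-//] := (cell_hom (sub_incl (fgen_submod o)) o (Sgen o) (sub_val x)).1 cx.
Qed.

Lemma Sgen_fixed o : o = Some chi_one -> wact (Sgen o) = Sgen o.
Proof. by move=> oE; apply: val_inj; apply: fgen_fixed. Qed.

Lemma Sobj_gen o (N : set (md (Sobj o))) z : submod N -> N z -> z <> 0 -> forall x, N x.
Proof.
move=> Ns Nz z0 x; apply: (cell_sub (o := o) (g := Sgen o)) (Sobj_cell x) => //.
exact: cell_simple (Sgen_std o) (Sobj_cell z) z0 Nz.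
Qed.

Lemma Sobj_std o m (z : md (Sobj o)) : std m z -> z <> 0 ->
  m = o /\ exists r : k, z = r *: Sgen o.
Proof.
move=> mz z0; apply: (std_cell k_char0 F_fin (Sgen_std o)) (Sobj_cell z) mz z0.
exact: Sgen_fixed.
Qed.

Lemma Sobj_simple o : simple_obj (Sobj o).
Proof.
apply/(simpleP k_char0 F_fin); split; first by exists (Sgen o); apply: Sgen_neq0.
move=> N Ns; have [[z [Nz z0]]|no] := pselect (exists z, N z /\ z <> 0).
  by right; apply: Sobj_gen Nz z0.
by left=> z Nz; apply: contrapT => z0; apply: no; exists z.
Qed.

(** The required map is the extension of the zero map provided by
    [graph_extend]. *)
Lemma Sobj_hom o (M : gmod k (SL2 F)) (g : M) : std o g ->
  (o = Some chi_one -> wact g = g) ->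
  exists h : gmod_hom (md (Sobj o)) M, h (Sgen o) = g.
Proof.
move=> og o1; pose P := product_gmod (md (Sobj o)) M.
pose D : set P := [set 0].
have D0 : dom D = [set 0].
  apply/seteqP; split=> [x [y [-> //]]|_ ->]; by exists 0.
have [||||||||D's D'f D'N] := graph_extend k_char0 F_fin (D := D) (N := [set 0])
    (o := o) (g := Sgen o) (g' := g) => //.
- exact: set0_submod.
- by move=> y [].
- exact: set0_submod.
- exact: Sgen_std.
- exact: Sgen_neq0.
- by move=> oE; rewrite Sgen_fixed // o1 // !subrr.
have [|h hE] := graph_hom D's D'f.
  move=> x; rewrite D'N; apply: addsetr; last exact: Sobj_cell.
  exact: (set0_submod _).1.
exists h; apply: (functionalP D's.1 D'f (hE _)).
apply: addsetr; last exact: cell_id.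
exact: (set0_submod P).1.
Qed.

(** A simple object is generated by a nonzero standard vector [g]. If [g] is fixed
    by [B] but not by [G], then [s g - g] is a nonzero Steinberg vector. *)
Lemma complete_Sobj : complete_simples Sobj.
Proof.
split; first exact: Sobj_simple.
  move=> o m [f [g [gf fg]]].
  have fi : injective (hm f).
    move=> x y fxy; have := congr1 (fun h => hm h x) gf; rewrite compcE fxy -compcE gf.
    by rewrite !idcE.
  have f0 : hm f (Sgen o) <> 0.
    by move=> f0; apply: (@Sgen_neq0 o); apply: fi; rewrite f0 hom0.
  by have [] := Sobj_std (std_hom (hm f) (Sgen_std o)) f0.
move=> X /(simpleP k_char0 F_fin)[[x x0] Xs].
have [o [g [og g0 o1]]] : exists o (g : md X),
    [/\ std o g, g <> 0 & o = Some chi_one -> wact g = g].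
  have [gs [gstd ggen]] := CG_std k_char0 F_fin X.
  have [g gg g0] : exists2 g, g \in gs & g <> 0.
    apply: contrapT => no; apply: x0; apply: (ggen _ (set0_submod _)) => g gg.
    by apply: contrapT => g0; apply: no; exists g.
  have [o og] := gstd g gg; have [oE|no] := pselect (o = Some chi_one); last first.
    by exists o, g.
  have [e0|e0] := pselect (wact g - g = 0).
    by exists o, g; split=> // _; apply/eqP; rewrite -subr_eq0; apply/eqP.
  by exists None, (wact g - g); split=> //; apply: steinberg_aug; rewrite oE in og.
have [h hg] := Sobj_hom og o1.
have h_inj : injective h.
  apply: hom_inj => z hz; apply: contrapT => z0; apply: g0; rewrite -hg.
  exact: (Sobj_gen (ker_submod h) hz z0).
have hs y : exists z, h z = y.
  have [R0|RT] := Xs _ (image_submod h (setT_submod _)).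
    by case: g0; apply: R0; exists (Sgen o).
  by have [z _ <-] := RT y; exists z.
have [h' h'E] := choice hs.
have h'l : linear h' by move=> a u v; apply: h_inj; rewrite homD homZ !h'E.
have h'g a v : h' (gact a v) = gact a (h' v).
  by apply: h_inj; rewrite gmod_hom_act !h'E.
exists o, (mo (X := X) (Y := Sobj o) (mkhom h'l h'g)), (mo (X := Sobj o) (Y := X) h).
by split; apply: mor_eq => y; rewrite compcE /= ?h'E //; apply: h_inj; rewrite h'E.
Qed.

(** A homomorphism is determined by the image of the generator. *)
Lemma Sobj_mor_dim o m : exists n, has_dim [set: mor (Sobj o) (Sobj m)] n.
Proof.
have detf (f g : mor (Sobj o) (Sobj m)) : hm f (Sgen o) = hm g (Sgen o) -> f = g.
  move=> fg; apply: mor_eq => x; apply/eqP; rewrite -subr_eq0; apply/eqP.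
  have := Sobj_gen (ker_submod (f - g : gmod_hom _ _)) _ (@Sgen_neq0 o) x.
  by apply; change (hm f (Sgen o) - hm g (Sgen o) = 0); rewrite fg subrr.
have [[f f0]|no] := pselect (exists f : mor (Sobj o) (Sobj m), f <> 0); last first.
  exists 0%N, (fun _ => 0); split=> [c _ []//|]; apply/seteqP; split=> // f _.
  exists 0%N, (fun _ => 0), (fun _ => 0); split=> [[]//|]; rewrite big_ord0.
  by apply: contrapT => f0; apply: no; exists f.
have fg0 : hm f (Sgen o) <> 0.
  by move=> fg; apply: f0; apply: detf; rewrite fg hm0.
have [_ [r fr]] := Sobj_std (std_hom (hm f) (Sgen_std o)) fg0.
have r0 : r != 0 by apply/eqP => r0; apply: fg0; rewrite fr r0 scale0r.
exists 1%N, (fun _ => f); split.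
  move=> c; rewrite big_ord1 => /eqP; rewrite scaler_eq0 => /orP[/eqP c0 i|/eqP//].
  by rewrite ord1.
apply/seteqP; split=> // g _.
have [t gt] : exists t : k, hm g (Sgen o) = t *: Sgen m.
  have [->|g0] := pselect (hm g (Sgen o) = 0); first by exists 0; rewrite scale0r.
  by have [_] := Sobj_std (std_hom (hm g) (Sgen_std o)) g0.
exists 1%N, (fun _ => t / r), (fun _ => f); split; first by move=> i; exists ord0.
rewrite big_ord1; apply: detf.
rewrite [RHS](_ : _ = (t / r) *: hm f (Sgen o)) // fr gt.
by rewrite scalerA mulfVK.
Qed.

End ConcreteVectors.

(** * Composition series *)

Section Length.
Context (F : closedFieldType) (k : fieldType).
Hypothesis k_char0 : [pchar k] =i pred0.
Hypothesis F_fin : locally_finite_field F.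
Local Notation C := (CG F k).
Implicit Types (X Q : C) (o : option (torus_char F k)).

Definition covers (M : gmod k (SL2 F)) (N N' : set M) :=
  [/\ N `<=` N', exists x, N' x /\ ~ N x
    & forall N0, submod N0 -> N `<=` N0 -> N0 `<=` N' -> N0 `<=` N \/ N' `<=` N0].

Lemma covers_cell (M : gmod k (SL2 F)) (N : set M) o g :
  submod N -> std o g -> ~ N g -> covers N (addset N (cell o g)).
Proof.
move=> Ns og Ng; split.
- by move=> x; apply: addsetl; apply: lsub_cell.
- by exists g; split=> //; apply: addsetr; [apply: Ns.1 | apply: cell_id].
move=> N0 N0s NN0 N0A; have [|no] := pselect (N0 `<=` N); [by left | right].
have [x [N0x Nx]] : exists x, N0 x /\ ~ N x.
  apply: contrapT => nx; apply: no => x N0x; apply: contrapT => Nx.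
  by apply: nx; exists x.
have [n [c [Nn cc xE]]] := N0A x N0x.
have N0c : N0 c by rewrite -(addKr n c) -xE addrC; apply: (lsubB N0s.1) => //; apply: NN0.
have c0 : c <> 0 by move=> c0; apply: Nx; rewrite xE c0 addr0.
have N0g := cell_simple k_char0 F_fin N0s og cc c0 N0c.
move=> _ [n' [c' [/NN0 Nn' cc' ->]]]; apply: (lsubD N0s.1) => //.
exact: cell_sub N0s N0g _ cc'.
Qed.

Lemma covers_chain (M : gmod k (SL2 F)) : std_generated M ->
  exists m (L : nat -> set M), [/\ forall i, submod (L i), L 0%N = [set 0],
    L m = [set: M] & forall i, (i < m)%N -> covers (L i) (L i.+1)].
Proof.
move=> Ms; pose P N := exists m (L : nat -> set M), [/\ forall i, submod (L i),
  L 0%N = [set 0], L m = N & forall i, (i < m)%N -> covers (L i) (L i.+1)].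
apply: (std_ind (P := P) Ms (set0_submod M)).
  by exists 0%N, (fun _ => [set 0]); split=> // _; apply: set0_submod.
move=> N o g Ns [m [L [Ls L0 Lm Lc]]] og Ng o1.
exists m.+1, (fun i => if (i <= m)%N then L i else addset N (cell o g)); split=> //.
- by move=> i; case: ifP => // _; apply: addset_cell_submod.
- by rewrite ltnn.
move=> i im /=; have := im; rewrite {1}ltnS {1}leq_eqVlt => /predU1P[->|lt_im]; last first.
  by rewrite (ltnW lt_im) lt_im; apply: Lc.
by rewrite leqnn ltnn Lm; apply: covers_cell.
Qed.

Lemma covers_simple X (A B : subobj X) : covers (Im A) (Im B) ->
  exists Q, simple_obj Q /\ is_subquo A B Q.
Proof.
move=> [AB [_ [[x _ <-] Ax]] cov]; have Ps := preimage_submod (hm (sinc B)) (Im_submod A).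
exists (quoCG k_char0 F_fin Ps); split; last first.
  apply: (is_subquoI k_char0 F_fin (p := projCG k_char0 F_fin Ps)) => //; first exact: projCG_surj.
  by move=> y; apply: projCG_ker.
apply/(simpleP k_char0 F_fin); split.
  by exists (hm (projCG k_char0 F_fin Ps) x) => /projCG_ker.
move=> N Ns; pose p := hm (projCG k_char0 F_fin Ps).
pose N' := hm (sinc B) @` (p @^-1` N).
have N's : submod N' by apply/image_submod/preimage_submod.
have [|_ [y _ <-]|N'A|BN'] := cov N' N's.
- move=> y Ay; have [z _ zy] := AB y Ay; exists z => //; change (N (p z)).
  by have -> : p z = 0; [apply/projCG_ker; rewrite /preimage /= zy | apply: lsub0 Ns.1].
- by exists y.
- left=> q Nq; have [y yq] := projCG_surj q; rewrite -yq.
  by apply/projCG_ker; apply: N'A; exists y => //; change (N (p y)); rewrite /p yq.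
right=> q; have [y <-] := projCG_surj q.
have [|y' Ny' /(sinc_inj k_char0 F_fin) <-//] := BN' (hm (sinc B) y).
by exists y.
Qed.

Lemma finite_lengthP X : finite_length X.
Proof.
have [m [L [Ls L0 Lm Lc]]] := covers_chain (CG_std k_char0 F_fin X).
exists m, (fun i => subobj_of k_char0 F_fin (Ls i)); split.
- by apply/(zero_Im k_char0 F_fin); rewrite Im_subobj_of L0.
- by apply/(sub_leP k_char0 F_fin); rewrite Im_subobj_of Lm.
by move=> i im; apply: covers_simple; rewrite !Im_subobj_of; apply: Lc.
Qed.

Lemma CG_locally_artinian : locally_artinian C.
Proof.
move=> X; split=> [B|V VB]; first by apply/(sub_leP k_char0 F_fin); rewrite Im_subT.
exact: (VB (exist _ (subT X) (finite_lengthP X))).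
Qed.

Lemma subquo_simple X (A B : subobj X) Q : simple_obj Q -> is_subquo A B Q ->
  Im A `<=` Im B /\ exists x, Im B x /\ ~ Im A x.
Proof.
move=> /(simpleP k_char0 F_fin)[[q q0] _] /(is_subquoP k_char0 F_fin)[AB [p [ps pk]]].
split=> //; have [y yq] := ps q; exists (hm (sinc B) y); split; first by exists y.
by move=> /pk py; apply: q0; rewrite -yq.
Qed.

Lemma comp_factor_zero X Q : is_zero X -> ~ is_comp_factor Q X.
Proof.
move=> /is_zeroP X0 [Qs [B [m [L [_ /card_gt0P[i]]]]]].
rewrite inE => iQ; have [_ [x [_ Ax]]] := subquo_simple Qs iQ; apply: Ax.
have -> : x = 0; last exact: lsub0 (Im_submod _).1.
by apply: (sinc_inj k_char0 F_fin); rewrite hom0; apply: X0.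
Qed.

(** Only one step of a chain of subobjects of a simple object is proper. *)
Lemma finite_mult_simple X Q : simple_obj X -> simple_obj Q -> finite_mult X Q.
Proof.
move=> /(simpleP k_char0 F_fin)[_ Xs] Qs; exists 1%N => B m L [_ _ Ls].
have sB (N : set (md (sdom B))) : submod N -> N `<=` [set 0] \/ forall x, N x.
  move=> Ns; have [N0|NT] := Xs _ (image_submod (hm (sinc B)) Ns).
    left=> x Nx; apply: (sinc_inj k_char0 F_fin); rewrite hom0; apply: N0.
    by exists x.
  by right=> x; have [y Ny /(sinc_inj k_char0 F_fin) <-] := NT (hm (sinc B) x).
have Lmono i j : (i <= j <= m)%N -> Im (L i) `<=` Im (L j).
  elim: j => [|j IH]; first by rewrite leqn0 => /andP[/eqP-> _].
  move=> /andP[]; rewrite leq_eqVlt => /predU1P[->|ij] jm x Lx //.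
  have [Q' [Q's /(subquo_simple Q's)[jj _]]] := Ls j jm.
  by apply/jj/IH => //; rewrite -ltnS ij (ltnW jm).
have lt_no (i j : 'I_m) : (i < j)%N -> is_subquo (L i) (L i.+1) Q ->
    is_subquo (L j) (L j.+1) Q -> False.
  move=> ij /(subquo_simple Qs)[_ [x [Lx nx]]] /(subquo_simple Qs)[_ [y [_ ny]]].
  have [L0|LT] := sB _ (Im_submod (L i.+1)).
    by apply: nx; rewrite (L0 x Lx); apply: lsub0 (Im_submod _).1.
  by apply: ny; apply: (Lmono i.+1) (LT y); rewrite ij ltnW.
apply/card_le1_eqP => i j; rewrite !inE => iQ jQ; apply: val_inj.
by have [ij|ij|//] := ltngtP i j; [case: (lt_no i j) | case: (lt_no j i)].
Qed.

End Length.

(** * Injective objects *)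

Section Injectives.
Context (F : closedFieldType) (k : fieldType).
Hypothesis k_char0 : [pchar k] =i pred0.
Hypothesis F_fin : locally_finite_field F.
Local Notation C := (CG F k).
Local Notation FM := (function_gmod F k).
Implicit Types (X I : C) (M : gmod k (SL2 F)) (l : torus_char F k) (o : option (torus_char F k)).

Lemma injective_steinberg_split I : steinberg_split (md I) -> injective_obj I.
Proof.
move=> Icrit X Y i f /(monoP k_char0 F_fin) ii; pose P := product_gmod (md Y) (md I).
have fl : linear (fun x : md X => (hm i x, hm f x) : P).
  by move=> a u v; rewrite !homD !homZ.
have fg g (v : md X) : ((hm i (gact g v), hm f (gact g v)) : P)
    = gact g ((hm i v, hm f v) : P) by rewrite !gmod_hom_act.
have Ds := image_submod (mkhom fl fg) (setT_submod _).
have [|h hE] := hom_extend k_char0 F_fin Icrit (CG_std k_char0 F_fin Y) Ds.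
  by move=> y [x _ [ix <-]]; rewrite (ii x 0) ?hom0.
by exists (mo h); apply: mor_eq => x; rewrite compcE; apply: hE; exists x.
Qed.

(** Not to be confused with all the Steinberg vectors: equality of the two sets is
    [steinberg_split]. *)
Definition augs M : set M := [set e | exists2 z : M, Uweight chi_one z & wact z - z = e].

Lemma lsub_augs M : lsub (@augs M).
Proof.
have [Ul0 Ul] := lsub_Uweight M chi_one; split; first by exists 0 => //; rewrite gact0 subr0.
move=> r _ _ [u uU <-] [v vU <-]; exists (r *: u + v); first exact: Ul.
by rewrite gactD gactZ opprD addrACA scalerBr.
Qed.

Lemma augs_hom M M' (f : gmod_hom M M') e : augs e -> augs (f e).
Proof.
move=> [z zU <-]; exists (f z); first exact: (std_hom f (o := Some chi_one)).
by rewrite homB gmod_hom_act.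
Qed.

Lemma steinberg_split_gens M (gs : seq M) :
  (forall g, g \in gs -> exists o, std o g /\ (o = None -> augs g)) ->
  (forall N, submod N -> (forall g, g \in gs -> N g) -> forall m, N m) ->
  steinberg_split M.
Proof.
move=> gstd ggen e es.
apply: (steinberg_in_span k_char0 F_fin (@lsub_augs M) _ gstd ggen es).
by move=> v vU; exists v.
Qed.

(** These objects contain no nonzero Steinberg vector. *)
Lemma Sobj_injective l : injective_obj (Sobj k_char0 F_fin (Some l)).
Proof.
apply: injective_steinberg_split => e es; exists 0.
  exact: lsub0 (lsub_Uweight _ _).
rewrite gact0 subr0; apply: contrapT => /nesym e0.
by have [] := Sobj_std (es : std None e) e0.
Qed.

(** ** The injective envelope of the Steinberg module *)

(** The module spanned by the indicator functions of the cosets [gB], that is, the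
    module induced from the trivial character of [B]. *)
Lemma env_submod : submod (addset (cell None (@fgen F k None))
  (cell (Some chi_one) (feta chi_one : FM))).
Proof.
have fs := @fgen_submod F k None.
apply: (addset_cell_submod fs (o := Some chi_one)); first exact: feta_std.
by move=> _; apply: (@cell_id _ _ _ None).
Qed.

Definition env := submodule_gmod env_submod.
Definition env_eta : env := sub_elt env_submod
  (addsetr (lsub_cell None (@fgen F k None)) (cell_id (Some chi_one) (feta chi_one : FM))).
Definition env_st : env := wact env_eta - env_eta.

Lemma env_eta_std : Uweight chi_one env_eta.
Proof.
apply: (std_hom_inj (o := Some chi_one) (@sub_incl_inj _ _ _ _ env_submod)).
exact: feta_std.
Qed.

Lemma env_st_std : steinberg_vector env_st.
Proof. exact: steinberg_aug env_eta_std. Qed.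

Lemma env_st_neq0 : env_st <> 0.
Proof. by move=> /(congr1 (fun x => sub_val x)); apply: (@fgen_neq0 F k None). Qed.

Lemma env_eta_neq0 : env_eta <> 0.
Proof. by move=> e0; apply: env_st_neq0; rewrite /env_st e0 gact0 subr0. Qed.

Lemma cell_one M (g z : M) : cell (Some (chi_one : torus_char F k)) g z -> exists r, z = r *: g.
Proof. by rewrite /= eqxx. Qed.

Lemma env_split (x : env) : exists w r, Uspan env_st w /\ x = w + r *: env_eta.
Proof.
have [y [z [yU /cell_one[r zE] xE]]] := sub_valX x.
have [w wU wy] := (hom_Uspan (sub_incl env_submod) env_st y).1 yU.
by exists w, r; split=> //; apply: (@sub_incl_inj _ _ _ _ env_submod); rewrite homD homZ wy -zE.
Qed.

Lemma env_gen (N : set env) : submod N -> N env_eta -> forall x, N x.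
Proof.
move=> Ns Ne x; have [w [r [wU ->]]] := env_split x.
have Nst : N env_st by apply: (lsubB Ns.1) => //; apply: Ns.2.
by apply: (lsubD Ns.1); [apply: (cell_sub (o := None) Ns Nst) | apply: (lsubZ Ns.1)].
Qed.

Lemma env_std_generated : std_generated env.
Proof.
exists [:: env_eta]; split=> [g|N Ns Ng].
  by rewrite inE => /eqP->; exists (Some chi_one); apply: env_eta_std.
by apply: (env_gen Ns); apply: Ng; rewrite mem_head.
Qed.

Definition Env : C := mkCG k_char0 F_fin env_std_generated.

Lemma Env_injective : injective_obj Env.
Proof.
apply/injective_steinberg_split/(steinberg_split_gens (gs := [:: env_eta])).
  by move=> g; rewrite inE => /eqP->; exists (Some chi_one); split; first exact: env_eta_std.
by move=> N Ns Ng; apply: (env_gen Ns); apply: Ng; rewrite mem_head.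
Qed.

Lemma Uspan_Ufixed0 M e w : steinberg_vector e -> Uspan (e : M) w -> Ufixed w -> w = 0.
Proof.
move=> es wU fw; have ew := std_weight (es : std None e).
have [fe|fr] := Ufixed_or_Ufree k_char0 F_fin ew; last exact: Uspan_free_Ufixed F_fin _ _ fr wU fw.
by apply: Uspan0; rewrite (steinberg_Ufixed0 es fe) in wU.
Qed.

(** Write [x = w + r eta] with [w] in the Steinberg module. Either some
    [x(b) x - x = x(b) w - w] is a nonzero element of the Steinberg module, or [w]
    is fixed by [U], hence zero, and [x] is a multiple of the generator [eta]. *)
Lemma env_essential (N : set env) x : submod N -> N x -> x <> 0 -> N env_st.
Proof.
move=> Ns Nx x0; have simp w : Uspan env_st w -> w <> 0 -> N w -> N env_st.
  by move=> wU w0; apply: (cell_simple k_char0 F_fin Ns (o := None) env_st_std wU).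
have [w [r [wU xE]]] := env_split x.
have [fw|nfw] := pselect (forall b, xact b w = w); last first.
  have [b wb] : exists b, xact b w <> w.
    by apply: contrapT => no; apply: nfw => b; apply: contrapT => wb; apply: no; exists b.
  apply: (simp (xact b w - w)).
  - by apply: (lsubB (lsub_Uspan _)) => //; apply: Uspan_xact.
  - by move=> /eqP; rewrite subr_eq0 => /eqP.
  have -> : xact b w - w = xact b x - x.
    by rewrite xE gactD gactZ env_eta_std.1 opprD addrACA subrr addr0.
  by apply: (lsubB Ns.1) => //; apply: Ns.2.
have w0 : w = 0 by apply: Uspan_Ufixed0 env_st_std wU _.
move: x0 Nx; rewrite xE w0 add0r => re0 /(lsubZ_inv Ns.1)Ne.
apply: (env_gen Ns); apply: Ne; apply/eqP => r0; apply: re0.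
by rewrite r0 scale0r.
Qed.

Lemma Sobj_hom_inj o M (h : gmod_hom (md (Sobj k_char0 F_fin o)) M) :
  h (Sgen k_char0 F_fin o) <> 0 -> injective h.
Proof.
move=> hg; apply: hom_inj => z hz; apply: contrapT => z0; apply: hg.
exact: (Sobj_gen (ker_submod h) hz z0).
Qed.

Lemma st_env_exists : exists h : gmod_hom (md (Sobj k_char0 F_fin None)) env,
  h (Sgen k_char0 F_fin None) = env_st.
Proof. by apply: Sobj_hom => //; apply: env_st_std. Qed.

End Injectives.

(** * Injective envelopes and their filtrations *)

Section Types.
Context (F k : fieldType).

Definition simple_label := option (torus_char F k).
HB.instance Definition _ := Choice.on simple_label.
Implicit Types x y : simple_label.

(** [None] stands for the Steinberg module and [Some chi_one] for the trivial one,
    which is the second layer of the injective envelope of the former; the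
    envelopes of the other simple objects have one layer. *)
Definition label_le x y := (x == y) || (x == None) && (y == Some chi_one).

Fact label_le_refl : reflexive label_le.
Proof. by move=> x; rewrite /label_le eqxx. Qed.

Fact label_le_anti : antisymmetric label_le.
Proof.
by move=> x y /andP[/orP[/eqP//|/andP[/eqP-> /eqP->]] /orP[/eqP|/andP[/eqP]]].
Qed.

Fact label_le_trans : transitive label_le.
Proof.
move=> y x z /orP[/eqP->//|/andP[/eqP-> /eqP->]] /orP[/eqP<-|/andP[/eqP//]].
by rewrite /label_le !eqxx orbT.
Qed.

HB.instance Definition _ := Order.Le_isPOrder.Build (Order.Disp tt tt) simple_label
  label_le_refl label_le_anti label_le_trans.

Lemma label_leE x y : (x <= y)%O = (x == y) || (x == None) && (y == Some chi_one).
Proof. by []. Qed.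

Lemma label_locally_finite : locally_finite simple_label.
Proof.
move=> x y; apply: (@sub_finite_set _ _ ([set x] `|` [set y])).
  move=> z /= /andP[]; rewrite !label_leE => /orP[/eqP->|/andP[_ /eqP->]]; first by left.
  by move=> /orP[/eqP->|/andP[/eqP]]; [right|].
by rewrite finite_setU; split; apply: finite_set1.
Qed.

Lemma steinberg_lt_trivial : ((None : simple_label) < Some chi_one)%O.
Proof. by rewrite lt_neqAle label_leE !eqxx orbT. Qed.

End Types.

Section Envelopes.
Context (F : closedFieldType) (k : fieldType).
Hypothesis k_char0 : [pchar k] =i pred0.
Hypothesis F_fin : locally_finite_field F.
Local Notation C := (CG F k).
Local Notation Sob := (Sobj k_char0 F_fin).
Local Notation Sge := (Sgen k_char0 F_fin).
Local Notation env := (env F k).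
Local Notation Env := (Env k_char0 F_fin).
Implicit Types (X I : C) (l : torus_char F k) (o : simple_label F k).

Lemma envelope_idc X : injective_obj X -> injective_envelope (idc X).
Proof.
move=> Xi; split=> //; exists (@mono_idc _ _ X) => A M A0 [_ _ M_max] M0; apply: A0.
apply/(zero_Im k_char0 F_fin) => x Ax; apply: ((zero_Im k_char0 F_fin M).1 M0).
move: x Ax; apply/(sub_leP k_char0 F_fin)/M_max; last by exists (idc _); rewrite compc1.
by exists (sinc A); rewrite comp1c.
Qed.

(** ** The Steinberg module in its envelope *)

Lemma st_env : {h : mor (Sob None) Env | hm h (Sge None) = env_st F k}.
Proof.
apply: cid; have [h hE] := st_env_exists k_char0 F_fin.
by exists (mo (Y := Env) h).
Qed.

Definition st_mor : mor (Sob None) Env := sval st_env.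

Lemma st_mor_inj : injective (hm st_mor).
Proof.
by apply: (Sobj_hom_inj (k_char0 := k_char0) (F_fin := F_fin)); rewrite (svalP st_env); apply: env_st_neq0.
Qed.

Lemma st_mor_range : range (hm st_mor) = cell None (env_st F k).
Proof.
apply/seteqP; split=> z.
  move=> [x _ <-]; rewrite -(svalP st_env); apply/cell_hom; exists x => //.
  exact: Sobj_cell.
by rewrite -(svalP st_env) => /cell_hom[x _ <-]; exists x.
Qed.

Definition st_sub : subobj Env := Subobj ((monoP k_char0 F_fin st_mor).2 st_mor_inj).

Lemma st_envelope : injective_envelope st_mor.
Proof.
split; first exact: Env_injective.
exists ((monoP k_char0 F_fin st_mor).2 st_mor_inj) => A M A0 [_ _ M_max] M0.
have Nst : Im A (env_st F k).
  apply: contrapT => nA; apply: A0; apply/(zero_Im k_char0 F_fin) => x Ax.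
  apply: contrapT => x0; apply: nA.
  exact: env_essential (Im_submod A) Ax x0.
have Ss : submod (cell None (env_st F k)).
  by apply: cell_submod => //; apply: env_st_std.
have /(sub_leP k_char0 F_fin) NM : sub_le (subobj_of k_char0 F_fin (X := Env) Ss) M.
  apply: M_max; apply/(sub_leP k_char0 F_fin); rewrite Im_subobj_of.
    by rewrite -st_mor_range.
  exact: cell_sub (Im_submod A) Nst.
apply: (@env_st_neq0 F k); apply: ((zero_Im k_char0 F_fin M).1 M0).
by apply: NM; rewrite Im_subobj_of; apply: cell_id.
Qed.

(** The image of [eta] in the quotient is fixed by [G], so it is the image of the
    generator of the trivial module under an isomorphism. *)
Lemma quotient_st_trivial : exists p : mor (sdom (subT Env)) (Sob (Some chi_one)),
  (forall q, exists x, hm p x = q) /\ (forall x, hm p x = 0 <-> cell None (env_st F k) x).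
Proof.
have Ss : submod (cell None (env_st F k)).
  by apply: cell_submod => //; apply: env_st_std.
pose q := quo_proj Ss.
have qst : q (env_st F k) = 0 by apply/quo_proj_ker; apply: cell_id.
have [||h hE] := Sobj_hom k_char0 F_fin (o := Some chi_one) (g := q (env_eta F k)).
- exact: (std_hom q (o := Some chi_one) (env_eta_std F k)).
- move=> _; apply/eqP; rewrite -subr_eq0 -gmod_hom_act -homB; apply/eqP.
  exact: qst.
have hi : injective h.
  apply: Sobj_hom_inj; rewrite hE => /quo_proj_ker eta_st.
  apply: (@env_eta_neq0 F k); apply: (Uspan_Ufixed0 k_char0 F_fin (@env_st_std F k) eta_st).
  by have [] := env_eta_std F k.
have hs x : exists y, h y = q x.
  have [w [r [wU ->]]] := env_split x; exists (r *: Sge (Some chi_one)).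
  rewrite homZ hE homD homZ; have -> : q w = 0 by apply/quo_proj_ker.
  by rewrite add0r.
have [p pE] := hom_lift hi hs.
exists (mo (X := Env) p); split=> [y|x].
  have [x xy] := quo_proj_surj (h y); exists x; apply: hi.
  by rewrite pE.
apply: (iff_trans _ (quo_proj_ker Ss x)); rewrite -/q -pE.
by split=> [->|hp]; [rewrite hom0 | apply: hi; rewrite hom0].
Qed.

(** ** Good filtrations *)

Lemma is_union_max X (J : Type) (A : J -> subobj X) j :
  sub_le (subT X) (A j) -> is_union A (subT X).
Proof.
move=> Aj; split=> [i|V VA]; first by apply/(sub_leP k_char0 F_fin); rewrite Im_subT.
by have [f fE] := VA j; have [g gE] := Aj; exists (f \c g); rewrite Defs.compA fE.
Qed.

Definition zero_sub X : subobj X := subobj_of k_char0 F_fin (set0_submod (md X)).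

Lemma zero_subP X : is_zero (sdom (zero_sub X)).
Proof. by apply/(zero_Im k_char0 F_fin); rewrite Im_subobj_of. Qed.

Lemma zero_sub_le X (A : subobj X) : sub_le (zero_sub X) A.
Proof.
apply/(sub_leP k_char0 F_fin); rewrite Im_subobj_of => _ ->.
exact: lsub0 (Im_submod A).1.
Qed.

Lemma sub_le_subT X (A : subobj X) : sub_le A (subT X).
Proof. by apply/(sub_leP k_char0 F_fin); rewrite Im_subT. Qed.

Lemma isomorphic_refl X : isomorphic X X.
Proof. by exists (idc X), (idc X); rewrite comp1c. Qed.

Lemma good_filtration_self o : good_filtration (Sob : simple_label F k -> C) o
  (Some 1%N) (fun n => if n is 0%N then zero_sub (Sob o) else subT (Sob o)) (fun=> o).
Proof.
split; first exact: zero_subP.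
- by case=> // _; apply: zero_sub_le.
- by split=> //; apply: isomorphic_refl.
split=> [n n1|m|].
- by rewrite /= leqNgt n1.
- apply: (@sub_finite_set _ _ set0) => [n [n1 /=]|]; last exact: finite_set0.
  by rewrite leqNgt n1.
by apply: (is_union_max (j := exist (in_range (Some 1%N)) 1%N isT)); apply: sub_le_subT.
Qed.

Lemma good_filtration_env : good_filtration (Sob : simple_label F k -> C) None
  (Some 2%N) (fun n => match n with
    0%N => zero_sub Env | 1%N => st_sub | _ => subT Env end) (fun=> Some chi_one).
Proof.
split; first exact: zero_subP.
- by case=> [_|[_|//]]; [apply: zero_sub_le | apply: sub_le_subT].
- by split=> //; apply: isomorphic_refl.
split=> [[|[|[|n]]] //= _ _|m|].
- split; last exact: steinberg_lt_trivial.
  have [p [ps pk]] := quotient_st_trivial.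
  apply: (is_subquoI k_char0 F_fin (A := st_sub) (B := subT Env) (p := p)) => //.
    by rewrite Im_subT.
  by move=> y; rewrite pk [Im _]st_mor_range.
- apply: (@sub_finite_set _ _ [set 2%N]) => [n [n1 n2 _] /=|]; last exact: finite_set1.
  by apply/eqP; rewrite eqn_leq n1 andbT.
by apply: (is_union_max (j := exist (in_range (Some 2%N)) 2%N isT)); apply: sub_le_subT.
Qed.

Lemma exists_envelope o : exists (I : C) (i : mor (Sob o) I), injective_envelope i /\
  exists len L mu, good_filtration (Sob : simple_label F k -> C) o (I := I) len L mu.
Proof.
case: o => [l|]; last first.
  exists Env, st_mor; split; first exact: st_envelope.
  by do 3![eexists]; apply: good_filtration_env.
exists (Sob (Some l)), (idc _); split; first exact/envelope_idc/Sobj_injective.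
by do 3![eexists]; apply: good_filtration_self.
Qed.

(** ** Enough injectives *)

(** Induction on the number of Steinberg generators that are not yet of the form
    [s z - z] with [z] fixed by [B]. For such a generator [e], the module [X] embeds
    into its pushout with the induced module along the Steinberg module, which
    identifies [e] with [s eta - eta]. *)
Lemma embed_injective n X (bad : seq (md X)) (gs : seq (md X)) :
  size bad = n -> (forall e, e \in bad -> steinberg_vector e) ->
  (forall g, g \in gs -> exists o, std o g /\ (o = None -> g \in bad \/ augs g)) ->
  (forall N, submod N -> (forall g, g \in gs -> N g) -> forall m, N m) ->
  exists (I : C) (i : mor X I), injective_obj I /\ mono i.
Proof.
elim: n X bad gs => [|n IH] X bad gs.
  move=> /eqP; rewrite size_eq0 => /eqP-> _ gstd ggen.
  exists X, (idc X); split; last exact: mono_idc.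
  apply/(injective_steinberg_split k_char0 F_fin)/(steinberg_split_gens k_char0 F_fin _ ggen).
  by move=> g /gstd[o [og oZ]]; exists o; split=> // /oZ[].
case: bad => [//|e bad] [sz] bads gstd ggen.
have es : steinberg_vector e by apply: bads; rewrite mem_head.
have {}bads b : b \in bad -> steinberg_vector b by move=> bb; apply: bads; rewrite inE bb orbT.
have [ae|ne] := pselect (augs e).
  apply: (IH X bad gs) => // g /gstd[o [og oZ]]; exists o; split=> //.
  by move=> /oZ[]; [rewrite inE => /predU1P[->|]; [right | left] | right].
have e0 : e <> 0 by move=> e0; apply: ne; rewrite e0; apply: lsub0 (@lsub_augs _ _ _).
pose P := product_gmod (md X) env.
pose z : P := (e, - env_st F k).
have zs : steinberg_vector z.
  apply: (std_pair (o := None)) => //; apply: (lsubN (lsub_steinberg _)).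
  exact: env_st_std.
have Ks : submod (cell None z) by apply: cell_submod.
pose q := quo_proj Ks.
have Qs : std_generated (quotient_gmod Ks).
  apply: quo_std_generated; apply: prod_std_generated; first exact: CG_std.
  exact: env_std_generated.
pose X' := mkCG k_char0 F_fin Qs.
pose j : gmod_hom (md X) (quotient_gmod Ks) := gmod_comp q (in1 (md X) env).
pose j2 : gmod_hom env (quotient_gmod Ks) := gmod_comp q (in2 (md X) env).
have ji : injective j.
  apply: hom_inj => x /quo_proj_ker xK; apply: contrapT => x0.
  have xP0 : in1 (md X) env x <> 0 by move=> /(congr1 (pr1 _ _)).
  have /= := cell_simple k_char0 F_fin (o := None) (ker_submod (pr2 (md X) env)) zs xK xP0 erefl.
  by move=> /eqP; rewrite oppr_eq0 => /eqP; apply: env_st_neq0.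
have jst : j2 (env_st F k) = j e.
  apply/eqP; rewrite -subr_eq0; apply/eqP.
  change (q (in2 (md X) env (env_st F k)) - q (in1 (md X) env e) = 0).
  rewrite -homB; apply/quo_proj_ker.
  have -> : in2 (md X) env (env_st F k) - in1 (md X) env e = - z.
    by transitivity ((0 - e, env_st F k - 0) : P); rewrite // sub0r subr0 /z -[X in (_, X)]opprK.
  by apply: (lsubN (lsub_cell _ _)); apply: cell_id.
have je : augs (j e).
  rewrite -jst; apply: augs_hom; exists (env_eta F k) => //; exact: env_eta_std.
have [||||I [i [Ii im]]] := IH X' (map j bad) (rcons (map j gs) (j2 (env_eta F k))).
- by rewrite size_map.
- by move=> _ /mapP[b /bads bs ->]; apply: (std_hom j (o := None)).
- move=> g; rewrite mem_rcons inE => /predU1P[->|/mapP[g' /gstd[o [og oZ]] ->]].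
    exists (Some chi_one); split=> //.
    by apply: (std_hom j2 (o := Some chi_one)); apply: env_eta_std.
  exists o; split; first exact: std_hom.
  move=> /oZ[]; last by right; apply: augs_hom.
  by rewrite inE => /predU1P[->|/(map_f j)]; [right | left].
- move=> N Ns Ng y; have [[x w] <-] := quo_proj_surj y.
  rewrite pair_in12 homD; apply: (lsubD Ns.1).
    apply: (ggen _ (preimage_submod j Ns)) => g gg; apply: Ng.
    by rewrite mem_rcons inE map_f ?orbT.
  apply: (env_gen (preimage_submod j2 Ns)); apply: Ng.
  by rewrite mem_rcons mem_head.
exists I, (i \c mo (Y := X') j); split=> //; apply/(monoP k_char0 F_fin) => x y.
by rewrite !compcE => /(monoP k_char0 F_fin i).1 => /(_ im)/ji.
Qed.

Lemma CG_enough_injectives : enough_injectives C.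
Proof.
move=> X; have [gs [gstd ggen]] := CG_std k_char0 F_fin X.
apply: (@embed_injective _ X [seq g <- gs | `[< steinberg_vector g >]] gs erefl) => //.
  by move=> e; rewrite mem_filter => /andP[/asboolP].
move=> g gg; have [o og] := gstd g gg; exists o; split=> // oE; left.
by rewrite mem_filter gg andbT; apply/asboolP; rewrite oE in og.
Qed.

Theorem CG_highest_weight : highest_weight_category C.
Proof.
split.
- exact: CG_locally_artinian.
- exact: CG_abelian.
- exact: CG_enough_injectives.
- exact: CG_grothendieck.
exists _, (simple_label F k), Sob, Sob, (fun o => idc (Sob o)); split.
- exact: label_locally_finite.
- exact: complete_Sobj.
- move=> o; split; first exact: mono_idc.
  move=> Q p /(is_cokernelE k_char0 F_fin)[ps pk] m /comp_factor_zero-[]//.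
  apply/is_zeroP => y; have [x <-] := ps y; apply/pk; exists x.
  by rewrite idcE.
- move=> o m; split; first exact: Sobj_mor_dim.
  by apply: (finite_mult_simple k_char0 F_fin); apply: Sobj_simple.
exact: exists_envelope.
Qed.

End Envelopes.

Theorem theorem5p5 (Fq : finFieldType) (F : closedFieldType)
    (iota : {rmorphism Fq -> F}) (F_alg : forall x : F, algebraicOver iota x)
    (k : closedFieldType) (k_char0 : [pchar k] =i pred0) :
  highest_weight_category (CG F k).
Proof.
exact: (CG_highest_weight k_char0 (locally_finite_algebraic_closure F_alg)).
Qed.
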